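(* Let $p$ be a differentiable weight exponent function such that $\lim_{r\to\infty}p'(r)=\infty$. Then every proper closed invariant subspace of the integration operator $J$, $Jf(z)=\int_0^zf(\zeta)\,d\zeta$, on $E=A^0_p(\mathbb{C})$ or on $E=A_p(\mathbb{C})$ is of the form $$A^E_K=\{f\in E \mid f^{(j)}(0)=0,\ 0\le j<K\}$$ for some $K\in\mathbb{N}$. This conclusion holds in particular for $p(z)=\alpha|z|^s$ with $\alpha>0$, $s>1$, and for $p(z)=e^{|z|}$.
   Context: $\mathbb{N}=\{1,2,3,\dots\}$; $H(\mathbb{C})$ is the space of entire functions. A function $p:\mathbb{C}\to\,]0,\infty[$ is a weight exponent function if: (w1) $p$ is continuous and subharmonic; (w2) $p$ is radial, $p(z)=p(|z|)$; (w3) $\log(1+|z|^2)=o(p(z))$ as $|z|\to\infty$; (w4) $p$ is doubling, i.e. $p(2z)=O(p(z))$ as $|z|\to\infty$. Differentiability and $p'$ refer to $p$ as a function $r\mapsto p(r)$ of $r=|z|\in[0,\infty[$. For a continuous function $p:\mathbb{C}\to[0,\infty[$ define $$A_p(\mathbb{C}):=\{f\in H(\mathbb{C}):\ \text{there is } A>0 \text{ with } \sup_{z\in\mathbb{C}}|f(z)|e^{-Ap(z)}<\infty\},$$ endowed with the inductive limit topology, i.e. the finest locally convex topology for which the inclusions of the Banach spaces $\{f\in H(\mathbb{C}):\sup_z|f(z)|e^{-np(z)}<\infty\}$, $n\in\mathbb{N}$ (normed by the indicated supremum), are continuous; and $$A^0_p(\mathbb{C}):=\{f\in H(\mathbb{C}):\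 \text{for all }\varepsilon>0,\ \sup_{z\in\mathbb{C}}|f(z)|e^{-\varepsilon p(z)}<\infty\},$$ endowed with the projective limit (Fréchet) topology given by the norms $\sup_z|f(z)|e^{-p(z)/n}$, $n\in\mathbb{N}$. The operator $J$ is continuous on these spaces. A subspace $M$ of a locally convex space $E$ is proper if $\{0\}\ne M\ne E$, and is invariant for a continuous linear operator $T:E\to E$ if $T(M)\subset M$. *)

(* Defs.v *)
From HB Require Import structures.
From mathcomp Require Import all_boot all_order all_algebra finmap.
From mathcomp Require Import all_classical all_reals all_analysis.
From mathcomp Require Import complex.

Set Implicit Arguments.
Unset Strict Implicit.
Unset Printing Implicit Defensive.

Import Order.TTheory GRing.Theory Num.Theory numFieldNormedType.Exports.

Local Open Scope classical_set_scope.
Local Open Scope ring_scope.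

HB.instance Definition _ (R : rcfType) := NormedModule.copy R[i] R[i]^o.

(* The real-valued modulus (the norm of R[i] takes its values in R[i]). *)
Definition cabs (R : realType) (z : R[i]) : R := complex.Re `|z|.

Section cabs_lemmas.
Variable R : realType.
Implicit Types z w : R[i].

Lemma cabsE z : (cabs z)%:C%C = `|z|.
Proof. by case: z => a b; rewrite /cabs normc_def. Qed.

Lemma cabs_ge0 z : 0 <= cabs z.
Proof. by rewrite -ler0c cabsE. Qed.

Lemma cabsM z w : cabs (z * w) = cabs z * cabs w.
Proof. by apply: complexI; rewrite rmorphM/= !cabsE normrM. Qed.

Lemma cabsD z w : cabs (z + w) <= cabs z + cabs w.
Proof. by rewrite -lecR rmorphD/= !cabsE ler_normD. Qed.

Lemma cabs0 : cabs (0 : R[i]) = 0.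
Proof. by apply: complexI; rewrite cabsE normr0. Qed.

Lemma cabs0_eq0 z : cabs z = 0 -> z = 0.
Proof. by move=> z0; apply: normr0_eq0; rewrite -cabsE z0. Qed.

End cabs_lemmas.

Section weights.
Variable R : realType.
Implicit Type p : R[i] -> R.

(* The filter |z| -> oo. *)
Definition cinfty : set_system R[i] :=
  [set A | exists M : R, forall z, M < cabs z -> A z].

Definition circle_point (z : R[i]) (r t : R) : R[i] :=
  z + ((r * cos t) +i* (r * sin t))%C.

(* For a continuous function, subharmonicity on the plane is the sub-mean
   value property on every circle. *)
Definition subharmonic p := forall z (r : R), 0 < r ->
  p z <= (2 * pi)^-1 *
         Rintegral lebesgue_measure `[0, 2 * pi] (fun t => p (circle_point z r t)).

Record weight_exponent p : Prop := {
  weight_gt0 : forall z, 0 < p z ;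
  weight_continuous : continuous p ;
  weight_subharmonic : subharmonic p ;
  weight_radial : forall z, p z = p (cabs z)%:C%C ;
  weight_log : forall e : R, 0 < e ->
    cinfty [set z | `|ln (1 + cabs z ^+ 2)| <= e * p z] ;
  weight_doubling : exists c : R, cinfty [set z | p (2 * z) <= c * p z]
}.

Definition radial_part p (r : R) : R := p r%:C%C.

(* Differentiability of r |-> p r on [0, +oo[, hence one-sided at 0: the
   two-sided derivative at 0 of the even function r |-> p |r| would have to
   vanish. *)
Definition radially_differentiable p :=
  (forall r : R, 0 < r -> derivable (radial_part p) r 1) /\
  cvg (h^-1 * (radial_part p h - radial_part p 0) @[h --> 0^'+]).

End weights.

Section entire_functions.
Variable R : realType.
Local Notation C := R[i].
Implicit Types (q : C -> R) (f : C -> C).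

Definition entire f := forall z : C, derivable f z 1.

Definition weighted f q : set R := range (fun z => cabs (f z) * expR (- q z)).

Lemma entireD (a : C) f g : entire f -> entire g -> entire (a *: f + g).
Proof.
by move=> hf hg z; apply: derivableD; [exact: derivableZ|exact: hg].
Qed.

Lemma entire0 : entire 0.
Proof. by move=> z; exact: derivable_cst. Qed.

Lemma weighted_ge0 f q x : weighted f q x -> 0 <= x.
Proof. by move=> [z _ <-]; rewrite mulr_ge0 ?cabs_ge0 ?expR_ge0. Qed.

Lemma has_ubound_weightedP f q :
  has_ubound (weighted f q) <->
  exists B, forall z, cabs (f z) * expR (- q z) <= B.
Proof.
split=> -[B hB]; exists B; first by move=> z; apply: hB; exists z.
by move=> _ [z _ <-].
Qed.

Lemma weighted0 q : has_ubound (weighted 0 q).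
Proof. by apply/has_ubound_weightedP; exists 0 => z; rewrite cabs0 mul0r. Qed.

Lemma weightedD (a : C) f g q : has_ubound (weighted f q) ->
  has_ubound (weighted g q) -> has_ubound (weighted (a *: f + g) q).
Proof.
move=> /has_ubound_weightedP[A hA] /has_ubound_weightedP[B hB].
apply/has_ubound_weightedP; exists (cabs a * A + B) => z.
have /le_trans -> // : cabs ((a *: f + g) z) * expR (- q z) <=
    cabs a * (cabs (f z) * expR (- q z)) + cabs (g z) * expR (- q z).
  by rewrite mulrA -mulrDl ler_wpM2r ?expR_ge0// -cabsM cabsD.
by rewrite lerD// ler_wpM2l ?cabs_ge0.
Qed.

Lemma weighted_le f q q' : (forall z, q z <= q' z) ->
  has_ubound (weighted f q) -> has_ubound (weighted f q').
Proof.
move=> qq' /has_ubound_weightedP[B hB]; apply/has_ubound_weightedP.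
exists B => z; apply: le_trans (hB z).
by rewrite ler_wpM2l ?cabs_ge0// ler_expR lerN2.
Qed.

End entire_functions.

(* The Banach space of the entire functions f with
   ||f|| = sup_z |f z| e^(- q z) < oo. *)
Section banach_step.
Variable R : realType.
Local Notation C := R[i].
Variable q : C -> R.

Definition step_pred : {pred C -> C} :=
  mem [set f | entire f /\ has_ubound (weighted f q)].

Record step := Step { step_val :> C -> C ; _ : step_val \in step_pred }.

HB.instance Definition _ := [isSub for step_val].
HB.instance Definition _ := [Choice of step by <:].

Lemma step_submod_closed : submod_closed step_pred.
Proof.
split; first by rewrite inE; split; [exact: entire0|exact: weighted0].
move=> a f g; rewrite !inE => -[hf bf] [hg bg].
by split; [exact: entireD|exact: weightedD].
Qed.

HB.instance Definition _ :=
  GRing.isSubmodClosed.Build _ _ step_pred step_submod_closed.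
HB.instance Definition _ := [SubChoice_isSubLmodule of step by <:].

Lemma stepP (f : step) : entire f /\ has_ubound (weighted f q).
Proof. by case: f => f /=; rewrite inE. Qed.

Definition step_norm (f : step) : R := sup (weighted f q).

Lemma step_norm_ub (f : step) z : cabs (f z) * expR (- q z) <= step_norm f.
Proof.
apply: sup_upper_bound; last by exists z.
by split; [exists (cabs (f 0) * expR (- q 0)), 0|have [] := stepP f].
Qed.

Lemma step_norm_le (f : step) B :
  (forall z, cabs (f z) * expR (- q z) <= B) -> step_norm f <= B.
Proof.
move=> hB; apply: ge_sup; first by exists (cabs (f 0) * expR (- q 0)), 0.
by move=> _ [z _ <-].
Qed.

Lemma step_norm_ge0 (f : step) : 0 <= step_norm f.
Proof.
by apply: le_trans (step_norm_ub f 0); rewrite mulr_ge0 ?cabs_ge0 ?expR_ge0.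
Qed.

Lemma step_normD (f g : step) : step_norm (f + g) <= step_norm f + step_norm g.
Proof.
apply: step_norm_le => z.
apply: le_trans (lerD (step_norm_ub f z) (step_norm_ub g z)).
by rewrite -mulrDl ler_wpM2r ?expR_ge0// cabsD.
Qed.

Lemma step_normZ_le (a : C) (f : step) :
  step_norm (a *: f) <= cabs a * step_norm f.
Proof.
apply: step_norm_le => z.
have -> : (a *: f : step) z = a * f z by [].
by rewrite cabsM -mulrA ler_wpM2l ?cabs_ge0 ?step_norm_ub.
Qed.

Lemma step_normZ (a : C) (f : step) :
  step_norm (a *: f) = cabs a * step_norm f.
Proof.
apply/eqP; rewrite eq_le step_normZ_le/=.
have [->|a0] := eqVneq a 0; first by rewrite cabs0 mul0r step_norm_ge0.
have := step_normZ_le a^-1 (a *: f); rewrite scalerA mulVf// scale1r.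
move=> /(ler_wpM2l (cabs_ge0 a)) /le_trans; apply.
by rewrite mulrA -cabsM divff// -[X in X * _]/(complex.Re `|1|) normr1 mul1r.
Qed.

Lemma step_norm0_eq0 (f : step) : step_norm f = 0 -> f = 0.
Proof.
move=> f0; apply: val_inj; apply/funext => z /=.
apply: cabs0_eq0; apply/eqP; rewrite eq_le cabs_ge0 andbT.
by have := step_norm_ub f z; rewrite f0 pmulr_lle0 ?expR_gt0.
Qed.

Definition step_normC (f : step) : C := (step_norm f)%:C%C.

Lemma step_normCD (f g : step) :
  step_normC (f + g) <= step_normC f + step_normC g.
Proof. by rewrite /step_normC -rmorphD lecR step_normD. Qed.

Lemma step_normCZ (a : C) (f : step) :
  step_normC (a *: f) = `|a| * step_normC f.
Proof. by rewrite /step_normC step_normZ rmorphM/= cabsE. Qed.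

Lemma step_normC0_eq0 (f : step) : step_normC f = 0 -> f = 0.
Proof. by move=> /complexI; exact: step_norm0_eq0. Qed.

HB.instance Definition _ := Lmodule_isNormed.Build C step
  step_normCD step_normCZ step_normC0_eq0.

End banach_step.

Section locally_convex_topology.
Variables (K : numDomainType) (E : lmodType K).

(* T is a locally convex vector space topology on the module E. *)
Definition lc_topology (T : Topological E) : Prop :=
  let TE := Topological.Pack T in
  [/\ continuous (fun x : TE * TE => (x.1 : E) + (x.2 : E) : TE),
      continuous (fun z : K^o * TE => (z.1 : K) *: (z.2 : E) : TE)
    & exists2 B : set_system TE,
        (forall b, b \in B -> convex_set (b : set (convex_lmodType E))) & basis B].

End locally_convex_topology.

Section Ap.
Variables (R : realType) (p : R[i] -> R).
Hypothesis p_ge0 : forall z, 0 <= p z.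
Local Notation C := R[i].

Definition Ap_pred : {pred C -> C} := mem [set f | entire f /\
  exists2 A : R, 0 < A & has_ubound (weighted f (fun z => A * p z))].

(* The type depends on [p_ge0] because [Ap_pred] is a vector space only for
   nonnegative p. *)
Record Ap (p0 : forall z, 0 <= p z) :=
  MkAp { Ap_val :> C -> C ; _ : Ap_val \in Ap_pred }.

HB.instance Definition _ := [isSub of Ap p_ge0 for @Ap_val p_ge0].
HB.instance Definition _ := [Choice of Ap p_ge0 by <:].

Lemma Ap_submod_closed : submod_closed Ap_pred.
Proof.
split.
  by rewrite inE; split; [exact: entire0|exists 1 => //; exact: weighted0].
move=> a f g; rewrite !inE => -[hf [A A0 bf]] [hg [B B0 bg]].
split; first exact: entireD.
exists (A + B); first exact: addr_gt0.
apply: weightedD; [apply: weighted_le bf|apply: weighted_le bg] => z.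
  by rewrite ler_wpM2r// lerDl ltW.
by rewrite ler_wpM2r// lerDr ltW.
Qed.

HB.instance Definition _ :=
  GRing.isSubmodClosed.Build _ _ Ap_pred Ap_submod_closed.
HB.instance Definition _ := [SubChoice_isSubLmodule of Ap p_ge0 by <:].

Definition Ap_step (n : nat) := step (fun z : C => n.+1%:R * p z).

Lemma Ap_step_subproof n (f : Ap_step n) : step_val f \in Ap_pred.
Proof.
rewrite inE; have [hf bf] := stepP f; split => //.
by exists n.+1%:R => //; rewrite ltr0n.
Qed.

Definition Ap_incl n (f : Ap_step n) : Ap p_ge0 :=
  MkAp p_ge0 (Ap_step_subproof f).

(* The locally convex topologies for which all the inclusions are continuous;
   the inductive limit topology is the finest one, i.e. their supremum (see
   [Ap_topology_admissible] below). *)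
Definition Ap_admissible (T : Topological (Ap p_ge0)) : Prop :=
  lc_topology T /\
  forall n, continuous (@Ap_incl n : Ap_step n -> Topological.Pack T).

Definition Ap_subbase : set_system (Ap p_ge0) :=
  [set U : set (Ap p_ge0) |
    exists2 T, Ap_admissible T & @open (Topological.Pack T) U].

HB.instance Definition _ := isSubBaseTopological.Build (Ap p_ge0) Ap_subbase id.

Lemma Ap_cvgP (F : set_system (Ap p_ge0)) (f : Ap p_ge0) : Filter F ->
  F --> f <-> forall T, Ap_admissible T -> F --> (f : Topological.Pack T).
Proof.
move=> FF; split=> [Ff T aT A /=|Ff A /=].
  rewrite (@nbhsE (Topological.Pack T)) => -[B [oB Bf] BA].
  apply: Ff; exists B => //; split=> //; exists [set B];
    last by rewrite bigcup_set1.
  move=> _ ->; exists [fset B]%fset; last first.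
    rewrite predeqE => g; split=> [|Bg V].
      by apply; rewrite /= inE.
    by rewrite /= inE => /eqP ->.
  by move=> V; rewrite inE inE => /eqP ->; exists T.
rewrite (@nbhsE (Ap p_ge0)) => -[_ [[B sB <-] [U BU Uf] sBA]].
rewrite nbhs_filterE; apply: filterS sBA _; apply: (@filterS _ _ _ U).
  by move=> g Ug; exists U.
have [D sD DU] := sB _ BU; rewrite -DU; apply: filter_bigI => V DV.
have /[!inE] -[T aT oV] := sD _ DV.
apply: (Ff T aT); rewrite (@nbhsE (Topological.Pack T)).
by exists V => //; split => //; move: Uf; rewrite -DU; exact.
Qed.

Lemma Ap_topology_finer (T : Topological (Ap p_ge0)) : Ap_admissible T ->
  @open (Topological.Pack T) `<=` @open (Ap p_ge0).
Proof.
move=> aT U oU; rewrite openE => f Uf.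
have /Ap_cvgP /(_ T aT) : nbhs f --> f by exact: cvg_id.
apply; rewrite (@nbhsE (Topological.Pack T)).
by exists U.
Qed.

Lemma Ap_topology_admissible :
  Ap_admissible (Topological.class (Ap p_ge0)).
Proof.
have nbhsT T : Ap_admissible T -> forall f : Ap p_ge0,
    (nbhs f : set_system (Ap p_ge0)) --> (f : Topological.Pack T).
  move=> aT f.
  by have /Ap_cvgP /(_ T aT) : nbhs f --> f by exact: cvg_id.
split; first split.
- move=> x; apply: (proj2 (@Ap_cvgP _ _ _)) => T aT.
  have [[addT _ _] _] := aT.
  apply: cvg_trans (addT x) => A [[P Q] [/= /(nbhsT _ aT) P1 /(nbhsT _ aT) Q1] PQ].
  by exists (P, Q).
- move=> x; apply: (proj2 (@Ap_cvgP _ _ _)) => T aT.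
  have [[_ scT _] _] := aT.
  apply: cvg_trans (scT x) => A [[P Q] [/= P1 /(nbhsT _ aT) Q1] PQ].
  by exists (P, Q).
- exists [set U : set (Ap p_ge0) |
      open U /\ convex_set (U : set (convex_lmodType (Ap p_ge0)))].
    by move=> U /[!inE] -[].
  split; first by move=> U [].
  move=> f; set F := filter_from _ _.
  have FF : Filter F.
    apply: filter_from_filter.
      exists setT; split => //; split; first exact: openT.
      by move=> x y l _ _; rewrite inE.
    move=> U V [[oU cU] Uf] [[oV cV] Vf]; exists (U `&` V) => //.
    split=> //; split; first exact: openI.
    move=> x y l; rewrite !inE => -[Ux Vx] [Uy Vy]; split; apply: set_mem.
      by apply: cU; rewrite inE.
    by apply: cV; rewrite inE.
  apply/Ap_cvgP => T aT; have [[_ _ [B cB [oB nB]]] _] := aT.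
  move=> A /nB [U [BU Uf] UA]; exists U => //; split=> //; split.
    by apply: (Ap_topology_finer aT); exact: oB.
  by apply: cB; rewrite inE.
- move=> n f.
  have FF : Filter (@Ap_incl n x @[x --> f]) by apply: fmap_filter; exact: (nbhs_filter (f : Ap_step n)).
  apply: (proj2 (Ap_cvgP _ FF)) => T aT; have [_ inclT] := aT.
  exact: (inclT n f).
Qed.

End Ap.

Section Ap0.
Variables (R : realType) (p : R[i] -> R).
Local Notation C := R[i].

Definition Ap0_pred : {pred C -> C} := mem [set f | entire f /\
  forall e : R, 0 < e -> has_ubound (weighted f (fun z => e * p z))].

Record Ap0 := MkAp0 { Ap0_val :> C -> C ; _ : Ap0_val \in Ap0_pred }.

HB.instance Definition _ := [isSub for Ap0_val].
HB.instance Definition _ := [Choice of Ap0 by <:].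

Lemma Ap0_submod_closed : submod_closed Ap0_pred.
Proof.
split; first by rewrite inE; split; [exact: entire0|move=> *; exact: weighted0].
move=> a f g; rewrite !inE => -[hf bf] [hg bg]; split; first exact: entireD.
by move=> e e0; apply: weightedD; [exact: bf|exact: bg].
Qed.

HB.instance Definition _ :=
  GRing.isSubmodClosed.Build _ _ Ap0_pred Ap0_submod_closed.
HB.instance Definition _ := [SubChoice_isSubLmodule of Ap0 by <:].

Definition Ap0_step (n : nat) := step (fun z : C => n.+1%:R^-1 * p z).

Lemma Ap0_step_subproof n (f : Ap0) :
  Ap0_val f \in step_pred (fun z : C => n.+1%:R^-1 * p z).
Proof.
case: f => f /=; rewrite !inE => -[hf bf]; split => //.
by apply: bf; rewrite invr_gt0 ltr0n.
Qed.

Definition Ap0_incl n (f : Ap0) : Ap0_step n := Step (Ap0_step_subproof n f).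

(* The projective limit topology: the coarsest one for which all the
   inclusions in the Banach steps, i.e. all the norms
   sup_z |f z| e^(- p z / n), are continuous. *)
Definition Ap0_topology : Type :=
  sup_topology (fun n => Topological.class (initial_topology (@Ap0_incl n))).

HB.instance Definition _ := Topological.copy Ap0 Ap0_topology.

End Ap0.

Section integration_operator.
Variable R : realType.
Local Notation C := R[i].

Definition cintegral01 (g : R -> C) : C :=
  (Rintegral lebesgue_measure `[0, 1] (fun t => complex.Re (g t)) +i*
   Rintegral lebesgue_measure `[0, 1] (fun t => complex.Im (g t)))%C.

(* The integral of f along the segment from 0 to z. *)
Definition J (f : C -> C) (z : C) : C :=
  cintegral01 (fun t => f (t%:C%C * z) * z).

(* In the following, E stands for a space of functions, through the inclusion
   [ev : E -> C -> C]. *)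
Definition subspace_set (E : lmodType C) (M : set E) : Prop :=
  M 0 /\ forall (a : C) f g, M f -> M g -> M (a *: f + g).

Definition proper_subspace (E : lmodType C) (M : set E) : Prop :=
  [/\ subspace_set M, M <> [set 0] & M <> setT].

Definition J_invariant (E : Type) (ev : E -> C -> C) (M : set E) : Prop :=
  J @` (ev @` M) `<=` ev @` M.

Definition A_K (E : Type) (ev : E -> C -> C) (K : nat) : set E :=
  [set f | forall j, (j < K)%N -> derive1n j (ev f) 0 = 0].

Definition only_A_K_invariant (E : preTopologicalLmodType C)
    (ev : E -> C -> C) : Prop :=
  forall M : set E, proper_subspace M -> closed M -> J_invariant ev M ->
  exists2 K : nat, (1 <= K)%N & M = A_K ev K.

End integration_operator.

Section statement_data.
Variable R : realType.

Lemma weight_ge0 (p : R[i] -> R) : weight_exponent p -> forall z, 0 <= p z.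
Proof. by move=> hp z; exact: ltW (weight_gt0 hp z). Qed.

Definition power_weight (a s : R) (z : R[i]) : R := a * (cabs z `^ s).

Lemma power_weight_ge0 a s : 0 < a -> forall z, 0 <= power_weight a s z.
Proof. by move=> a0 z; rewrite mulr_ge0 ?powR_ge0// ltW. Qed.

Definition exp_weight (z : R[i]) : R := expR (cabs z).

Lemma exp_weight_ge0 z : 0 <= exp_weight z.
Proof. exact: expR_ge0. Qed.

Definition J_subspaces_classified (p : R[i] -> R)
    (p_ge0 : forall z, 0 <= p z) : Prop :=
  only_A_K_invariant (@Ap0_val R p : Ap0 p -> R[i] -> R[i]) /\
  only_A_K_invariant (@Ap_val R p p_ge0 : Ap p_ge0 -> R[i] -> R[i]).

End statement_data.

(* Main.v *)
(* Let K be the least order of vanishing at 0 in the invariant subspace M,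
   and f in M with f^(K)(0) = 1. On the coefficients m! c_m of an entire
   function, J acts as a shift, so if h is the inverse of the power series with
   coefficients f^(K + k)(0), the finite sums \sum_(i <= n) h_i J^i f agree with
   z^K / K! up to the order K + n. The point is that, although h may diverge,
   these sums converge to z^K / K! in the weighted norms along suitable n. By
   Cauchy's estimates the Taylor coefficients of f only see the minorant Q of p
   that is convex in ln r. As Q is superlinear, Q(t) / t has records r1 with
   arbitrarily large slope Q(r1) / r1; at such a scale the coefficients f^(K +
   k)(0) are so small that |h_i| r1^i / i! <= e^(8 a D Q(r1)) for all i up to a
   multiple n of the slope N of a line N ln r - c supporting Q at r1. The
   remaining terms have degree > K + n, and (r / r1)^n is dominated by exp(b
   (Q(r) - Q(r1))), which beats the size of h_i. Hence M contains z^K / K!, thus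
   by applying J all z^m with m >= K, and the Taylor sums of the functions
   vanishing to order K at 0 converge to them. *)

Require Import Defs.
From HB Require Import structures.
From mathcomp Require Import all_boot all_order all_algebra.
From mathcomp Require Import all_classical all_reals all_analysis.
From mathcomp Require Import complex ring lra.

Import Order.TTheory GRing.Theory Num.Theory numFieldNormedType.Exports.

Local Open Scope classical_set_scope.
Local Open Scope ring_scope.

Set Implicit Arguments.
Unset Strict Implicit.
Unset Printing Implicit Defensive.

(** * Complex derivatives *)

(** The weight e^|z| is not doubling, so the estimates are carried out for a radial function [P]
    with [P (r + 1) <= D * (P r + 1)] and superlinear growth: doubling and eventual monotonicity
    give the first condition, and [expR] satisfies it with [D = e]. Each approximation multiplies
    the exponent [a] by a constant that depends on [D] only ([18 * D] for monomials, [3 * D] for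
    Taylor sums). Such a factor preserves both quantifiers on [a], so one argument serves the two
    spaces. At the scale [r1], with [s = a * D], the exponents balance as follows. The truncation
    gives exp (16 s (Q r - Q r1)), the h_i cost exp (8 s Q r1), and summing the series of f costs
    exp (2 s Q), taken at r, or at r1 when r < r1. A factor of at most exp (- 6 s Q r1) is left
    over; it absorbs the number of terms, which is quadratic in Q r1. *)

Section modulus.
Variable R : realType.
Local Notation C := R[i].
Local Notation Re := (@complex.Re R).
Local Notation Im := (@complex.Im R).
Implicit Types (z w : C) (x y : R).

Lemma cabs_real x : cabs x%:C%C = `|x|.
Proof. by rewrite /cabs normc_def /= expr0n addr0 sqrtr_sqr. Qed.

Lemma cabs1 : cabs (1 : C) = 1.
Proof. by rewrite (cabs_real 1) normr1. Qed.

Lemma cabsi : cabs ('i%C : C) = 1.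
Proof. by rewrite /cabs normc_def /= expr0n expr1n add0r sqrtr1. Qed.

Lemma cabsN z : cabs (- z) = cabs z.
Proof. by rewrite /cabs normrN. Qed.

Lemma cabsBC z w : cabs (z - w) = cabs (w - z).
Proof. by rewrite -cabsN opprB. Qed.

Lemma cabsB z w : cabs (z - w) <= cabs z + cabs w.
Proof. by rewrite -(cabsN w) cabsD. Qed.

Lemma cabs_triangle z w : cabs z - cabs w <= cabs (z - w).
Proof. by rewrite lerBlDr; apply: le_trans (cabsD _ _); rewrite subrK. Qed.

Lemma cabsX z n : cabs (z ^+ n) = cabs z ^+ n.
Proof. by elim: n => [|n IH]; rewrite ?expr0 ?cabs1// !exprS cabsM IH. Qed.

Lemma cabs_gt0 z : (0 < cabs z) = (z != 0).
Proof.
rewrite lt_neqAle cabs_ge0 andbT eq_sym; congr (~~ _).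
by apply/eqP/eqP => [/cabs0_eq0|->]; rewrite ?cabs0.
Qed.

Lemma cabsV z : cabs z^-1 = (cabs z)^-1.
Proof.
have [->|z0] := eqVneq z 0; first by rewrite invr0 cabs0 invr0.
apply: (@mulfI _ (cabs z)); first by rewrite gt_eqF ?cabs_gt0.
by rewrite -cabsM !divff ?cabs1// gt_eqF ?cabs_gt0.
Qed.

Lemma cabs_nat n : cabs (n%:R : C) = n%:R.
Proof. by rewrite -(rmorph_nat (real_complex R)) cabs_real ger0_norm. Qed.

Lemma cabs_sum (I : Type) (r : seq I) (P : pred I) (F : I -> C) :
  cabs (\sum_(i <- r | P i) F i) <= \sum_(i <- r | P i) cabs (F i).
Proof.
elim/big_ind2 : _ => [|z1 x1 z2 x2 h1 h2|//]; first by rewrite cabs0.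
by rewrite (le_trans (cabsD _ _))// lerD.
Qed.

Lemma Re_le z : `|Re z| <= cabs z.
Proof.
by case: z => a b; rewrite /cabs normc_def /= -(sqrtr_sqr a) ler_wsqrtr// lerDl sqr_ge0.
Qed.

Lemma Im_le z : `|Im z| <= cabs z.
Proof.
by case: z => a b; rewrite /cabs normc_def /= -(sqrtr_sqr b) ler_wsqrtr// lerDr sqr_ge0.
Qed.

Lemma cabs_leD z : cabs z <= `|Re z| + `|Im z|.
Proof.
case: z => a b; have E : (a +i* b)%C = a%:C%C + 'i%C * b%:C%C by simpc.
by rewrite {1}E; apply: le_trans (cabsD _ _) _; rewrite cabsM cabsi mul1r !cabs_real.
Qed.

Lemma normcE z : `|z| = (cabs z)%:C%C.
Proof. by rewrite cabsE. Qed.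

Lemma ltr_cabs z x : (`|z| < x%:C%C) = (cabs z < x).
Proof. by rewrite normcE ltcR. Qed.

End modulus.

Section holomorphy.
Variable R : realType.
Local Notation C := R[i].
Implicit Types (f g : C -> C) (z w : C).

(** Stated with the real modulus and without division, so that increments may vanish and
    compositions need no case distinction. *)
Definition cder f z (A : C) := forall e : R, 0 < e -> exists2 d : R, 0 < d &
  forall h, cabs h < d -> cabs (f (z + h) - f z - A * h) <= e * cabs h.

Definition hol f z := exists A, cder f z A.

Definition ccontinuous f z := forall e : R, 0 < e -> exists2 d : R, 0 < d &
  forall h, cabs h < d -> cabs (f (z + h) - f z) < e.

Lemma cder_ccontinuous f z A : cder f z A -> ccontinuous f z.
Proof.
move=> fA e e0; have [d d0 fd] := fA 1 ltr01.
have A0 : 0 < 1 + cabs A by rewrite ltr_pwDl ?cabs_ge0.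
exists (Num.min d (e / (1 + cabs A))).
  by rewrite lt_min d0/= divr_gt0.
move=> h; rewrite lt_min => /andP[/fd {}fd he].
rewrite -(subrK (A * h) (f (z + h) - f z)).
rewrite (le_lt_trans (cabsD _ _))//.
rewrite (le_lt_trans (lerD fd (lexx _)))// mul1r cabsM -{1}(mul1r (cabs h)).
by rewrite -mulrDl mulrC -ltr_pdivlMr.
Qed.

Lemma hol_ccontinuous f z : hol f z -> ccontinuous f z.
Proof. by move=> [A] /cder_ccontinuous. Qed.

Lemma cder_cst c z : cder (fun=> c) z 0.
Proof.
by move=> e e0; exists 1 => // h _; rewrite subrr mul0r subr0 cabs0 mulr_ge0 ?cabs_ge0 ?ltW.
Qed.

Lemma cder_id z : cder id z 1.
Proof.
move=> e e0; exists 1 => // h _.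
by rewrite mul1r (addrC z) addrK subrr cabs0 mulr_ge0 ?cabs_ge0 ?ltW.
Qed.

Lemma cderD f g z A B : cder f z A -> cder g z B ->
  cder (fun x => f x + g x) z (A + B).
Proof.
move=> fA gB e e0; have e20 : 0 < e / 2 by rewrite divr_gt0.
have [d1 d10 h1] := fA _ e20; have [d2 d20 h2] := gB _ e20.
exists (Num.min d1 d2) => [|h]; first by rewrite lt_min d10.
rewrite lt_min => /andP[/h1 {}h1 /h2 {}h2].
have -> : f (z + h) + g (z + h) - (f z + g z) - (A + B) * h =
  (f (z + h) - f z - A * h) + (g (z + h) - g z - B * h) by ring.
by rewrite (le_trans (cabsD _ _))// [e]splitr mulrDl lerD.
Qed.

Lemma cderM f g z A B : cder f z A -> cder g z B ->
  cder (fun x => f x * g x) z (A * g z + f z * B).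
Proof.
move=> fA gB e e0.
pose c := 1 + cabs (f z) + cabs (g z) + cabs B.
have c1 : 1 <= c by rewrite /c -!addrA lerDl !addr_ge0 ?cabs_ge0.
have c0 : 0 < c by apply: lt_le_trans c1.
have [cf cg cB] : [/\ cabs (f z) <= c, cabs (g z) <= c & cabs B <= c].
  have := cabs_ge0 (f z); have := cabs_ge0 (g z); have := cabs_ge0 B.
  by rewrite /c => *; split; lra.
(* The error splits into four terms, each at most [e / 4 * cabs h]; the cap at 1 serves the term
   with two small factors. *)
pose e1 := Num.min 1 (e / (4 * c)).
have e10 : 0 < e1 by rewrite lt_min ltr01 divr_gt0// mulr_gt0.
have ce1 : c * e1 <= e / 4.
  have : e1 <= e / (4 * c) by rewrite ge_min lexx orbT.
  move=> /(ler_wpM2l (ltW c0)) /le_trans; apply.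
  by have -> : c * (e / (4 * c)) = e / 4 by field; rewrite gt_eqF.
have e11 : e1 <= 1 by rewrite ge_min lexx.
have [d1 d10 h1] := fA _ e10; have [d2 d20 h2] := gB _ e10.
have [d3 d30 h3] := cder_ccontinuous fA e10.
exists (Num.min d1 (Num.min d2 d3)) => [|h]; first by rewrite !lt_min d10 d20.
rewrite !lt_min => /and3P[/h1 {}h1 /h2 {}h2 /h3 {}h3].
have -> : f (z + h) * g (z + h) - f z * g z - (A * g z + f z * B) * h =
  (f (z + h) - f z - A * h) * g z + (f (z + h) - f z) * (g (z + h) - g z - B * h)
  + (f (z + h) - f z) * (B * h) + f z * (g (z + h) - g z - B * h) by ring.
have H0 := cabs_ge0 h.
have T : forall a b x y : C, forall s t : R, cabs a <= s -> cabs b <= t -> cabs (a * b) <= s * t.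
  by move=> a b _ _ s t sa tb; rewrite cabsM ler_pM ?cabs_ge0.
have := T _ _ 0 0 _ _ h1 cg.
have := T _ _ 0 0 _ _ (ltW h3) h2.
have hB : cabs (B * h) <= c * cabs h by rewrite cabsM ler_wpM2r.
have := T _ _ 0 0 _ _ (ltW h3) hB.
have := T _ _ 0 0 _ _ cf h2.
move=> t1 t2 t3 t4.
do 3! (rewrite (le_trans (cabsD _ _))//; rewrite -lerBrDr).
apply: (le_trans t4); rewrite !lerBrDr.
have u1 : e1 * (e1 * cabs h) <= c * e1 * cabs h.
  by rewrite mulrA ler_wpM2r// ler_wpM2r ?(ltW e10)// (le_trans e11).
have u2 : c * e1 * cabs h <= e / 4 * cabs h by rewrite ler_wpM2r.
have -> : e * cabs h = e / 4 * cabs h + e / 4 * cabs h + e / 4 * cabs h + e / 4 * cabs h by field.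
have E3 : e1 * (c * cabs h) = c * e1 * cabs h by ring.
have E4 : c * (e1 * cabs h) = c * e1 * cabs h by ring.
have E5 : e1 * cabs h * c = c * e1 * cabs h by ring.
rewrite E3 in t2 *; rewrite E4 in t1 *; rewrite E5.
lra.
Qed.

Lemma cder_comp f g z A B : cder g z B -> cder f (g z) A ->
  cder (fun x => f (g x)) z (A * B).
Proof.
move=> gB fA e e0.
have cB : 0 < 1 + cabs B by rewrite ltr_pwDl ?cabs_ge0.
have cA : 0 < 1 + cabs A by rewrite ltr_pwDl ?cabs_ge0.
pose e1 := e / (2 * (1 + cabs B)).
have e10 : 0 < e1 by rewrite divr_gt0// mulr_gt0.
pose e2 := Num.min 1 (e / (2 * (1 + cabs A))).
have e20 : 0 < e2 by rewrite lt_min ltr01 divr_gt0// mulr_gt0.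
have [d1 d10 h1] := fA _ e10; have [d2 d20 h2] := gB _ e20.
have [d3 d30 h3] := cder_ccontinuous gB d10.
exists (Num.min d2 d3) => [|h]; first by rewrite lt_min d20.
rewrite lt_min => /andP[/h2 {}h2 /h3 /h1 {}h1].
move: h1; rewrite (addrC (g z)) subrK => h1.
have -> : f (g (z + h)) - f (g z) - A * B * h =
  (f (g (z + h)) - f (g z) - A * (g (z + h) - g z)) + A * (g (z + h) - g z - B * h) by ring.
have H0 := cabs_ge0 h.
have kg : cabs (g (z + h) - g z) <= (1 + cabs B) * cabs h.
  rewrite -(subrK (B * h) (g (z + h) - g z)) (le_trans (cabsD _ _))// mulrDl lerD//.
    by rewrite (le_trans h2)// ler_wpM2r// ge_min lexx.
  by rewrite cabsM.
rewrite (le_trans (cabsD _ _))//; have -> : e * cabs h = e / 2 * cabs h + e / 2 * cabs h by field.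
apply: lerD.
  apply: (le_trans h1); apply: (le_trans (ler_wpM2l (ltW e10) kg)).
  by rewrite mulrA ler_wpM2r// /e1 invfM mulrA mulfVK ?gt_eqF.
rewrite cabsM; apply: (le_trans (ler_wpM2l (cabs_ge0 _) h2)).
rewrite mulrA ler_wpM2r//.
have : e2 <= e / (2 * (1 + cabs A)) by rewrite ge_min lexx orbT.
have A1 : cabs A <= 1 + cabs A by rewrite lerDr.
move=> /(ler_pM (cabs_ge0 A) (ltW e20) A1) /le_trans; apply.
by rewrite [leLHS]mulrC invfM mulrA mulfVK ?gt_eqF.
Qed.

Lemma cderV z : z != 0 -> cder (@GRing.inv C) z (- z ^- 2).
Proof.
move=> z0 e e0; have a0 : 0 < cabs z by rewrite cabs_gt0.
have a30 : 0 < cabs z ^+ 3 by rewrite exprn_gt0.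
exists (Num.min (cabs z / 2) (e * cabs z ^+ 3 / 2)) => [|h].
  by rewrite lt_min divr_gt0//= divr_gt0 ?mulr_gt0.
rewrite lt_min => /andP[h1 h2].
have zh : cabs z / 2 <= cabs (z + h).
  have := cabs_triangle z (- h); rewrite opprK cabsN; lra.
have zh0 : z + h != 0 by rewrite -cabs_gt0 (lt_le_trans _ zh)// divr_gt0.
have -> : (z + h)^-1 - z^-1 - - z ^- 2 * h = h ^+ 2 * ((z + h)^-1 * z ^- 2).
  by field; rewrite zh0 z0.
rewrite cabsM cabsX expr2 -mulrA [leRHS]mulrC ler_wpM2l ?cabs_ge0//.
rewrite cabsM !cabsV cabsX -invfM ler_pdivrMr ?mulr_gt0 ?exprn_gt0//; last first.
  by rewrite (lt_le_trans _ zh)// divr_gt0.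
apply: (le_trans (ltW h2)); rewrite -mulrA ler_wpM2l ?(ltW e0)//.
by rewrite exprS mulrAC ler_wpM2r// exprn_ge0// ltW.
Qed.

Lemma holD f g z : hol f z -> hol g z -> hol (fun x => f x + g x) z.
Proof. by move=> [A fA] [B gB]; exists (A + B); exact: cderD. Qed.

Lemma holM f g z : hol f z -> hol g z -> hol (fun x => f x * g x) z.
Proof. by move=> [A fA] [B gB]; exists (A * g z + f z * B); exact: cderM. Qed.

Lemma hol_cst c z : hol (fun=> c) z.
Proof. by exists 0; exact: cder_cst. Qed.

Lemma hol_id z : hol id z.
Proof. by exists 1; exact: cder_id. Qed.

Lemma holX n z : hol (fun x => x ^+ n) z.
Proof.
elim: n => [|n IH]; first exact: hol_cst.
have -> : (fun x : C => x ^+ n.+1) = (fun x => x * x ^+ n).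
  by apply/funext => x; rewrite exprS.
by apply: holM => //; exact: hol_id.
Qed.

Lemma holV f z : f z != 0 -> hol f z -> hol (fun x => (f x)^-1) z.
Proof.
by move=> fz [A fA]; exists (- (f z) ^- 2 * A); apply: cder_comp fA (cderV fz).
Qed.

Lemma hol_sum (I : Type) (r : seq I) (F : I -> C -> C) z :
  (forall i, hol (F i) z) -> hol (fun x => \sum_(i <- r) F i x) z.
Proof.
move=> hF; elim: r => [|i r IH].
  by under [fun x => _]funext do rewrite big_nil; exact: hol_cst.
by under [fun x => _]funext do rewrite big_cons; exact: holD.
Qed.

Lemma cder_unique f z A B : cder f z A -> cder f z B -> A = B.
Proof.
move=> fA fB; apply/eqP; rewrite -subr_eq0; apply/negPn/negP; rewrite -cabs_gt0 => AB.
have e0 : 0 < cabs (A - B) / 4 by rewrite divr_gt0.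
have [d1 d10 h1] := fA _ e0; have [d2 d20 h2] := fB _ e0.
pose h : C := (Num.min d1 d2 / 2)%:C%C.
have m0 : 0 < Num.min d1 d2 by rewrite lt_min d10.
have ch : cabs h = Num.min d1 d2 / 2 by rewrite cabs_real ger0_norm// divr_ge0// ltW.
have : cabs h < Num.min d1 d2 by rewrite ch ltr_pdivrMr// ltr_pMr// ltr1n.
rewrite lt_min => /andP[/h1 {}h1 /h2 {}h2].
have : cabs ((A - B) * h) <= cabs (A - B) / 4 * cabs h + cabs (A - B) / 4 * cabs h.
  have -> : (A - B) * h = (f (z + h) - f z - B * h) - (f (z + h) - f z - A * h) by ring.
  by rewrite (le_trans (cabsB _ _))// lerD.
rewrite cabsM -mulrDl ler_pM2r ?ch ?divr_gt0//; lra.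
Qed.

Lemma cder_is_derive f z A : cder f z A -> is_derive z 1 f A.
Proof.
move=> fA.
suff cv : (h^-1 *: (f (h *: 1 + z) - f z)) @[h --> 0^'] --> A.
  by split; [apply/cvg_ex; exists A|exact/cvg_lim].
apply/cvgrPdist_le => /= e e0.
have e0' : 0 < complex.Re e by move: e0; case: (e) => a b /=; rewrite ltcE /= => /andP[].
have eE : e = (complex.Re e)%:C%C.
  by move: e0; case: (e) => a b /=; rewrite ltcE /= => /andP[/eqP ->].
have [d d0 h1] := fA _ e0'.
near=> h.
have hd : cabs h < d.
  rewrite -ltr_cabs; near: h; apply: dnbhs0_lt; by rewrite ltcR.
have h0 : h != 0 by near: h; exact: nbhs_dnbhs_neq.
rewrite normcE [leRHS]eE lecR.
have -> : A - h^-1 *: (f (h *: 1 + z) - f z) = - h^-1 * (f (z + h) - f z - A * h).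
  rewrite /GRing.scale /= mulr1 (addrC h).
  by field.
rewrite cabsM cabsN cabsV mulrC ler_pdivrMr ?cabs_gt0//; exact: h1.
Unshelve. all: by end_near. Qed.

Lemma derivable_cder f z : derivable f z 1 -> cder f z ('D_1 f z).
Proof.
move=> df e e0.
have /cvgrPdist_le := df => /(_ e%:C%C).
rewrite ltcR => /(_ e0) /=.
rewrite near_withinE => /nbhs_ballP [d /= d0 hd].
exists (complex.Re d).
  by move: d0; case: (d) => a b /=; rewrite ltcE /= => /andP[].
move=> h hd'.
have [->|h0] := eqVneq h 0; first by rewrite addr0 subrr mulr0 subr0 cabs0 mulr0.
have dE : d = (complex.Re d)%:C%C.
  by move: d0; case: (d) => a b /=; rewrite ltcE /= => /andP[/eqP ->].
have : ball 0 d h by rewrite -ball_normE /= sub0r normrN dE ltr_cabs.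
move=> /hd /(_ h0); rewrite normcE lecR => H.
have E : f (z + h) - f z - 'D_1 f z * h =
    - h * ('D_1 f z - h^-1 *: (f (h *: 1 + z) - f z)).
  rewrite /GRing.scale /= mulr1 (addrC h).
  by field.
by rewrite E cabsM cabsN mulrC ler_wpM2r ?cabs_ge0.
Qed.

Lemma entireP f : entire f <-> forall z, hol f z.
Proof.
split=> [ef z|hf z]; first by exists ('D_1 f z); exact: derivable_cder.
by have [A /cder_is_derive[]] := hf z.
Qed.

Lemma cder_derive1 f z A : cder f z A -> derive1 f z = A.
Proof. by move=> /cder_is_derive ?; rewrite derive1E derive_val. Qed.

End holomorphy.

(** * Goursat's theorem *)

Section complex_integral.
Variable R : realType.
Local Notation C := R[i].
Local Notation Re := (@complex.Re R).
Local Notation Im := (@complex.Im R).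
Local Notation mu := (@lebesgue_measure R).
Implicit Types (g h : R -> C) (a b : R).

Definition rcont g := forall t (e : R), 0 < e -> exists2 d : R, 0 < d &
  forall s, `|s| < d -> cabs (g (t + s) - g t) < e.

Definition ccint a b g : C :=
  (Rintegral mu `[a, b] (Re \o g) +i* Rintegral mu `[a, b] (Im \o g))%C.

Lemma rcont_cst c : rcont (fun=> c).
Proof. by move=> t e e0; exists 1 => // s _; rewrite subrr cabs0. Qed.

Lemma rcontD g h : rcont g -> rcont h -> rcont (fun t => g t + h t).
Proof.
move=> cg ch t e e0; have e20 : 0 < e / 2 by rewrite divr_gt0.
have [d1 d10 h1] := cg t _ e20; have [d2 d20 h2] := ch t _ e20.
exists (Num.min d1 d2) => [|s]; first by rewrite lt_min d10.
rewrite lt_min => /andP[/h1 {}h1 /h2 {}h2].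
rewrite opprD addrACA (le_lt_trans (cabsD _ _))// [e]splitr; exact: ltrD.
Qed.

Lemma rcontZ c g : rcont g -> rcont (fun t => c * g t).
Proof.
move=> cg t e e0; have c0 : 0 < 1 + cabs c by rewrite ltr_pwDl ?cabs_ge0.
have [d d0 h1] := cg t (e / (1 + cabs c)) (divr_gt0 e0 c0).
exists d => // s /h1; rewrite ltr_pdivlMr// => H.
rewrite -mulrBr cabsM (le_lt_trans _ H)// mulrC ler_wpM2l ?cabs_ge0//.
by rewrite lerDr.
Qed.

Lemma rcontN g : rcont g -> rcont (fun t => - g t).
Proof. by move=> /(rcontZ (-1)); under [fun t => _]funext do rewrite mulN1r. Qed.

Lemma rcontB g h : rcont g -> rcont h -> rcont (fun t => g t - h t).
Proof. by move=> cg ch; apply: rcontD => //; exact: rcontN. Qed.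

Lemma rcont_Re g : rcont g -> continuous (Re \o g).
Proof.
move=> cg t; apply/cvgrPdist_lt => e e0; have [d d0 h1] := cg t e e0.
near=> s; have : `|s - t| < d.
  rewrite distrC; near: s; apply/nbhs_ballP; exists d => //= s; rewrite -ball_normE.
move=> /h1; rewrite (addrC t) subrK cabsBC => /(le_lt_trans _); apply.
by apply: le_trans (Re_le _); rewrite raddfB.
Unshelve. all: by end_near. Qed.

Lemma rcont_Im g : rcont g -> continuous (Im \o g).
Proof.
move=> cg t; apply/cvgrPdist_lt => e e0; have [d d0 h1] := cg t e e0.
near=> s; have : `|s - t| < d.
  rewrite distrC; near: s; apply/nbhs_ballP; exists d => //= s; rewrite -ball_normE.
move=> /h1; rewrite (addrC t) subrK cabsBC => /(le_lt_trans _); apply.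
by apply: le_trans (Im_le _); rewrite raddfB.
Unshelve. all: by end_near. Qed.

Lemma cont_integrable a b (f : R -> R) : continuous f ->
  mu.-integrable `[a, b] (EFin \o f).
Proof.
move=> cf; apply: continuous_compact_integrable; first exact: segment_compact.
exact: continuous_subspaceT.
Qed.

Let mab a b : measurable (`[a, b] : set R).
Proof. exact: measurable_itv. Qed.

Lemma ccintD a b g h : rcont g -> rcont h ->
  ccint a b (fun t => g t + h t) = ccint a b g + ccint a b h.
Proof.
move=> cg ch; apply/eqP; rewrite eq_complex /=; apply/andP; split; apply/eqP.
  rewrite -RintegralD//; try exact/cont_integrable/rcont_Re.
  by apply: eq_Rintegral => t _ /=; rewrite raddfD.
rewrite -RintegralD//; try exact/cont_integrable/rcont_Im.
by apply: eq_Rintegral => t _ /=; rewrite raddfD.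
Qed.

Lemma ccintZ a b c g : rcont g ->
  ccint a b (fun t => c * g t) = c * ccint a b g.
Proof.
move=> cg; case: c => u v; rewrite /ccint; simpc.
have iR := cont_integrable a b (rcont_Re cg).
have iI := cont_integrable a b (rcont_Im cg).
have iR' w : mu.-integrable `[a, b] (EFin \o (fun t => w * (Re \o g) t)).
  by apply: eq_integrable (integrableZl _ w iR) => //.
have iI' w : mu.-integrable `[a, b] (EFin \o (fun t => w * (Im \o g) t)).
  by apply: eq_integrable (integrableZl _ w iI) => //.
rewrite -!RintegralZl// -RintegralB// -RintegralD//; congr (_ +i* _)%C.
  by apply: eq_Rintegral => t _ /=; case: (g t) => x y; simpc.
by apply: eq_Rintegral => t _ /=; case: (g t) => x y; simpc.
Qed.

Lemma ccintB a b g h : rcont g -> rcont h ->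
  ccint a b (fun t => g t - h t) = ccint a b g - ccint a b h.
Proof.
move=> cg ch; rewrite ccintD//; last exact: rcontN.
have -> : (fun t => - h t) = (fun t => -1 * h t) by apply/funext => t; rewrite mulN1r.
by rewrite ccintZ// mulN1r.
Qed.

Lemma ccint_sum a b (I : Type) (r : seq I) (F : I -> R -> C) :
  (forall i, rcont (F i)) ->
  rcont (fun t => \sum_(i <- r) F i t) /\
  ccint a b (fun t => \sum_(i <- r) F i t) = \sum_(i <- r) ccint a b (F i).
Proof.
move=> cF; elim: r => [|i r [IH1 IH2]].
  under [fun t => _]funext do rewrite big_nil; split; first exact: rcont_cst.
  rewrite big_nil; have := ccintZ a b 0 (rcont_cst 0).
  by under [fun t => _]funext do rewrite mul0r; rewrite mul0r.
have E : (fun t => \sum_(j <- i :: r) F j t) = (fun t => F i t + \sum_(j <- r) F j t).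
  by apply/funext => t; rewrite big_cons.
by rewrite E; split; [exact: rcontD|rewrite ccintD// IH2 big_cons].
Qed.

Lemma fine_lebesgue_itv a b : a <= b -> fine (mu `[a, b]) = b - a.
Proof. by move=> ab; rewrite lebesgue_measure_itv /= lte_fin; case: ltgtP ab => // ->; rewrite subrr. Qed.

Lemma ccint_cst a b c : a <= b -> ccint a b (fun=> c) = (b - a)%:C%C * c.
Proof.
move=> ab; case: c => u v; rewrite /ccint; simpc => /=.
have E (w : R) : Rintegral mu `[a, b] (fun=> w) = (b - a) * w.
  by rewrite Rintegral_cst// fine_lebesgue_itv// mulrC.
by rewrite -!E.
Qed.

Lemma Rint_le_norm a b (f : R -> R) (M : R) : a <= b -> continuous f ->
  (forall t, a <= t <= b -> `|f t| <= M) ->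
  `|Rintegral mu `[a, b] f| <= (b - a) * M.
Proof.
move=> ab cf fM.
have i1 := cont_integrable a b cf.
have iM := cont_integrable a b (@cst_continuous R R M).
have EM : Rintegral mu `[a, b] (fun=> M) = (b - a) * M.
  by rewrite Rintegral_cst// fine_lebesgue_itv// mulrC.
rewrite -EM; apply: le_trans (le_normr_Rintegral _ i1) _ => //.
have iN : mu.-integrable `[a, b] (EFin \o (fun t => `|f t|)).
  by apply: cont_integrable => t; apply: continuous_comp; [exact: cf|exact: norm_continuous].
apply: le_Rintegral; [exact: mab|exact: iN|exact: iM|].
by move=> t /=; rewrite in_itv/=; exact: fM.
Qed.

(** Real and imaginary parts are bounded separately, whence the factor 2; it only affects constants,
    and reappears in [cauchy_estimate] and [cauchy_taylor]. *)
Lemma ccint_le a b g (M : R) : a <= b -> rcont g ->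
  (forall t, a <= t <= b -> cabs (g t) <= M) ->
  cabs (ccint a b g) <= 2 * ((b - a) * M).
Proof.
move=> ab cg gM; rewrite (le_trans (cabs_leD _))// mulr2n mulrDl mul1r lerD//.
  apply: Rint_le_norm => //; first exact: rcont_Re.
  by move=> t /gM; apply: le_trans; exact: Re_le.
apply: Rint_le_norm => //; first exact: rcont_Im.
by move=> t /gM; apply: le_trans; exact: Im_le.
Qed.

Lemma Rint_chasles a c b (f : R -> R) : a <= c -> c <= b -> continuous f ->
  Rintegral mu `[a, b] f = Rintegral mu `[a, c] f + Rintegral mu `[c, b] f.
Proof.
move=> ac cb cf; have i1 := cont_integrable a b cf.
have := @Rintegral_itvB R f (BLeft a) (BRight b) c i1.
rewrite !bnd_simp => /(_ ac cb) /eqP; rewrite subr_eq => /eqP ->.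
rewrite addrC; congr (_ + _); rewrite -Rintegral_itv_obnd_cbnd//.
apply: integrableS (cont_integrable c b cf) => //.
by apply: subset_itvr; rewrite bnd_simp.
Qed.

Lemma ccint_chasles a c b g : a <= c -> c <= b -> rcont g ->
  ccint a b g = ccint a c g + ccint c b g.
Proof.
move=> ac cb cg; apply/eqP; rewrite eq_complex /=; apply/andP; split; apply/eqP.
  by apply: Rint_chasles => //; exact: rcont_Re.
by apply: Rint_chasles => //; exact: rcont_Im.
Qed.

End complex_integral.

Section goursat.
Variable R : realType.
Local Notation C := R[i].
Variable g : C -> C.
Hypothesis cg : forall z, ccontinuous g z.

Definition cxy (x y : R) : C := (x +i* y)%C.

Lemma cxyD x y s t : cxy (x + s) (y + t) = cxy x y + cxy s t.
Proof. by rewrite /cxy; simpc. Qed.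

Lemma cabs_cxy x y : cabs (cxy x y) <= `|x| + `|y|.
Proof. exact: cabs_leD. Qed.

Lemma rcont_h (f : C -> C) y : (forall z, ccontinuous f z) -> rcont (fun t => f (cxy t y)).
Proof.
move=> cf t e e0; have [d d0 h] := cf (cxy t y) e e0; exists d => // s sd.
rewrite -[y in cxy (t + s) y]addr0 cxyD; apply: h.
by rewrite (le_lt_trans (cabs_cxy _ _))// normr0 addr0.
Qed.

Lemma rcont_v (f : C -> C) x : (forall z, ccontinuous f z) -> rcont (fun t => f (cxy x t)).
Proof.
move=> cf t e e0; have [d d0 h] := cf (cxy x t) e e0; exists d => // s sd.
rewrite -[x in cxy x (t + s)]addr0 cxyD; apply: h.
by rewrite (le_lt_trans (cabs_cxy _ _))// normr0 add0r.
Qed.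

(** The integral of [f] along the positively oriented boundary of a rectangle, with opposite sides
    paired under one integral. *)
Definition bdry (f : C -> C) (x y u v : R) : C :=
  ccint x (x + u) (fun t => f (cxy t y) - f (cxy t (y + v))) +
  'i%C * ccint y (y + v) (fun t => f (cxy (x + u) t) - f (cxy x t)).

Lemma bdry_split x y u v : 0 <= u -> 0 <= v ->
  bdry g x y u v = bdry g x y (u / 2) (v / 2) + bdry g (x + u / 2) y (u / 2) (v / 2)
   + bdry g x (y + v / 2) (u / 2) (v / 2) + bdry g (x + u / 2) (y + v / 2) (u / 2) (v / 2).
Proof.
move=> u0 v0; rewrite /bdry.
have Eu w : w + u / 2 + u / 2 = w + u by rewrite -addrA -splitr.
have Ev w : w + v / 2 + v / 2 = w + v by rewrite -addrA -splitr.
rewrite !Eu !Ev.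
have rh := (fun y => @rcont_h g y cg); have rv := (fun y => @rcont_v g y cg).
rewrite !ccintB//.
have lu w : w <= w + u / 2 by rewrite lerDl divr_ge0.
have lv w : w <= w + v / 2 by rewrite lerDl divr_ge0.
have lu2 w : w + u / 2 <= w + u by rewrite -(Eu w).
have lv2 w : w + v / 2 <= w + v by rewrite -(Ev w).
rewrite (ccint_chasles (lu x) (lu2 x) (rh y)) (ccint_chasles (lu x) (lu2 x) (rh (y + v))).
rewrite (ccint_chasles (lv y) (lv2 y) (rv (x + u))) (ccint_chasles (lv y) (lv2 y) (rv x)).
ring.
Qed.

Lemma bdry_affine (a b : C) x y u v : 0 <= u -> 0 <= v ->
  bdry (fun z => a + b * z) x y u v = 0.
Proof.
move=> u0 v0; rewrite /bdry.
have E1 : (fun t => a + b * cxy t y - (a + b * cxy t (y + v))) = fun=> - b * ('i%C * v%:C%C).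
  apply/funext => t; have -> : cxy t (y + v) = cxy t y + 'i%C * v%:C%C by rewrite /cxy; simpc.
  ring.
have E2 : (fun t => a + b * cxy (x + u) t - (a + b * cxy x t)) = fun=> b * u%:C%C.
  apply/funext => t; have -> : cxy (x + u) t = cxy x t + u%:C%C by rewrite /cxy; simpc.
  ring.
rewrite E1 E2 !ccint_cst ?lerDl//.
rewrite !(addrC _ u) !(addrC _ v) !addrK; ring.
Qed.

(** By [bdry_affine], the tangent affine map can be subtracted from [g] without changing the
    boundary integral. *)
Lemma bdry_near (A : C) z (e : R) x y u v : 0 <= u -> 0 <= v -> 0 <= e ->
  (forall s t, x <= s <= x + u -> y <= t <= y + v ->
     cabs (g (cxy s t) - g z - A * (cxy s t - z)) <= e * (u + v)) ->
  cabs (bdry g x y u v) <= 4 * e * (u + v) ^+ 2.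
Proof.
move=> u0 v0 e0 H.
have -> : bdry g x y u v = bdry (fun w => g w - ((g z - A * z) + A * w)) x y u v.
  rewrite /bdry; have cl : forall w, ccontinuous (fun w => (g z - A * z) + A * w) w.
    move=> w; apply: hol_ccontinuous; apply: holD; first exact: hol_cst.
    by apply: holM; [exact: hol_cst|exact: hol_id].
  rewrite -[LHS]subr0 -{1}(@bdry_affine (g z - A * z) A x y u v)// /bdry.
  have rh := (fun y => @rcont_h g y cg); have rv := (fun y => @rcont_v g y cg).
  have rh' := (fun y => @rcont_h _ y cl); have rv' := (fun y => @rcont_v _ y cl).
  have -> : (fun t => g (cxy t y) - ((g z - A * z) + A * cxy t y) -
     (g (cxy t (y + v)) - ((g z - A * z) + A * cxy t (y + v)))) =
     (fun t => (g (cxy t y) - g (cxy t (y + v))) - (((g z - A * z) + A * cxy t y) - ((g z - A * z) + A * cxy t (y + v)))).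
    by apply/funext => t; ring.
  have -> : (fun t => g (cxy (x + u) t) - ((g z - A * z) + A * cxy (x + u) t) -
     (g (cxy x t) - ((g z - A * z) + A * cxy x t))) =
     (fun t => (g (cxy (x + u) t) - g (cxy x t)) - (((g z - A * z) + A * cxy (x + u) t) - ((g z - A * z) + A * cxy x t))).
    by apply/funext => t; ring.
  rewrite [in RHS]ccintB; [|exact: rcontB|by apply: (@rcontB _ (fun t => _ + A * cxy t y) (fun t => _ + A * cxy t (y + v)))].
  rewrite [X in _ = _ + 'i%C * X]ccintB; [|exact: rcontB|by apply: (@rcontB _ (fun t => _ + A * cxy (x + u) t) (fun t => _ + A * cxy x t))].
  ring.
pose f := (fun w => g w - ((g z - A * z) + A * w)).
have fe s t : x <= s <= x + u -> y <= t <= y + v -> cabs (f (cxy s t)) <= e * (u + v).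
  by move=> hs ht; rewrite /f; apply: le_trans (H _ _ hs ht); rewrite le_eqVlt; apply/orP; left; apply/eqP; congr cabs; ring.
have cf w : ccontinuous f w.
  move=> e' e'0; have e20 : 0 < e' / 2 by rewrite divr_gt0.
  have : ccontinuous (fun w => (g z - A * z) + A * w) w.
    apply: hol_ccontinuous; apply: holD; first exact: hol_cst.
    by apply: holM; [exact: hol_cst|exact: hol_id].
  move=> /(_ _ e20) [d2 d20 h2]; have [d1 d10 h1] := cg w e20.
  exists (Num.min d1 d2) => [|h]; first by rewrite lt_min d10.
  rewrite lt_min => /andP[/h1 {}h1 /h2 {}h2].
  have -> : f (w + h) - f w = (g (w + h) - g w) -
    (g z - A * z + A * (w + h) - (g z - A * z + A * w)) by rewrite /f; ring.
  by rewrite (le_lt_trans (cabsB _ _))// [e']splitr; exact: ltrD.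
rewrite -/f /bdry (le_trans (cabsD _ _))// cabsM cabsi mul1r.
have rh := (fun y => @rcont_h _ y cf); have rv := (fun y => @rcont_v _ y cf).
have xx : x <= x <= x + u by rewrite lexx lerDl.
have xu : x <= x + u <= x + u by rewrite lexx lerDl u0.
have yy : y <= y <= y + v by rewrite lexx lerDl.
have yv : y <= y + v <= y + v by rewrite lexx lerDl v0.
have h1 : cabs (ccint x (x + u) (fun t => f (cxy t y) - f (cxy t (y + v)))) <= 2 * (u * (2 * (e * (u + v)))).
  rewrite -{2}(addrK x u) (addrC u x) ccint_le//; [by rewrite lerDl|exact: rcontB|].
  by move=> t ht; rewrite (le_trans (cabsB _ _))// mulr2n mulrDl mul1r lerD// fe.
have h2 : cabs (ccint y (y + v) (fun t => f (cxy (x + u) t) - f (cxy x t))) <= 2 * (v * (2 * (e * (u + v)))).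
  rewrite -{2}(addrK y v) (addrC v y) ccint_le//; [by rewrite lerDl|exact: rcontB|].
  by move=> t ht; rewrite (le_trans (cabsB _ _))// mulr2n mulrDl mul1r lerD// fe.
apply: le_trans (lerD h1 h2) _; rewrite le_eqVlt; apply/orP; left; apply/eqP; ring.
Qed.

Section bisection.
Variables x0 y0 u v : R.
Hypotheses (u0 : 0 <= u) (v0 : 0 <= v).
Hypothesis hg : forall s t, x0 <= s <= x0 + u -> y0 <= t <= y0 + v -> hol g (cxy s t).

Let un n := u / 2 ^+ n.
Let vn n := v / 2 ^+ n.
Let next n (p : R * R) : R * R :=
  let B x y := cabs (bdry g x y (un n.+1) (vn n.+1)) in
  let b := cabs (bdry g p.1 p.2 (un n) (vn n)) in
  if b <= 4 * B p.1 p.2 then p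
  else if b <= 4 * B (p.1 + un n.+1) p.2 then (p.1 + un n.+1, p.2)
  else if b <= 4 * B p.1 (p.2 + vn n.+1) then (p.1, p.2 + vn n.+1)
  else (p.1 + un n.+1, p.2 + vn n.+1).

Let st := fix st n := if n is m.+1 then next m (st m) else (x0, y0).

Let unS n : un n / 2 = un n.+1.
Proof. by rewrite /un exprSr invfM mulrA. Qed.

Let vnS n : vn n / 2 = vn n.+1.
Proof. by rewrite /vn exprSr invfM mulrA. Qed.

Let un_ge0 n : 0 <= un n.
Proof. by rewrite divr_ge0// exprn_ge0. Qed.

Let vn_ge0 n : 0 <= vn n.
Proof. by rewrite divr_ge0// exprn_ge0. Qed.

Let nextP n p : cabs (bdry g p.1 p.2 (un n) (vn n)) <=
   4 * cabs (bdry g (next n p).1 (next n p).2 (un n.+1) (vn n.+1)).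
Proof.
rewrite /next; case: ifP => // /negbT; rewrite -ltNge => h1.
case: ifP => // /negbT; rewrite -ltNge => h2.
case: ifP => // /negbT; rewrite -ltNge => h3 /=.
have := bdry_split p.1 p.2 (un_ge0 n) (vn_ge0 n); rewrite !unS !vnS => E.
have : cabs (bdry g p.1 p.2 (un n) (vn n)) <=
  cabs (bdry g p.1 p.2 (un n.+1) (vn n.+1)) + cabs (bdry g (p.1 + un n.+1) p.2 (un n.+1) (vn n.+1)) +
  cabs (bdry g p.1 (p.2 + vn n.+1) (un n.+1) (vn n.+1)) + cabs (bdry g (p.1 + un n.+1) (p.2 + vn n.+1) (un n.+1) (vn n.+1)).
  by rewrite {1}E; do 3! (apply: le_trans (cabsD _ _) _; rewrite lerD//).
lra.
Qed.

Let next_ge n p : [/\ p.1 <= (next n p).1, (next n p).1 + un n.+1 <= p.1 + un n,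
  p.2 <= (next n p).2 & (next n p).2 + vn n.+1 <= p.2 + vn n].
Proof.
have a1 : un n = un n.+1 + un n.+1 by rewrite -unS -splitr.
have a2 : vn n = vn n.+1 + vn n.+1 by rewrite -vnS -splitr.
have := un_ge0 n.+1; have := vn_ge0 n.+1.
by rewrite /next; do ![case: ifP => _ /=] => *; split; lra.
Qed.

Let st_bound n : cabs (bdry g x0 y0 u v) <= 4 ^+ n * cabs (bdry g (st n).1 (st n).2 (un n) (vn n)).
Proof.
elim: n => [|n IH]; first by rewrite /un /vn expr0 !divr1 mul1r.
apply: le_trans IH _; rewrite exprSr -mulrA ler_wpM2l ?exprn_ge0//; exact: nextP.
Qed.

(** Nested intervals, used for each coordinate of the shrinking rectangles. *)
Let limit_pt (a w : nat -> R) : (forall n, a n <= a n.+1) ->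
  (forall n, a n.+1 + w n.+1 <= a n + w n) -> (forall n, 0 <= w n) ->
  exists X, forall n, a n <= X <= a n + w n.
Proof.
move=> an wn w0.
have nda : nondecreasing_seq a by apply/nondecreasing_seqP.
have niw : nonincreasing_seq (fun n => a n + w n) by apply/nonincreasing_seqP.
have ub n m : a m <= a n + w n.
  have [nm|mn] := leqP n m.
    by apply: le_trans (niw _ _ nm); rewrite lerDl.
  by apply: le_trans (nda _ _ (ltnW mn)) _; rewrite lerDl.
exists (sup (range a)) => n; apply/andP; split.
  apply: sup_upper_bound; last by exists n.
  by split; [exists (a 0%N); exists 0%N|exists (a 0%N + w 0%N) => _ [m _ <-]; exact: ub].
apply: ge_sup; first by exists (a 0%N); exists 0%N.
by move=> _ [m _ <-]; exact: ub.
Qed.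

(** Each quartering keeps a rectangle with at least a quarter of the boundary integral. At the limit
    point, [bdry_near] bounds the n-th integral by a small multiple of 4^-n, which cancels the
    factor 4^n of [st_bound]. Continuity of [g] is global while differentiability is local, since
    the later integrands may be merely continuous at a point outside the rectangle. *)
Lemma goursat : bdry g x0 y0 u v = 0.
Proof.
have [X HX] : exists X, forall n, (st n).1 <= X <= (st n).1 + un n.
  by apply: limit_pt => // n; have [] := next_ge n (st n).
have [Y HY] : exists Y, forall n, (st n).2 <= Y <= (st n).2 + vn n.
  by apply: limit_pt => // n; have [] := next_ge n (st n).
have : hol g (cxy X Y).
  apply: hg; first by have := HX 0%N; rewrite /un expr0 divr1.
  by have := HY 0%N; rewrite /vn expr0 divr1.
move=> [A hA].
apply: cabs0_eq0; apply/eqP; rewrite eq_le cabs_ge0 andbT.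
apply/ler_addgt0Pr => e e0; rewrite add0r.
(* The summand 1 keeps [c] positive for a degenerate rectangle. *)
pose c := 4 * (u + v) ^+ 2 + 1.
have c0 : 0 < c by rewrite ltr_wpDl// mulr_ge0// exprn_ge0// addr_ge0.
have [d d0 hd] := hA _ (divr_gt0 e0 c0).
have [n nd] : exists n, un n + vn n < d.
  have [n hn] : exists n : nat, (u + v) / d < n%:R.
    by exists (Num.truncn ((u + v) / d)).+1; rewrite truncnS_gt.
  exists n; rewrite /un /vn -mulrDl ltr_pdivrMr ?exprn_gt0//.
  rewrite mulrC -ltr_pdivrMr//; apply: lt_le_trans hn _.
  by rewrite -natrX ler_nat ltnW// ltn_expl.
have := @bdry_near A (cxy X Y) (e / c) (st n).1 (st n).2 (un n) (vn n)
  (un_ge0 n) (vn_ge0 n) (ltW (divr_gt0 e0 c0)).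
have B s t : (st n).1 <= s <= (st n).1 + un n -> (st n).2 <= t <= (st n).2 + vn n ->
   cabs (g (cxy s t) - g (cxy X Y) - A * (cxy s t - cxy X Y)) <= e / c * (un n + vn n).
  move=> hs ht; have hXY : cabs (cxy s t - cxy X Y) <= un n + vn n.
    have -> : cxy s t - cxy X Y = cxy (s - X) (t - Y) by rewrite /cxy; simpc.
    apply: le_trans (cabs_cxy _ _) _; have := HX n; have := HY n.
    by move=> *; apply: lerD; rewrite ler_norml; lra.
  have := hd (cxy s t - cxy X Y); rewrite (addrC (cxy X Y)) subrK.
  move=> /(_ (le_lt_trans hXY nd)) /le_trans; apply.
  by rewrite ler_wpM2l// ltW// divr_gt0.
move=> /(_ B) Hn; apply: le_trans (st_bound n) _.
have p4 : (0 : R) < 4 ^+ n by rewrite exprn_gt0.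
apply: le_trans (ler_wpM2l (ltW p4) Hn) _.
have -> : 4 ^+ n * (4 * (e / c) * (un n + vn n) ^+ 2) = 4 * (e / c) * (u + v) ^+ 2.
  rewrite /un /vn -mulrDl expr_div_n -exprM mulnC exprM.
  have -> : (2 : R) ^+ 2 = 4 by ring.
  by field; rewrite !gt_eqF.
have -> : 4 * (e / c) * (u + v) ^+ 2 = e * (4 * (u + v) ^+ 2 / c) by field; rewrite gt_eqF.
by rewrite ger_pMr// ler_pdivrMr// mul1r /c lerDl.
Qed.

End bisection.
End goursat.

(** * Circle integrals *)

Section complex_exponential.
Variable R : realType.
Local Notation C := R[i].

Definition eit (t : R) : C := (cos t +i* sin t)%C.

Definition cexp (z : C) : C := (expR (complex.Re z))%:C%C * eit (complex.Im z).

Lemma eitD s t : eit (s + t) = eit s * eit t.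
Proof. by rewrite /eit cosD sinD; simpc; rewrite (addrC (sin s * _)). Qed.

Lemma cabs_eit t : cabs (eit t) = 1.
Proof. by rewrite /cabs normc_def /= cos2Dsin2 sqrtr1. Qed.

Lemma eit2pi t : eit (t + pi *+ 2) = eit t.
Proof. by rewrite /eit cosD2pi sinD2pi. Qed.

Lemma cexpD z w : cexp (z + w) = cexp z * cexp w.
Proof. by rewrite /cexp !raddfD /= expRD eitD rmorphM/=; ring. Qed.

Lemma cabs_cexp z : cabs (cexp z) = expR (complex.Re z).
Proof. by rewrite cabsM cabs_eit mulr1 cabs_real gtr0_norm ?expR_gt0. Qed.

Lemma cexp_neq0 z : cexp z != 0.
Proof. by rewrite -cabs_gt0 cabs_cexp expR_gt0. Qed.

Lemma is_derive_eps (f : R -> R) (x A : R) : is_derive x 1 f A ->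
  forall e : R, 0 < e -> exists2 d : R, 0 < d &
  forall h, `|h| < d -> `|f (x + h) - f x - A * h| <= e * `|h|.
Proof.
move=> [df dfA] e e0.
have /cvgrPdist_le := df => /(_ e e0) /=; rewrite -/(derive f x 1) dfA.
rewrite near_withinE => /nbhs_ballP [d /= d0 hd].
exists d => // h hd'.
have [->|h0] := eqVneq h 0; first by rewrite addr0 subrr mulr0 subr0 normr0 mulr0.
have : ball 0 d h by rewrite -ball_normE /= sub0r normrN.
move=> /hd /(_ h0) H.
have -> : f (x + h) - f x - A * h = - h * (A - h^-1 *: (f (h *: 1 + x) - f x)).
  rewrite /GRing.scale /= mulr1 (addrC h).
  by field.
by rewrite normrM normrN mulrC ler_wpM2r.
Qed.

Lemma cder_cexp0 : cder cexp 0 1.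
Proof.
move=> e e0.
pose m := Num.min 1 (e / 8).
have e40 : 0 < m by rewrite lt_min ltr01 divr_gt0.
have [d1 d10 h1] := is_derive_eps (is_derive_expR (0 : R)) e40.
have [d2 d20 h2] := is_derive_eps (is_derive_cos (0 : R)) e40.
have [d3 d30 h3] := is_derive_eps (is_derive_sin (0 : R)) e40.
have [d4 d40 h4] := is_derive_eps (is_derive_expR (0 : R)) ltr01.
exists (Num.min (Num.min d1 d2) (Num.min d3 (Num.min d4 (m / 4)))).
  by rewrite !lt_min d10 d20 d30 d40 divr_gt0.
move=> h; rewrite !lt_min => /andP[/andP[hd1 hd2] /and3P[hd3 hd4 hm]].
have := Re_le h; have := Im_le h.
set x := complex.Re h; set y := complex.Im h; set c := cabs h => yc xc.
have c0 : 0 <= c := cabs_ge0 h.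
have := h1 _ (le_lt_trans xc hd1); have := h2 _ (le_lt_trans yc hd2).
have := h3 _ (le_lt_trans yc hd3); have := h4 _ (le_lt_trans xc hd4).
rewrite !add0r expR0 cos0 sin0 oppr0 !mul1r mul0r !subr0 addr0 => k4 k3 k2 k1.
have hxy : h = (x +i* y)%C by rewrite /x /y; case: (h).
have E : cexp h - 1 - h = ((expR x - 1 - x + expR x * (cos y - 1)) +i* ((expR x - 1) * sin y + (sin y - y)))%C.
  by rewrite /cexp -/x -/y hxy /eit; simpc; congr (_ +i* _)%C; ring.
have e01 : cexp 0 = 1 by rewrite /cexp /= expR0 /eit cos0 sin0 mul1r.
rewrite e01.
have m1 : m <= 1 by rewrite ge_min lexx.
have m2 : m <= e / 8 by rewrite ge_min lexx orbT.
have mx : m * `|x| <= m * c by rewrite ler_wpM2l// ltW.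
have my : m * `|y| <= m * c by rewrite ler_wpM2l// ltW.
have mc : m * c <= c by rewrite ler_piMl.
have mec : m * c <= e / 8 * c by rewrite ler_wpM2r.
have mc0 : 0 <= m * c by exact: mulr_ge0 (ltW e40) c0.
have ex1 : `|expR x - 1| <= 2 * c.
  have -> : expR x - 1 = (expR x - 1 - x) + x by ring.
  by apply: le_trans (ler_normD _ _) _; lra.
have exm : `|expR x - 1| <= m by apply: le_trans ex1 _; lra.
have ex2 : `|expR x| <= 2.
  rewrite gtr0_norm ?expR_gt0//; have := ler_norm (expR x - 1); lra.
have sy : `|sin y| <= 2 * c.
  have -> : sin y = (sin y - y) + y by ring.
  by apply: le_trans (ler_normD _ _) _; lra.
rewrite E; apply: le_trans (cabs_leD _) _ => /=.
have T1 : `|expR x * (cos y - 1)| <= 2 * (m * c).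
  by rewrite normrM ler_pM//; apply: le_trans k2 _.
have T2 : `|(expR x - 1) * sin y| <= m * (2 * c) by rewrite normrM ler_pM.
apply: le_trans (lerD (ler_normD _ _) (ler_normD _ _)) _; lra.
Qed.

Lemma cder_cexp z : cder cexp z (cexp z).
Proof.
move=> e e0; have e10 : 0 < e / cabs (cexp z) by rewrite divr_gt0// cabs_gt0 cexp_neq0.
have [d d0 hd] := cder_cexp0 e10; exists d => // h /hd; rewrite add0r mul1r.
have -> : cexp 0 = 1 by rewrite /cexp /= expR0 /eit cos0 sin0 mul1r.
have -> : cexp (z + h) - cexp z - cexp z * h = cexp z * (cexp h - 1 - h).
  by rewrite cexpD; ring.
rewrite cabsM => /(ler_wpM2l (cabs_ge0 (cexp z))) /le_trans; apply.
by rewrite mulrA mulrCA divff ?mulr1// gt_eqF// cabs_gt0 cexp_neq0.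
Qed.

End complex_exponential.

Section circle_mean.
Variable R : realType.
Local Notation C := R[i].
Implicit Types (f G : C -> C) (z w : C) (r : R).

(** The integral is against dt, hence equals that of G z / (i z) against dz: exponents are shifted
    by one from the usual contour integrals. *)
Definition circ G r : C := ccint 0 (pi *+ 2) (fun t => G (r%:C%C * eit t)).

Lemma rcont_eit r : rcont (fun t => r%:C%C * eit t).
Proof.
have -> : (fun t => r%:C%C * eit t) = (fun t => r%:C%C * (cexp (cxy 0 t))).
  by apply/funext => t; rewrite /cexp /= expR0 mul1r.
apply: rcontZ; apply: rcont_v => z.
by apply: cder_ccontinuous (cder_cexp z).
Qed.

Lemma rcont_comp f (g : R -> C) : (forall t, ccontinuous f (g t)) -> rcont g ->
  rcont (fun t => f (g t)).
Proof.
move=> cf cg t e e0; have [d d0 hd] := cf t e e0; have [d' d'0 hd'] := cg t d d0.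
by exists d' => // s /hd' /hd; rewrite (addrC (g t)) subrK.
Qed.

Lemma cabs_circle r t : 0 <= r -> cabs (r%:C%C * eit t) = r.
Proof. by move=> r0; rewrite cabsM cabs_eit mulr1 cabs_real ger0_norm. Qed.

Lemma circle_neq0 r t : 0 < r -> r%:C%C * eit t != 0.
Proof. by move=> r0; rewrite -cabs_gt0 cabs_circle// ltW. Qed.

Lemma rcont_circ G r : 0 < r -> (forall z, z != 0 -> ccontinuous G z) ->
  rcont (fun t => G (r%:C%C * eit t)).
Proof.
move=> r0 cG; apply: (@rcont_comp G (fun t => r%:C%C * eit t)); last exact: rcont_eit.
by move=> t; apply: cG; exact: circle_neq0.
Qed.

Lemma pi2_ge0 : (0 : R) <= pi *+ 2.
Proof. by rewrite mulrn_wge0// pi_ge0. Qed.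

Lemma circ_le G r (M : R) : 0 < r -> (forall z, z != 0 -> ccontinuous G z) ->
  (forall z, cabs z = r -> cabs (G z) <= M) -> cabs (circ G r) <= 2 * (pi *+ 2) * M.
Proof.
move=> r0 cG GM; rewrite -mulrA -[pi *+ 2]subr0; apply: ccint_le.
- exact: pi2_ge0.
- exact: rcont_circ.
- by move=> t _; rewrite GM// cabs_circle// ltW.
Qed.

(** The exponential maps the rectangle [ln r1, ln r2] x [0, 2 pi] onto the annulus. In [goursat],
    the horizontal sides cancel by periodicity and the vertical sides are the two circles. *)
Lemma circ_const G r1 r2 : 0 < r1 -> r1 <= r2 ->
  (forall z, z != 0 -> ccontinuous G z) ->
  (forall z, r1 <= cabs z <= r2 -> hol G z) -> circ G r1 = circ G r2.
Proof.
move=> r10 r12 cG hG; have r20 := lt_le_trans r10 r12.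
pose g z := G (cexp z).
have cg z : ccontinuous g z.
  move=> e e0; have [d d0 hd] := cG _ (cexp_neq0 z) e e0.
  have [d' d'0 hd'] := cder_ccontinuous (cder_cexp z) d0.
  by exists d' => // h /hd' /hd; rewrite (addrC (cexp z)) subrK.
have ln12 : 0 <= ln r2 - ln r1 by rewrite subr_ge0 ler_ln.
have := goursat cg ln12 pi2_ge0 (x0 := ln r1) (y0 := 0).
have E s t : g (cxy s t) = G ((expR s)%:C%C * eit t) by [].
have hg : forall s t : R, ln r1 <= s <= ln r1 + (ln r2 - ln r1) ->
  0 <= t <= 0 + pi *+ 2 -> hol g (cxy s t).
  move=> s t; rewrite (addrC (ln r1)) subrK => /andP[s1 s2] _.
  have [A hA] : hol G (cexp (cxy s t)).
    apply: hG; rewrite cabs_cexp /= -[r1]lnK ?posrE// -[r2]lnK ?posrE//.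
    by rewrite !ler_expR s1 s2.
  by exists (A * cexp (cxy s t)); apply: cder_comp (cder_cexp _) hA.
move=> /(_ hg); rewrite /bdry.
have -> : (fun t => g (cxy t 0) - g (cxy t (0 + pi *+ 2))) = (fun=> 0).
  by apply/funext => t; rewrite !E eit2pi subrr.
rewrite ccint_cst ?lerDl// mulr0 add0r (addrC (ln r1)) subrK add0r => /eqP.
rewrite mulf_eq0 => /orP[/eqP i0|].
  by have := cabsi R; rewrite i0 cabs0 => /eqP; rewrite eq_sym oner_eq0.
have rg s := @rcont_v R g s cg.
rewrite ccintB// subr_eq0 => /eqP H; rewrite /circ.
have L r (r0 : 0 < r) : (fun t => G (r%:C%C * eit t)) = (fun t => g (cxy (ln r) t)).
  by apply/funext => t; rewrite E lnK// posrE.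
by rewrite !L// H.
Qed.

(** Compactness of [0, 2 pi] makes the continuity uniform in the angle. This is what allows crossing
    a circle through a point where [G] is only known to be continuous, where [circ_const] does not
    apply. *)
Lemma circ_continuous G r0 : 0 < r0 -> (forall z, z != 0 -> ccontinuous G z) ->
  forall e : R, 0 < e -> exists2 d : R, 0 < d & forall r, 0 < r -> `|r - r0| < d ->
  cabs (circ G r - circ G r0) <= e.
Proof.
move=> r00 cG e e0.
have pi0 : 0 < 2 * (pi *+ 2) :> R by rewrite mulr_gt0// mulrn_wgt0// pi_gt0.
pose e1 := e / (2 * (pi *+ 2)).
have e10 : 0 < e1 by rewrite divr_gt0.
have /compact_near_coveringP/(_ _ (nbhs r0) (fun r t => cabs (G (r%:C%C * eit t) - G (r0%:C%C * eit t)) < e1)) := @segment_compact R 0 (pi *+ 2).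
move=> /(_ (nbhs_filter r0)) H.
have : \forall r \near r0, `[0, pi *+ 2]%classic `<=` (fun t => cabs (G (r%:C%C * eit t) - G (r0%:C%C * eit t)) < e1).
  apply: H => t _.
  have e120 : 0 < e1 / 2 by rewrite divr_gt0.
  have [d d0 hd] := cG _ (circle_neq0 t r00) _ e120.
  have d20 : 0 < d / 2 by rewrite divr_gt0.
  have [d1 d10 hd1] := @rcont_eit r0 t (d / 2) d20.
  exists (ball t d1, ball r0 (d / 2)); first by split; apply/nbhs_ballP; [exists d1|exists (d / 2)].
  move=> [s r] /= [hs hr].
  have hs' : cabs (r0%:C%C * eit s - r0%:C%C * eit t) < d / 2.
    by have := hd1 (s - t); rewrite (addrC t) subrK; apply; rewrite distrC.
  have hr' : cabs (r%:C%C * eit s - r0%:C%C * eit s) < d / 2.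
    by rewrite -mulrBl cabsM cabs_eit mulr1 -rmorphB/= cabs_real distrC.
  have k1 : cabs (G (r%:C%C * eit s) - G (r0%:C%C * eit t)) < e1 / 2.
    have := hd (r%:C%C * eit s - r0%:C%C * eit t); rewrite (addrC (r0%:C%C * eit t)) subrK; apply.
    have -> : r%:C%C * eit s - r0%:C%C * eit t = (r%:C%C * eit s - r0%:C%C * eit s) + (r0%:C%C * eit s - r0%:C%C * eit t) by ring.
    by rewrite (le_lt_trans (cabsD _ _))// [d]splitr ltrD.
  have k2 : cabs (G (r0%:C%C * eit s) - G (r0%:C%C * eit t)) < e1 / 2.
    have := hd (r0%:C%C * eit s - r0%:C%C * eit t); rewrite (addrC (r0%:C%C * eit t)) subrK; apply.
    by rewrite (lt_trans hs')// ltr_pdivrMr// ltr_pMr// ltr1n.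
  have -> : G (r%:C%C * eit s) - G (r0%:C%C * eit s) = (G (r%:C%C * eit s) - G (r0%:C%C * eit t)) - (G (r0%:C%C * eit s) - G (r0%:C%C * eit t)) by ring.
  by rewrite (le_lt_trans (cabsB _ _))// [e1]splitr ltrD.
move=> /nbhs_ballP [d /= d0 hd]; exists d => // r rp rr.
rewrite /circ -ccintB; try exact: rcont_circ.
have -> : e = 2 * ((pi *+ 2 - 0) * e1) by rewrite subr0 mulrA /e1 mulrC divfK// gt_eqF.
apply: ccint_le; first exact: pi2_ge0.
  by apply: rcontB; exact: rcont_circ.
move=> t ht; apply: ltW; apply: (hd r); last by rewrite /= in_itv.
by rewrite -ball_normE /= distrC.
Qed.

(** The circle is shrunk towards 0, where [G] is small. *)
Lemma circ_eq0_near0 G r : 0 < r -> (forall z, ccontinuous G z) -> G 0 = 0 ->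
  (forall z, 0 < cabs z <= r -> hol G z) -> circ G r = 0.
Proof.
move=> r0 cG G0 hG; apply: cabs0_eq0; apply/eqP; rewrite eq_le cabs_ge0 andbT.
apply/ler_addgt0Pr => e e0; rewrite add0r.
have pi0 : 0 < 2 * (pi *+ 2) :> R by rewrite mulr_gt0// mulrn_wgt0// pi_gt0.
have [d d0 hd] := cG 0 _ (divr_gt0 e0 pi0).
pose s := Num.min r (d / 2).
have s0 : 0 < s by rewrite lt_min r0 divr_gt0.
have sr : s <= r by rewrite ge_min lexx.
rewrite -(circ_const s0 sr); last 2 first.
- by move=> z _; exact: cG.
- by move=> z /andP[sz zr]; apply: hG; rewrite (lt_le_trans s0).
have -> : e = 2 * (pi *+ 2) * (e / (2 * (pi *+ 2))) by rewrite mulrC divfK// gt_eqF.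
apply: circ_le => // z zs; apply: ltW.
have := hd z; rewrite add0r G0 subr0; apply; rewrite zs.
by rewrite (@le_lt_trans _ _ (d / 2))// ?ge_min ?lexx ?orbT// ltr_pdivrMr// ltr_pMr// ltr1n.
Qed.

Lemma circ_inv_pow k r : 0 < r -> (0 < k)%N -> circ (fun z => (z ^+ k)^-1) r = 0.
Proof.
move=> r0 k0; apply: cabs0_eq0; apply/eqP; rewrite eq_le cabs_ge0 andbT.
apply/ler_addgt0Pr => e e0; rewrite add0r.
have hG z : z != 0 -> hol (fun z => (z ^+ k)^-1) z.
  by move=> z0; apply: holV; [rewrite expf_neq0|exact: holX].
have cG z : z != 0 -> ccontinuous (fun z => (z ^+ k)^-1) z.
  by move=> /hG; exact: hol_ccontinuous.
have pi0 : 0 < 2 * (pi *+ 2) :> R by rewrite mulr_gt0// mulrn_wgt0// pi_gt0.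
(* The circle is enlarged until [s^-1] is small; [s >= 1] gives s^-k <= s^-1. *)
pose s := r + 1 + 2 * (pi *+ 2) / e.
have q0 : 0 < 2 * (pi *+ 2) / e by rewrite divr_gt0.
have s1 : 1 <= s by rewrite /s; lra.
have rs : r <= s by rewrite /s; lra.
have se : 2 * (pi *+ 2) / e <= s by rewrite /s; lra.
rewrite (circ_const r0 rs)//; last first.
  by move=> z /andP[rz _]; apply: hG; rewrite -cabs_gt0 (lt_le_trans r0).
have s0 : 0 < s by apply: lt_le_trans s1.
apply: (@le_trans _ _ (2 * (pi *+ 2) * s^-1)).
  apply: circ_le => // z zs; rewrite cabsV cabsX zs lef_pV2 ?posrE ?exprn_gt0//.
  by rewrite -[leLHS]expr1; apply: ler_weXn2l.
by rewrite ler_pdivrMr// (mulrC e) -ler_pdivrMr.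
Qed.

End circle_mean.

(** * Taylor coefficients *)

Section taylor.
Variable R : realType.
Local Notation C := R[i].
Implicit Types (f : C -> C) (z w h : C) (r : R).

Lemma hol_shift f w : (forall z, hol f z) -> forall z, hol (fun h => f (w + h)) z.
Proof.
move=> hf z; have [A hA] := hf (w + z); exists (A * (0 + 1)).
apply: (@cder_comp _ f (fun h => w + h)) hA.
by apply: cderD; [exact: cder_cst|exact: cder_id].
Qed.

Lemma entire_bounded f r : (forall z, hol f z) ->
  exists2 M : R, 0 <= M & forall z, cabs z <= r -> cabs (f z) <= M.
Proof.
move=> hf.
have /compact_near_coveringP/(_ _ (pinfty_nbhs R) (fun M p => cabs (f (cxy p.1 p.2)) < M) _) :=
  compact_setX (@segment_compact R (- r) r) (@segment_compact R (- r) r).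
case=> [|M [_ HM]].
  move=> [x y] _; have [d d0 hd] := hol_ccontinuous (hf (cxy x y)) ltr01.
  have d20 : 0 < d / 2 by rewrite divr_gt0.
  exists (ball (x, y) (d / 2), [set M | cabs (f (cxy x y)) + 1 < M]).
    split; first by apply/nbhs_ballP; exists (d / 2).
    by exists (cabs (f (cxy x y)) + 1); rewrite num_real.
  move=> [[s t] M] /= [[hs ht] hM].
  apply: le_lt_trans hM.
  have := hd (cxy s t - cxy x y); rewrite (addrC (cxy x y)) subrK => H.
  have : cabs (cxy s t - cxy x y) < d.
    have -> : cxy s t - cxy x y = cxy (s - x) (t - y) by rewrite /cxy; simpc.
    apply: le_lt_trans (cabs_cxy _ _) _.
    rewrite [d]splitr; apply: ltrD; first by rewrite distrC.
    by rewrite distrC.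
  move=> /H {}H; have := cabs_triangle (f (cxy s t)) (f (cxy x y)); lra.
exists (`|M| + 1) => [|z zr]; first by rewrite addr_ge0.
apply: ltW.
have := HM (`|M| + 1) _ (complex.Re z, complex.Im z).
have -> : cxy (complex.Re z) (complex.Im z) = z by case: (z).
apply; first by rewrite (le_lt_trans (ler_norm M))// ltrDl.
by split; rewrite /= in_itv /= -ler_norml (le_trans _ zr)// ?Re_le ?Im_le.
Qed.

Lemma ccontinuousM f g z : ccontinuous f z -> ccontinuous g z ->
  ccontinuous (fun w => f w * g w) z.
Proof.
move=> cf cg e e0.
pose c := 1 + cabs (f z) + cabs (g z).
have c1 : 1 <= c by rewrite /c -addrA lerDl addr_ge0 ?cabs_ge0.
have c0 : 0 < c by apply: lt_le_trans c1.
have ca : cabs (f z) <= c by rewrite /c; have := cabs_ge0 (g z); lra.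
have cb : cabs (g z) <= c by rewrite /c; have := cabs_ge0 (f z); lra.
pose m := Num.min 1 (e / (4 * c)).
have m0 : 0 < m by rewrite lt_min ltr01 divr_gt0// mulr_gt0.
have m1 : m <= 1 by rewrite ge_min lexx.
have mc : m * c <= e / 4.
  have : m <= e / (4 * c) by rewrite ge_min lexx orbT.
  move=> /(ler_wpM2r (ltW c0)) /le_trans; apply.
  by have -> : e / (4 * c) * c = e / 4 by field; rewrite gt_eqF.
have [d1 d10 h1] := cf m m0; have [d2 d20 h2] := cg m m0.
exists (Num.min d1 d2) => [|h]; first by rewrite lt_min d10.
rewrite lt_min => /andP[/h1 {}h1 /h2 {}h2].
have -> : f (z + h) * g (z + h) - f z * g z = (f (z + h) - f z) * (g (z + h) - g z)
   + (f (z + h) - f z) * g z + f z * (g (z + h) - g z) by ring.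
have t1 : cabs ((f (z + h) - f z) * (g (z + h) - g z)) <= m * c.
  by rewrite cabsM ler_pM ?cabs_ge0 ?(ltW h1)// (le_trans (ltW h2))// (le_trans m1).
have t2 : cabs ((f (z + h) - f z) * g z) <= m * c.
  by rewrite cabsM ler_pM ?cabs_ge0 ?(ltW h1).
have t3 : cabs (f z * (g (z + h) - g z)) <= m * c.
  by rewrite cabsM mulrC ler_pM ?cabs_ge0 ?(ltW h2).
apply: le_lt_trans (cabsD _ _) _.
have := cabsD ((f (z + h) - f z) * (g (z + h) - g z)) ((f (z + h) - f z) * g z); lra.
Qed.

(** Cauchy's integral for the Taylor coefficient; the exponent is [k] rather than [k + 1] because
    [circ] integrates against dt. *)
Definition tcoef f (k : nat) : C := ((pi *+ 2)^-1)%:C%C * circ (fun z => f z * (z ^+ k)^-1) 1.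

Lemma hol_pow_div f k z : (forall z, hol f z) -> z != 0 -> hol (fun z => f z * (z ^+ k)^-1) z.
Proof. by move=> hf z0; apply: holM => //; apply: holV; [rewrite expf_neq0|exact: holX]. Qed.

Let pi2_gt0 : (0 : R) < pi *+ 2.
Proof. by rewrite mulrn_wgt0// pi_gt0. Qed.

Lemma tcoefE f k r : (forall z, hol f z) -> 0 < r ->
  tcoef f k = ((pi *+ 2)^-1)%:C%C * circ (fun z => f z * (z ^+ k)^-1) r.
Proof.
move=> hf r0.
have cG z : z != 0 -> ccontinuous (fun z => f z * (z ^+ k)^-1) z.
  by move=> z0; apply: hol_ccontinuous; exact: hol_pow_div.
have hG s : 0 < s -> forall z, s <= cabs z -> hol (fun z => f z * (z ^+ k)^-1) z.
  by move=> s0 z sz; apply: hol_pow_div => //; rewrite -cabs_gt0 (lt_le_trans s0).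
suff -> : circ (fun z => f z * (z ^+ k)^-1) r = circ (fun z => f z * (z ^+ k)^-1) 1.
  exact: erefl.
have [r1|r1] := leP r 1.
  by rewrite (circ_const r0 r1 cG)// => z /andP[+ _]; exact: hG.
by rewrite -(circ_const ltr01 (ltW r1) cG)// => z /andP[+ _]; exact: hG.
Qed.

Lemma cauchy_estimate f k r (M : R) : (forall z, hol f z) -> 0 < r ->
  (forall z, cabs z = r -> cabs (f z) <= M) -> cabs (tcoef f k) * r ^+ k <= 2 * M.
Proof.
move=> hf r0 fM; rewrite (tcoefE _ hf r0) cabsM cabs_real ger0_norm ?invr_ge0 ?(ltW pi2_gt0)//.
have : cabs (circ (fun z => f z * (z ^+ k)^-1) r) <= 2 * (pi *+ 2) * (M / r ^+ k).
  apply: circ_le => // z zr; first by apply: hol_ccontinuous; exact: hol_pow_div.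
  by rewrite cabsM cabsV cabsX zr ler_wpM2r ?fM// invr_ge0 exprn_ge0// ltW.
have pi0 : (0 : R) <= (pi *+ 2)^-1 by rewrite invr_ge0 ltW.
have rk : 0 < r ^+ k by rewrite exprn_gt0.
move=> /(ler_wpM2l pi0) /(ler_wpM2r (ltW rk)) /le_trans; apply.
have gen (q t : R) : 0 < q -> 0 < t -> q^-1 * (2 * q * (M / t)) * t = 2 * M.
  by move=> q0 t0; field; rewrite !gt_eqF.
by rewrite gen.
Qed.

(** Let [H] be the difference quotient of [f] at [z]. The function G w = H w * w has zero mean on
    every circle enclosing [z]; expanding in powers of z / w turns this into Taylor's formula, whose
    remainder is the mean of G w * (z / w)^n. The factor 4 is the 2 of [ccint_le] times the 2 in |f
    w - f z| <= 2 M. *)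
Lemma cauchy_taylor f z r n (M : R) : (forall z, hol f z) -> cabs z < r ->
  (forall w, cabs w <= r -> cabs (f w) <= M) ->
  cabs (f z - \sum_(k < n) tcoef f k * z ^+ k) <=
  4 * M * (r / (r - cabs z)) * (cabs z / r) ^+ n.
Proof.
move=> hf zr fM; have r0 : 0 < r by rewrite (le_lt_trans (cabs_ge0 z)).
have [A hA] := hf z.
pose H w := if w == z then A else (f w - f z) / (w - z).
have hH w : w != z -> hol H w.
  move=> wz.
  have [B hB] : hol (fun w => (f w - f z) / (w - z)) w.
    apply: holM; first by apply: holD => //; exact: hol_cst.
    apply: holV; first by rewrite subr_eq0.
    by apply: holD; [exact: hol_id|exact: hol_cst].
  exists B => e e0; have [d d0 hd] := hB e e0.
  have wz0 : 0 < cabs (z - w) by rewrite cabs_gt0 subr_eq0 eq_sym.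
  exists (Num.min d (cabs (z - w))) => [|h]; first by rewrite lt_min d0.
  rewrite lt_min => /andP[/hd {}hd hz]; rewrite /H (negbTE wz) ifN//.
  apply/eqP => whz; move: hz; rewrite -whz (addrC w) addrK ltxx//.
have cH w : ccontinuous H w.
  have [->|wz] := eqVneq w z; last exact/hol_ccontinuous/hH.
  move=> e e0; have [d d0 hd] := hA _ (divr_gt0 e0 (ltr0n R 2)).
  exists d => // h /hd; rewrite /H eqxx.
  case: eqP => [_ _|/eqP hz k1]; first by rewrite subrr cabs0.
  have h0 : h != 0 by apply: contraNneq hz => ->; rewrite addr0.
  have -> : (f (z + h) - f z) / (z + h - z) - A = (f (z + h) - f z - A * h) / h.
    by rewrite (addrC z) addrK; field.
  rewrite cabsM cabsV ltr_pdivrMr ?cabs_gt0//; apply: (le_lt_trans k1).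
  by rewrite ltr_pM2r ?cabs_gt0// ltr_pdivrMr// ltr_pMr// ltr1n.
pose G w := H w * w.
have cG w : ccontinuous G w by apply: ccontinuousM => //; exact/hol_ccontinuous/hol_id.
have hG w : w != z -> hol G w by move=> wz; apply: holM; [exact: hH|exact: hol_id].
have G0 : G 0 = 0 by rewrite /G mulr0.
(* [H] is only known to be continuous at [z]: the circle means of [G] are
   constant on either side of the radius [cabs z], hence equal by continuity. *)
have circG s : cabs z < s -> circ G s = 0.
  move=> zs.
  have s0 : 0 < s by rewrite (le_lt_trans (cabs_ge0 z)).
  have [z0|z0] := eqVneq z 0.
    apply: circ_eq0_near0 => // w /andP[w0 _]; apply: hG.
    by rewrite z0 -cabs_gt0.
  have cz0 : 0 < cabs z by rewrite cabs_gt0.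
  have cG' w : w != 0 -> ccontinuous G w by [].
  have lo t : 0 < t -> t < cabs z -> circ G t = 0.
    move=> t0 tz; apply: circ_eq0_near0 => // w /andP[_ wt]; apply: hG.
    by apply: contraTneq wt => ->; rewrite -ltNge.
  have mid e : 0 < e -> cabs (circ G (cabs z)) <= e.
    move=> e0; have [d d0 hd] := circ_continuous cz0 cG' e0.
    pose t := Num.max (cabs z / 2) (cabs z - d / 2).
    have t0 : 0 < t by rewrite lt_max divr_gt0.
    have tz : t < cabs z by rewrite gt_max ltr_pdivrMr// ltr_pMr// ltr1n/= ltrBlDr ltrDl divr_gt0.
    have td : `|t - cabs z| < d.
      have : cabs z - d / 2 <= t by rewrite le_max lexx orbT.
      by rewrite ltr_norml; move=> ?; apply/andP; split; lra.
    by have := hd t t0 td; rewrite lo// sub0r cabsN.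
  have mid0 : circ G (cabs z) = 0.
    apply: cabs0_eq0; apply/eqP; rewrite eq_le cabs_ge0 andbT.
    by apply/ler_addgt0Pr => e e0; rewrite add0r; exact: mid.
  apply: cabs0_eq0; apply/eqP; rewrite eq_le cabs_ge0 andbT.
  apply/ler_addgt0Pr => e e0; rewrite add0r.
  have [d d0 hd] := circ_continuous cz0 cG' e0.
  pose t := Num.min s (cabs z + d / 2).
  have tz : cabs z < t by rewrite lt_min zs ltrDl divr_gt0.
  have ts : t <= s by rewrite ge_min lexx.
  have t0 : 0 < t by apply: lt_trans tz.
  have td : `|t - cabs z| < d.
    have : t <= cabs z + d / 2 by rewrite ge_min lexx orbT.
    by rewrite ltr_norml; move=> ?; apply/andP; split; lra.
  have := hd t t0 td; rewrite mid0 subr0.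
  rewrite (circ_const t0 ts)// => w /andP[tw _]; apply: hG.
  by apply: contraTneq tw => ->; rewrite -ltNge.
have M0 : 0 <= M by apply: le_trans (fM 0 _); rewrite ?cabs_ge0// cabs0 ltW.
have rz0 : 0 < r - cabs z by rewrite subr_gt0.
(* The value [f z] comes out of the term of index 0 below, so the empty sum is treated apart. *)
case: n => [|n].
  rewrite big_ord0 subr0 expr0 mulr1; apply: le_trans (fM _ (ltW zr)) _.
  rewrite -mulrA mulrCA ler_peMr//.
  have : 1 <= r / (r - cabs z) by rewrite ler_pdivlMr// mul1r lerBlDr lerDl cabs_ge0.
  lra.
pose ze t := r%:C%C * eit t.
have ze0 t : ze t != 0 by exact: circle_neq0.
have cze t : cabs (ze t) = r by rewrite cabs_circle// ltW.
have zez t : ze t != z by apply: contraTneq zr => <-; rewrite cze ltxx.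
pose F (k : 'I_n.+1) t := z ^+ k * (f (ze t) * ((ze t) ^+ k)^-1).
pose E (k : 'I_n.+1) t := (f z * z ^+ k) * ((ze t) ^+ k)^-1.
have rF k : rcont (F k).
  apply: rcontZ; apply: (@rcont_circ _ (fun w => f w * (w ^+ k)^-1)) => // w w0.
  by apply: hol_ccontinuous; exact: hol_pow_div.
have rE k : rcont (E k).
  apply: rcontZ; apply: (@rcont_circ _ (fun w => (w ^+ k)^-1)) => // w w0.
  apply: hol_ccontinuous; apply: holV; [by rewrite expf_neq0|exact: holX].
have rG : rcont (fun t => G (ze t)) by exact: rcont_circ.
have [rsF iF] := ccint_sum 0 (pi *+ 2) (index_enum 'I_n.+1) rF.
have [rsE iE] := ccint_sum 0 (pi *+ 2) (index_enum 'I_n.+1) rE.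
(* A finite geometric sum in [z / ze t]. *)
have ident t : \sum_k F k t - \sum_k E k t - G (ze t) = - (G (ze t) * (z / ze t) ^+ n.+1).
  have fz : f (ze t) = f z + H (ze t) * (ze t - z).
    by rewrite /H ifN// divfK ?subr_eq0// addrC subrK.
  rewrite -sumrB.
  have -> : \sum_k (F k t - E k t) = H (ze t) * (ze t - z) * \sum_(k < n.+1) (z / ze t) ^+ k.
    rewrite mulr_sumr; apply: eq_bigr => k _; rewrite /F /E fz expr_div_n; ring.
  have -> : ze t - z = - (ze t * (z / ze t - 1)) by field.
  rewrite mulrN mulNr mulrA -mulrA -subrX1 /G; ring.
have iG : ccint 0 (pi *+ 2) (fun t => G (ze t)) = 0 by exact: circG.
have IF : \sum_k ccint 0 (pi *+ 2) (F k) = (pi *+ 2)%:C%C * \sum_(k < n.+1) tcoef f k * z ^+ k.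
  rewrite mulr_sumr; apply: eq_bigr => k _.
  rewrite (tcoefE k hf r0) /F ccintZ; last first.
    apply: (@rcont_circ _ (fun w => f w * (w ^+ k)^-1)) => // w w0.
    by apply: hol_ccontinuous; exact: hol_pow_div.
  rewrite -/(circ (fun w => f w * (w ^+ k)^-1) r) fmorphV/=.
  have : (pi *+ 2)%:C%C != 0 :> C by rewrite -cabs_gt0 cabs_real normr_gt0 gt_eqF.
  have gen (q x y : C) : q != 0 -> y * x = q * (q^-1 * x * y) by move=> q0; field.
  exact: gen.
have IE : \sum_k ccint 0 (pi *+ 2) (E k) = (pi *+ 2)%:C%C * f z.
  rewrite big_ord_recl big1 => [|k _].
    rewrite addr0 /E /= expr0 mulr1 ccintZ; last first.
      by under [fun t => _]funext do rewrite expr0 invr1; exact: rcont_cst.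
    under [fun t => _]funext do rewrite expr0 invr1.
    by rewrite ccint_cst ?pi2_ge0// subr0 mulr1 mulrC.
  rewrite /E ccintZ; last first.
    apply: (@rcont_circ _ (fun w => (w ^+ lift ord0 k)^-1)) => // w w0.
    apply: hol_ccontinuous; apply: holV; [by rewrite expf_neq0|exact: holX].
  by rewrite -/(circ (fun w => (w ^+ lift ord0 k)^-1) r) circ_inv_pow// mulr0.
have key : cabs (ccint 0 (pi *+ 2) (fun t => \sum_k F k t - \sum_k E k t - G (ze t))) <=
    2 * ((pi *+ 2) * (2 * M * (r / (r - cabs z)) * (cabs z / r) ^+ n.+1)).
  rewrite -[pi *+ 2 in X in _ <= X]subr0.
  apply: ccint_le; [exact: pi2_ge0|by apply: rcontB => //; exact: rcontB|move=> t _].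
  rewrite ident cabsN cabsM cabsX cabsM cabsV cze.
  rewrite ler_wpM2r ?exprn_ge0 ?divr_ge0 ?cabs_ge0 ?(ltW r0)//.
  rewrite /G cabsM cze mulrA mulrAC ler_wpM2r ?(ltW r0)//.
  rewrite /H ifN// cabsM cabsV ler_pM ?cabs_ge0 ?invr_ge0 ?cabs_ge0//.
    by rewrite (le_trans (cabsB _ _))// mulr2n mulrDl mul1r lerD// fM ?cze// ltW.
  rewrite lef_pV2 ?posrE ?cabs_gt0 ?subr_eq0//.
  by rewrite -(cze t) cabs_triangle.
rewrite -(ler_pM2l pi2_gt0).
move: key; rewrite ccintB//; last exact: rcontB.
rewrite ccintB// iF iE iG IF IE subr0 -mulrBr cabsM cabs_real ger0_norm ?(ltW pi2_gt0)//.
rewrite cabsBC => /le_trans; apply.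
by rewrite le_eqVlt; apply/orP; left; apply/eqP; ring.
Qed.

(* The radius of convergence is infinite, so on every disc the remainders can
   be compared with a fixed geometric rate. *)
Definition pow f (c : nat -> C) := forall r : R, 0 < r -> exists2 B : R, 0 <= B &
  forall n z, cabs z <= r -> cabs (f z - \sum_(k < n) c k * z ^+ k) <= B / 2 ^+ n.

(** [cauchy_taylor] on the circle of radius [2 * r]: the ratio is then at most 1/2, and the factor 2
    r / (2 r - |z|) at most 2. *)
Lemma entire_pow f : (forall z, hol f z) -> pow f (tcoef f).
Proof.
move=> hf r r0; have [M M0 fM] := entire_bounded (2 * r) hf.
exists (8 * M) => [|n z zr]; first by rewrite mulr_ge0.
have z2r : cabs z < 2 * r by rewrite (le_lt_trans zr)// ltr_pMl// ltr1n.
apply: le_trans (cauchy_taylor n hf z2r fM) _.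
have r20 : 0 < 2 * r by rewrite mulr_gt0.
apply: ler_pM; rewrite ?exprn_ge0 ?divr_ge0 ?mulr_ge0 ?cabs_ge0 ?(ltW r20) ?(ltW r0)//.
- by rewrite invr_ge0 subr_ge0 ltW.
- have : 2 * r / (2 * r - cabs z) <= 2 by rewrite ler_pdivrMr ?subr_gt0//; lra.
  move=> H; have -> : 8 * M = 4 * M * 2 by ring.
  by rewrite ler_wpM2l// mulr_ge0.
- rewrite -exprVn; apply: lerXn2r; rewrite ?nnegrE ?divr_ge0 ?cabs_ge0 ?(ltW r20) ?invr_ge0//.
  by rewrite ler_pdivrMr// mulrA mulVf ?mul1r// pnatr_eq0.
Qed.

Lemma pow_at0 f c : pow f c -> f 0 = c 0%N.
Proof.
move=> /(_ 1 ltr01) [B B0 hB].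
apply/eqP; rewrite -subr_eq0; apply/eqP/cabs0_eq0/eqP; rewrite eq_le cabs_ge0 andbT.
apply/ler_addgt0Pr => e e0; rewrite add0r.
pose n := (Num.truncn (B / e)).+1.
have nB : B / e < n%:R by rewrite truncnS_gt.
have := hB n 0; rewrite cabs0 ler01 => /(_ isT).
rewrite big_ord_recl big1 ?addr0 ?expr0 ?mulr1; last by move=> i _; rewrite expr0n mulr0.
move=> /le_trans; apply; rewrite ler_pdivrMr ?exprn_gt0// mulrC -ler_pdivrMr//.
by apply: ltW; apply: lt_le_trans nB _; rewrite -natrX ler_nat ltnW// ltn_expl.
Qed.

(** The passage from coefficients back to functions: the weighted estimates below are proved for
    absolute partial sums. *)
Lemma pow_bound f c z (B : R) : pow f c ->
  (forall n, \sum_(k < n) cabs (c k) * cabs z ^+ k <= B) -> cabs (f z) <= B.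
Proof.
move=> pf hB; apply/ler_addgt0Pr => e e0.
have z10 : 0 < cabs z + 1 by rewrite ltr_wpDl ?cabs_ge0.
have [D D0 hD] := pf _ z10.
pose n := (Num.truncn (D / e)).+1.
have nD : D / e < n%:R by rewrite truncnS_gt.
rewrite -(subrK (\sum_(k < n) c k * z ^+ k) (f z)) addrC.
apply: le_trans (cabsD _ _) _; apply: lerD.
  apply: le_trans (cabs_sum _ _ _) _; apply: le_trans (hB n).
  by apply: ler_sum => k _; rewrite cabsM cabsX.
apply: le_trans (hD n z _) _; first by rewrite lerDl.
rewrite ler_pdivrMr ?exprn_gt0// mulrC -ler_pdivrMr//.
by apply: ltW; apply: lt_le_trans nD _; rewrite -natrX ler_nat ltnW// ltn_expl.
Qed.

Lemma pow_eq f c d : pow f c -> c =1 d -> pow f d.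
Proof. by move=> pf /funext <-. Qed.

Lemma powD f g c d : pow f c -> pow g d -> pow (f \+ g) (fun k => c k + d k).
Proof.
move=> pf pg r r0; have [B B0 hB] := pf r r0; have [D D0 hD] := pg r r0.
exists (B + D) => [|n z zr]; first by rewrite addr_ge0.
have -> : (f \+ g) z - \sum_(k < n) (c k + d k) * z ^+ k =
   (f z - \sum_(k < n) c k * z ^+ k) + (g z - \sum_(k < n) d k * z ^+ k).
  by under eq_bigr do rewrite mulrDl; rewrite big_split/=; ring.
by rewrite (le_trans (cabsD _ _))// mulrDl lerD ?hB ?hD.
Qed.

Lemma powZ f c a : pow f c -> pow (fun z => a * f z) (fun k => a * c k).
Proof.
move=> pf r r0; have [B B0 hB] := pf r r0.
exists (cabs a * B) => [|n z zr]; first by rewrite mulr_ge0 ?cabs_ge0.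
have -> : a * f z - \sum_(k < n) a * c k * z ^+ k = a * (f z - \sum_(k < n) c k * z ^+ k).
  by under eq_bigr do rewrite -mulrA; rewrite -mulr_sumr; ring.
by rewrite cabsM -mulrA ler_wpM2l ?cabs_ge0 ?hB.
Qed.

Lemma pow0 : pow (fun=> 0) (fun=> 0).
Proof.
move=> r r0; exists 0 => // n z _.
by rewrite big1 ?subrr ?cabs0 ?mul0r// => k _; rewrite mul0r.
Qed.

(** The constant is uniform in the base point [w], so that expansions at [z] and at [z + h] can be
    compared. *)
Lemma taylor2 f (r : R) : (forall z, hol f z) -> exists2 B : R, 0 <= B &
  forall w h, cabs w <= r -> cabs h <= 1 ->
  cabs (f (w + h) - f w - tcoef (fun h => f (w + h)) 1 * h
     - tcoef (fun h => f (w + h)) 2 * h ^+ 2) <= B * cabs h ^+ 3.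
Proof.
move=> hf; have [M M0 fM] := entire_bounded (r + 2) hf.
exists (8 * M) => [|w h wr h1]; first by rewrite mulr_ge0.
have hs := hol_shift w hf.
have fMw k : cabs k <= 2 -> cabs (f (w + k)) <= M.
  by move=> k2; rewrite fM// (le_trans (cabsD _ _))// lerD.
have h2 : cabs h < 2 by rewrite (le_lt_trans h1)// ltr1n.
have := cauchy_taylor 3 hs h2 fMw.
rewrite !big_ord_recl big_ord0 /= expr0 mulr1 addr0 expr1.
have -> : tcoef (fun h => f (w + h)) 0 = f w.
  by rewrite -(pow_at0 (entire_pow hs)) addr0.
rewrite !opprD !addrA => /le_trans; apply.
rewrite expr_div_n -mulrA mulrA.
have c3 : 0 <= cabs h ^+ 3 by rewrite exprn_ge0 ?cabs_ge0.
have : 2 / (2 - cabs h) <= 2 by rewrite ler_pdivrMr ?subr_gt0//; lra.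
move=> H; apply: (@le_trans _ _ (4 * M * 2 * (cabs h ^+ 3 / 2 ^+ 3))).
  by apply: ler_wpM2r; [rewrite divr_ge0// exprn_ge0|rewrite ler_wpM2l// mulr_ge0].
have -> : 4 * M * 2 * (cabs h ^+ 3 / 2 ^+ 3) = M * cabs h ^+ 3 by rewrite (_ : 2 ^+ 3 = 8 :> R); [field|ring].
by rewrite ler_wpM2r// ler_peMl// ler1n.
Qed.

Lemma entire_cder f z : (forall z, hol f z) -> cder f z (tcoef (fun h => f (z + h)) 1).
Proof.
move=> hf e e0; have [B B0 hB] := taylor2 (cabs z) hf.
set c1 := tcoef _ 1; set c2 := tcoef (fun h => f (z + h)) 2.
pose K := cabs c2 + B + 1.
have K0 : 0 < K by rewrite ltr_wpDl// addr_ge0 ?cabs_ge0.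
exists (Num.min 1 (e / K)) => [|h]; first by rewrite lt_min ltr01 divr_gt0.
rewrite lt_min => /andP[h1 hK].
have := hB z h (lexx _) (ltW h1); rewrite -/c1 -/c2 => H.
rewrite -(subrK (c2 * h ^+ 2) (f (z + h) - f z - c1 * h)).
apply: le_trans (cabsD _ _) _; apply: le_trans (lerD H (lexx _)) _.
rewrite cabsM cabsX.
have ch := cabs_ge0 h.
have h32 : cabs h ^+ 3 <= cabs h ^+ 2 by rewrite exprS ler_piMl// ?exprn_ge0// ltW.
apply: (@le_trans _ _ (K * cabs h ^+ 2)).
  have := ler_wpM2l B0 h32; have := exprn_ge0 2 ch; rewrite /K !mulrDl; lra.
by rewrite expr2 mulrA ler_wpM2r// mulrC -ler_pdivlMr// ltW.
Qed.

(** The expansions at [z + h] with increments [h] and [- h] are subtracted, which cancels their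
    second-order terms; comparing with the expansion at [z] with increment [2 * h] isolates the
    difference of the first coefficients, up to (8 + 1 + 1) B |h|^3. *)
Lemma hol_derive1 f : (forall z, hol f z) -> forall z, hol (derive1 f) z.
Proof.
move=> hf z; pose c w k := tcoef (fun h => f (w + h)) k.
have df w : derive1 f w = c w 1%N by apply: cder_derive1; exact: entire_cder.
exists (2 * c z 2%N) => e e0.
have [B B0 hB] := taylor2 (cabs z + 1) hf.
pose K := cabs (c z 2%N) + 5 * B + 1.
have K0 : 0 < K by rewrite ltr_wpDl// addr_ge0 ?cabs_ge0 ?mulr_ge0.
exists (Num.min (1 / 2) (e / K)) => [|h].
  by rewrite lt_min !divr_gt0.
rewrite lt_min => /andP[h1 hK]; rewrite !df.
have [->|h0] := eqVneq h 0; first by rewrite addr0 subrr mulr0 subr0 cabs0 mulr0.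
have ch0 : 0 < cabs h by rewrite cabs_gt0.
have ch := ltW ch0.
have zh : cabs (z + h) <= cabs z + 1 by rewrite (le_trans (cabsD _ _))// lerD2l; lra.
have z1 : cabs z <= cabs z + 1 by rewrite lerDl.
have h1' : cabs h <= 1 by lra.
have h2' : cabs (2 * h) <= 1 by rewrite cabsM (cabs_nat R 2); lra.
have hN : cabs (- h) <= 1 by rewrite cabsN.
have E1 := hB _ _ zh h1'; have E2 := hB _ _ z1 h2'; have E3 := hB _ _ zh hN.
move: E1 E2 E3; rewrite -!/(c _ _).
have -> : z + h + h = z + 2 * h by ring.
have -> : z + h + - h = z by ring.
rewrite cabsN cabsM (cabs_nat R 2).
set t1 := f (z + 2 * h) - f (z + h) - _ - _; set t2 := f (z + 2 * h) - f z - _ - _.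
set t3 := f z - f (z + h) - _ - _ => E1 E2 E3.
have E : 2 * h * (c (z + h) 1%N - c z 1%N - 2 * c z 2%N * h) = t2 - (t1 - t3).
  by rewrite /t1 /t2 /t3; ring.
have : cabs (2 * h * (c (z + h) 1%N - c z 1%N - 2 * c z 2%N * h)) <= 10 * B * cabs h ^+ 3.
  rewrite E; apply: le_trans (cabsB _ _) _.
  apply: le_trans (lerD E2 (le_trans (cabsB _ _) (lerD E1 E3))) _.
  rewrite exprMn (_ : 2 ^+ 3 = 8 :> R); [lra|ring].
rewrite !cabsM (cabs_nat R 2).
have -> : 10 * B * cabs h ^+ 3 = 2 * cabs h * (5 * B * cabs h ^+ 2) by ring.
rewrite ler_pM2l ?mulr_gt0// => /le_trans; apply.
rewrite expr2 mulrA ler_wpM2r//.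
apply: (@le_trans _ _ (K * cabs h)); last by rewrite mulrC -ler_pdivlMr// ltW.
by rewrite ler_wpM2r// /K; have := cabs_ge0 (c z 2%N); lra.
Qed.

Lemma cder_sum (n : nat) (F : nat -> C -> C) (D : nat -> C) z :
  (forall i, cder (F i) z (D i)) ->
  cder (fun x => \sum_(i < n) F i x) z (\sum_(i < n) D i).
Proof.
move=> hF; elim: n => [|n IH].
  rewrite big_ord0; under [fun x => _]funext do rewrite big_ord0; exact: cder_cst.
have -> : (fun x => \sum_(i < n.+1) F i x) = (fun x => \sum_(i < n) F i x + F n x).
  by apply/funext => x; rewrite big_ord_recr.
by rewrite big_ord_recr /=; apply: cderD.
Qed.

Lemma cderX n z : cder (fun x => x ^+ n) z (n%:R * z ^+ n.-1).
Proof.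
elim: n => [|n IH]; first by rewrite mul0r; exact: cder_cst.
under [fun x => _]funext do rewrite exprS.
have -> : n.+1%:R * z ^+ n.+1.-1 = 1 * z ^+ n + z * (n%:R * z ^+ n.-1).
  by case: n {IH} => [|n]; rewrite /= ?expr0 -?natr1 ?exprS; ring.
by apply: cderM IH; exact: cder_id.
Qed.

(** The Taylor remainder [g] is small on the disc of radius [r + 1]; Cauchy's estimate on the unit
    circle about [z] transfers this to its derivative. *)
Lemma pow_derive1 f c : (forall z, hol f z) -> pow f c ->
  pow (derive1 f) (fun k => k.+1%:R * c k.+1).
Proof.
move=> hf pf r r0; have r10 : 0 < r + 1 by rewrite addr_gt0.
have [B B0 hB] := pf _ r10; exists (2 * B) => [|n z zr]; first by rewrite mulr_ge0.
pose S x := \sum_(k < n.+1) c k * x ^+ k.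
have cS x : cder S x (\sum_(k < n) k.+1%:R * c k.+1 * x ^+ k).
  have E : \sum_(k < n) k.+1%:R * c k.+1 * x ^+ k =
      \sum_(k < n.+1) (0 * x ^+ k + c k * (k%:R * x ^+ k.-1)).
    rewrite big_ord_recl /= !mul0r mulr0 !add0r.
    by apply: eq_bigr => k _; rewrite /= /bump /= mul0r add0r; ring.
  rewrite E; apply: (@cder_sum n.+1 (fun k y => c k * y ^+ k)
    (fun k => 0 * x ^+ k + c k * (k%:R * x ^+ k.-1))) => k.
  by apply: (@cderM _ (fun=> c k)); [exact: cder_cst|exact: cderX].
pose g x := f x + (-1) * S x.
have hg x : hol g x.
  by apply: holD => //; apply: holM; [exact: hol_cst|exists (\sum_(k < n) k.+1%:R * c k.+1 * x ^+ k)].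
have cg : cder g z (tcoef (fun h => f (z + h)) 1 + (0 * S z + (-1) * (\sum_(k < n) k.+1%:R * c k.+1 * z ^+ k))).
  apply: cderD; first exact: entire_cder.
  by apply: (@cderM _ (fun=> -1)) => //; exact: cder_cst.
rewrite (cder_derive1 (entire_cder z hf)).
have := cder_unique cg (entire_cder z hg).
rewrite mul0r add0r mulN1r => ->.
have hgz := hol_shift z hg.
have := @cauchy_estimate _ 1 1 (B / 2 ^+ n) hgz ltr01.
rewrite expr1 mulr1 mulrA => H; apply: H => w w1.
rewrite /g mulN1r; apply: (@le_trans _ _ (B / 2 ^+ n.+1)).
  by apply: hB; rewrite (le_trans (cabsD _ _))// w1 lerD2r.
rewrite ler_wpM2l// lef_pV2 ?posrE ?exprn_gt0//.
by rewrite exprS ler_peMl ?ler1n// exprn_ge0.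
Qed.

Lemma derive1n_at0 f c j : (forall z, hol f z) -> pow f c ->
  derive1n j f 0 = j`!%:R * c j.
Proof.
elim: j f c => [|j IH] f c hf pf; first by rewrite fact0 mul1r -(pow_at0 pf).
rewrite /derive1n iterSr -/(derive1n j (derive1 f)) (IH _ _ (hol_derive1 hf) (pow_derive1 hf pf)).
by rewrite factS natrM; ring.
Qed.

End taylor.

(** * The integration operator on Taylor coefficients *)

Section integration.
Variable R : realType.
Local Notation C := R[i].
Local Notation mu := (@lebesgue_measure R).
Implicit Types (f : C -> C) (z w : C).

Lemma Rint_pow k : Rintegral mu `[0, 1] (fun t : R => t ^+ k) = k.+1%:R^-1.
Proof.
have cX n : continuous (fun t : R => t ^+ n) by move=> t; exact: exprn_continuous.
have dF (x : R) : is_derive x 1 (fun t : R => k.+1%:R^-1 * t ^+ k.+1) (x ^+ k).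
  have -> : x ^+ k = k.+1%:R^-1 *: ((k.+1%:R * id x ^+ k) *: (1 : R)).
    by rewrite /GRing.scale /= mulr1 mulrA mulVf ?mul1r// pnatr_eq0.
  have -> : (fun t : R => k.+1%:R^-1 * t ^+ k.+1) = k.+1%:R^-1 \*: ((id : R -> R) ^+ k.+1).
    by apply/funext => t; rewrite exprfctE.
  by apply: is_deriveZ; apply: is_deriveX.
rewrite /Rintegral (@continuous_FTC2 R (fun t => t ^+ k) (fun t => k.+1%:R^-1 * t ^+ k.+1)) //.
- by rewrite expr1n mulr1 expr0n mulr0 sube0.
- exact: continuous_subspaceT.
- split.
  + by move=> x _; exact: ex_derive.
  + apply: cvg_at_right_filter; by apply: cvgM; [exact: cvg_cst|exact: cX].
  + apply: cvg_at_left_filter; by apply: cvgM; [exact: cvg_cst|exact: cX].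
- by move=> x _; rewrite derive1E; have [] := dF x.
Qed.

Lemma ccint_pow k (a : C) : ccint 0 1 (fun t => a * (t%:C%C) ^+ k) = a / k.+1%:R.
Proof.
have rX : rcont (fun t : R => (t%:C%C : C) ^+ k).
  apply: (@rcont_comp _ (fun z => z ^+ k)).
    by move=> t; apply/hol_ccontinuous/holX.
  move=> t e e0; exists e => // s se.
  by rewrite -rmorphB/= (addrC t) addrK cabs_real.
rewrite ccintZ//; congr (_ * _).
have E (t : R) : (t%:C%C : C) ^+ k = (t ^+ k)%:C%C by rewrite rmorphXn.
rewrite /ccint.
have -> : Rintegral mu `[0, 1] (@complex.Re R \o (fun t => t%:C%C ^+ k)) = k.+1%:R^-1.
  by rewrite -Rint_pow; apply: eq_Rintegral => t _ /=; rewrite E.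
have -> : Rintegral mu `[0, 1] (@complex.Im R \o (fun t => t%:C%C ^+ k)) = 0.
  transitivity (Rintegral mu `[0, 1] (fun=> 0 : R)); last by rewrite Rintegral_cst// mul0r.
  by apply: eq_Rintegral => t _ /=; rewrite E.
by rewrite -(rmorph_nat (real_complex R)) -fmorphV.
Qed.

Definition Jcoef (c : nat -> C) k := if k is k'.+1 then c k' / k'.+1%:R else 0.

Lemma J_pow f c : (forall z, hol f z) -> pow f c -> pow (J f) (Jcoef c).
Proof.
move=> hf pf r r0; have [B B0 hB] := pf _ r0.
exists (4 * r * B) => [|n z zr]; first exact: mulr_ge0 (mulr_ge0 (ler0n _ 4) (ltW r0)) B0.
have rz : rcont (fun t : R => t%:C%C * z).
  under [fun t => _]funext do rewrite mulrC; apply: rcontZ.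
  by move=> t e e0; exists e => // s se; rewrite -rmorphB/= (addrC t) addrK cabs_real.
have rM (g : C -> C) : (forall z, hol g z) -> rcont (fun t : R => g (t%:C%C * z) * z).
  move=> hg; under [fun t => _]funext do rewrite mulrC; apply: rcontZ.
  by apply: (@rcont_comp _ g (fun t => t%:C%C * z)) => // t; exact: hol_ccontinuous.
have tz (t : R) : 0 <= t <= 1 -> cabs (t%:C%C * z) <= r.
  move=> /andP[t0 t1]; rewrite cabsM cabs_real ger0_norm// (le_trans _ zr)//.
  by rewrite ler_piMl ?cabs_ge0.
have bound m : cabs (J f z - \sum_(k < m) c k / k.+1%:R * z ^+ k.+1) <= 2 * (r * (B / 2 ^+ m)).
  pose S w := \sum_(k < m) c k * w ^+ k.
  have hS w : hol S w by apply: hol_sum => k; apply: holM; [exact: hol_cst|exact: holX].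
  have -> : \sum_(k < m) c k / k.+1%:R * z ^+ k.+1 = ccint 0 1 (fun t => S (t%:C%C * z) * z).
    pose F (k : 'I_m) (t : R) := c k * z ^+ k.+1 * t%:C%C ^+ k.
    have -> : (fun t => S (t%:C%C * z) * z) = (fun t => \sum_k F k t).
      apply/funext => t; rewrite /S mulr_suml; apply: eq_bigr => k _.
      by rewrite /F exprMn exprS; ring.
    have rF k : rcont (F k).
      apply: rcontZ; apply: (@rcont_comp _ (fun z => z ^+ k) (fun t => t%:C%C)).
        by move=> t; apply/hol_ccontinuous/holX.
      by move=> t e e0; exists e => // s se; rewrite -rmorphB/= (addrC t) addrK cabs_real.
    rewrite (ccint_sum 0 1 _ rF).2; apply: eq_bigr => k _.
    by rewrite ccint_pow; ring.
  have -> : J f z = ccint 0 1 (fun t => f (t%:C%C * z) * z) by [].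
  rewrite -ccintB; [|exact: rM|exact: rM].
  have -> : 2 * (r * (B / 2 ^+ m)) = 2 * ((1 - 0) * (r * (B / 2 ^+ m))) :> R by rewrite subr0 mul1r.
  apply: ccint_le => //; first by apply: rcontB; exact: rM.
  move=> t /tz ht; rewrite -mulrBl cabsM mulrC ler_pM ?cabs_ge0//; exact: hB.
have B2 m : 2 * (r * (B / 2 ^+ m)) = 4 * r * B / 2 ^+ m.+1.
  by rewrite exprS invfM; field; rewrite expf_neq0.
(* [J] raises degrees by one, so the remainder of order n + 1 of [J f] comes from that of order n of
   [f]. *)
case: n => [|n].
  rewrite big_ord0 expr0 divr1; have := bound 0%N; rewrite big_ord0 expr0 divr1 => /le_trans; apply.
  have : 0 <= r * B by rewrite mulr_ge0// ltW.
  lra.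
by rewrite big_ord_recl /= mul0r add0r -B2; exact: bound.
Qed.

End integration.

(** * Log-convex minorants *)

(* A function of exponential type growth [exp (a * P r)] is only sensitive to
   the largest minorant [Q] of [P] which is convex in [ln r], because its Taylor
   coefficients only see the lines below [P]. *)
Section log_convex_minorant.
Variable R : realType.
Variables (P : R -> R) (D : R).
Hypothesis P_ge0 : forall r, 0 <= r -> 0 <= P r.
Hypothesis D_ge1 : 1 <= D.
Hypothesis P_shift : forall r, 0 <= r -> P (r + 1) <= D * (P r + 1).
Hypothesis P_super : forall k : R, exists c : R, forall r, 0 <= r -> k * r - c <= P r.

(** Nonnegative slopes make the minorant nondecreasing, and include the slopes k / a that come from
    Taylor coefficients. *)
Definition log_line (N c : R) := 0 <= N /\ forall s, 0 < s -> N * ln s - c <= P s.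

Definition log_minorant (r : R) : R :=
  sup [set y | exists N c, log_line N c /\ y = N * ln r - c].

Local Notation Q := log_minorant.

Lemma log_line0 : log_line 0 0.
Proof. by split=> // s s0; rewrite mul0r subr0 P_ge0// ltW. Qed.

Lemma has_sup_lines r : 0 < r -> has_sup [set y | exists N c, log_line N c /\ y = N * ln r - c].
Proof.
move=> r0; split; first by exists 0, 0, 0; split; [exact: log_line0|rewrite mul0r subr0].
by exists (P r) => _ [N [c [[_ h] ->]]]; exact: h.
Qed.

Lemma log_minorant_line r N c : 0 < r -> log_line N c -> N * ln r - c <= Q r.
Proof.
by move=> r0 l; apply: sup_upper_bound; [exact: has_sup_lines|exists N, c].
Qed.

Lemma log_minorant_le_of r x : 0 < r ->
  (forall N c, log_line N c -> N * ln r - c <= x) -> Q r <= x.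
Proof.
move=> r0 h; apply: ge_sup; first by have [] := has_sup_lines r0.
by move=> _ [N [c [l ->]]]; exact: h.
Qed.

Lemma log_minorant_le r : 0 < r -> Q r <= P r.
Proof. by move=> r0; apply: log_minorant_le_of => // N c [_]; exact. Qed.

Lemma log_minorant_ge0 r : 0 < r -> 0 <= Q r.
Proof.
by move=> r0; have := log_minorant_line r0 log_line0; rewrite mul0r subr0.
Qed.

Lemma log_minorant_approx r : 0 < r -> exists N c, log_line N c /\ Q r - 1 <= N * ln r - c.
Proof.
move=> r0; have [_ [N [c [l ->]]] h] := sup_adherent ltr01 (has_sup_lines r0).
by exists N, c; split=> //; exact: ltW.
Qed.

Lemma log_minorant_mono r s : 0 < r -> r <= s -> Q r <= Q s.
Proof.
move=> r0 rs; have s0 := lt_le_trans r0 rs.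
apply: log_minorant_le_of => // N c l; apply: le_trans (log_minorant_line s0 l).
by rewrite lerD2r ler_wpM2l ?l.1// ler_ln.
Qed.

(* Concavity of [ln] at the barycentre [(s + 1) / (r + 1)] of [s / r] and [1]. *)
Lemma ln_shift (r s : R) : 0 < r -> 0 < s ->
  r / (r + 1) * (ln s - ln r) <= ln (s + 1) - ln (r + 1).
Proof.
move=> r0 s0; have r10 : 0 < r + 1 by rewrite addr_gt0.
have s10 : 0 < s + 1 by rewrite addr_gt0.
have ln1 (x : R) : 0 < x -> ln x <= x - 1.
  by move=> x0; have := @le_ln1Dx R (x - 1); rewrite (addrC 1) subrK; apply; lra.
have h1 := ln1 (s / r * ((r + 1) / (s + 1))); have h2 := ln1 ((r + 1) / (s + 1)).
rewrite !lnM ?lnV ?posrE ?divr_gt0 ?invr_gt0// in h1 h2.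
have {}h1 := h1 (mulr_gt0 (divr_gt0 s0 r0) (divr_gt0 r10 s10)).
have {}h2 := h2 isT.
have l0 : 0 <= r / (r + 1) by rewrite divr_ge0// ltW.
have l1 : 0 <= 1 - r / (r + 1) by rewrite subr_ge0 ler_pdivrMr// mul1r lerDl.
have := lerD (ler_wpM2l l0 h1) (ler_wpM2l l1 h2).
have -> : r / (r + 1) * (s / r * ((r + 1) / (s + 1)) - 1) + (1 - r / (r + 1)) * ((r + 1) / (s + 1) - 1) = 0.
  by field; rewrite !gt_eqF.
lra.
Qed.

(** A line below [P], read at s + 1, lies above its tangent at s = r in the variable ln s, by
    [ln_shift]. Dividing that tangent by [D] and subtracting 1 gives a line below [P], by
    [P_shift]. *)
Lemma log_minorant_shift r : 0 < r -> Q (r + 1) <= D * (Q r + 1).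
Proof.
move=> r0; have r10 : 0 < r + 1 by rewrite addr_gt0.
have D0 : 0 < D by apply: lt_le_trans D_ge1.
apply: log_minorant_le_of => // N c [N0 hl].
pose N' := N * (r / (r + 1)) / D.
(* Chosen so that the new line takes the value (N ln (r + 1) - c) / D - 1 at r. *)
pose c' := N' * ln r - ((N * ln (r + 1) - c) / D - 1).
have l' : log_line N' c'.
  split; first exact: divr_ge0 (mulr_ge0 N0 (divr_ge0 (ltW r0) (ltW r10))) (ltW D0).
  move=> s s0.
  have := ler_wpM2l N0 (ln_shift r0 s0) => h.
  have s10 : 0 < s + 1 by rewrite addr_gt0.
  have := le_trans (hl _ s10) (P_shift (ltW s0)) => h'.
  have -> : N' * ln s - c' = (N * (r / (r + 1) * (ln s - ln r)) + (N * ln (r + 1) - c)) / D - 1.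
    by rewrite /c' /N'; field; rewrite !gt_eqF.
  by rewrite lerBlDr ler_pdivrMr// [leRHS]mulrC; lra.
have := log_minorant_line r0 l'; rewrite /c' opprB addrC subrK lerBlDr ler_pdivrMr//.
by rewrite (mulrC D).
Qed.

Lemma log_minorant_super k : exists c : R, forall r, 0 < r -> k * r - c <= Q r.
Proof.
have [k0|k0] := lerP k 0.
  exists 0 => r r0; rewrite subr0; apply: le_trans (log_minorant_ge0 r0).
  by rewrite mulr_le0_ge0// ltW.
have [c hc] := P_super k; exists c => r r0.
have kr : 0 <= k * r by rewrite mulr_ge0 ?ltW.
(* The tangent at r, in the variable ln s, of the function k s - c, which is convex in ln s. *)
have l : log_line (k * r) (k * r * ln r - (k * r - c)).
  split=> // s s0; apply: le_trans (hc s (ltW s0)).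
  have : ln (s / r) <= s / r - 1.
    have sr : 0 < s / r by rewrite divr_gt0.
    by have := @le_ln1Dx R (s / r - 1); rewrite (addrC 1) subrK; apply; lra.
  rewrite lnM ?lnV ?posrE ?invr_gt0// => /(ler_wpM2l kr).
  have -> : k * r * (s / r - 1) = k * s - k * r by field; rewrite gt_eqF.
  lra.
by have := log_minorant_line r0 l; rewrite opprB addrC subrK.
Qed.

(** The point [r1] reaches half the supremum of Q t / t on a bounded interval [1, M], chosen by
    superlinearity to make this supremum at least 2 B. The factor 2 makes up for the supremum not
    being attained, and [Q 1] covers t < 1. *)
Lemma log_minorant_record (B : R) : exists r1, [/\ 1 <= r1, B * r1 <= Q r1 &
  forall t, 0 < t -> t <= r1 -> Q t <= Q 1 + 2 * (Q r1 / r1) * t].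
Proof.
pose B1 := Num.max 1 B.
have B10 : 0 < B1 by rewrite lt_max ltr01.
have [c hc] := log_minorant_super (2 * B1 + 1).
pose M := Num.max 1 c.
have M1 : 1 <= M by rewrite le_max lexx.
have M0 : 0 < M by apply: lt_le_trans M1.
pose S := [set y | exists2 t, 1 <= t <= M & y = Q t / t].
have hS : has_sup S.
  split; first by exists (Q 1 / 1), 1; rewrite ?lexx.
  exists (Q M) => _ [t /andP[t1 tM] ->].
  have t0 : 0 < t by apply: lt_le_trans t1.
  rewrite ler_pdivrMr//; apply: le_trans (log_minorant_mono t0 tM) _.
  by rewrite ler_peMr ?log_minorant_ge0.
have SB : 2 * B1 <= sup S.
  apply: (@le_trans _ _ (Q M / M)); last first.
    by apply: sup_upper_bound => //; exists M; rewrite ?M1 ?lexx.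
  rewrite ler_pdivlMr//; have := hc M M0.
  have : c <= M by rewrite le_max lexx orbT.
  lra.
have S0 : 0 < sup S by apply: lt_le_trans SB; rewrite mulr_gt0.
have S20 : 0 < sup S / 2 by rewrite divr_gt0.
have [_ [r1 /andP[r11 r1M] ->] h] := sup_adherent S20 hS.
have r10 : 0 < r1 by apply: lt_le_trans r11.
have h' : sup S <= 2 * (Q r1 / r1) by lra.
exists r1; split => //.
  have BB : B <= B1 by rewrite le_max lexx orbT.
  by rewrite -ler_pdivlMr//; lra.
move=> t t0 tr1; have [t1|t1] := lerP t 1.
  apply: le_trans (log_minorant_mono t0 t1) _; rewrite lerDl.
  by rewrite !mulr_ge0 ?invr_ge0 ?(ltW r10) ?(ltW t0) ?log_minorant_ge0.
apply: (@le_trans _ _ (2 * (Q r1 / r1) * t)); last by rewrite lerDr log_minorant_ge0.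
rewrite -ler_pdivrMr//; apply: le_trans h'; apply: sup_upper_bound => //.
by exists t => //; rewrite (ltW t1) (le_trans tr1).
Qed.

(** After taking logarithms, the hypothesis says that a line of slope k / a lies below [P], hence
    below [Q]. *)
Lemma coef_log_minorant (x C a : R) k : 0 <= x -> 0 < C -> 0 < a ->
  (forall r, 0 < r -> x * r ^+ k <= C * expR (a * P r)) ->
  forall r, 0 < r -> x * r ^+ k <= C * expR (a * Q r).
Proof.
move=> x0 C0 a0 h r r0; have [->|xn0] := eqVneq x 0.
  by rewrite mul0r mulr_ge0 ?expR_ge0 ?ltW.
have {x0 xn0}x0 : 0 < x by rewrite lt_neqAle eq_sym xn0.
have E s : 0 < s -> (x * s ^+ k) / C = expR (ln (x / C) + k%:R * ln s).
  move=> s0; rewrite expRD mulrC expRM_natl !lnK ?posrE ?divr_gt0//; ring.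
have l : log_line (k%:R / a) (- ln (x / C) / a).
  split=> [|s s0]; first by rewrite divr_ge0// ltW.
  have := h s s0; rewrite -ler_pdivrMl// mulrC E// ler_expR => H.
  have -> : k%:R / a * ln s - - ln (x / C) / a = (ln (x / C) + k%:R * ln s) / a by ring.
  by rewrite ler_pdivrMr// (mulrC (P s)).
have := log_minorant_line r0 l.
have -> : k%:R / a * ln r - - ln (x / C) / a = (ln (x / C) + k%:R * ln r) / a by ring.
by rewrite ler_pdivrMr// (mulrC _ a) => H; rewrite -ler_pdivrMl// mulrC E// ler_expR.
Qed.

(** From r to r + 1 the line rises by at least N / (r + 1), while it starts at [Q r - 1] or higher
    and ends below [Q (r + 1)]. *)
Lemma log_line_slope r N c : 0 < r -> log_line N c -> Q r - 1 <= N * ln r - c ->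
  N <= (r + 1) * (D * (Q r + 1) + 1).
Proof.
move=> r0 l h; have r10 : 0 < r + 1 by rewrite addr_gt0.
have h1 := le_trans (log_minorant_line r10 l) (log_minorant_shift r0).
have h2 : (r + 1)^-1 <= ln (r + 1) - ln r.
  have r1 : 0 < r / (r + 1) by rewrite divr_gt0.
  have := @le_ln1Dx R (r / (r + 1) - 1).
  rewrite (addrC 1) subrK lnM ?lnV ?posrE ?invr_gt0//.
  have -> : r / (r + 1) - 1 = - (r + 1)^-1 by field; rewrite gt_eqF.
  have i1 : (r + 1)^-1 < 1 by rewrite invf_lt1// ltrDr.
  by rewrite ltrN2 => /(_ i1); lra.
have Q0 := log_minorant_ge0 r0.
have := ler_wpM2l l.1 h2; rewrite -(ler_pM2l r10).
have -> : (r + 1) * (N / (r + 1)) = N by field; rewrite gt_eqF.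
move=> /le_trans; apply; rewrite ler_pM2l//; lra.
Qed.

End log_convex_minorant.

(** * Reciprocals of power series *)

Section inverse_series.
Variable R : realType.

(* [H] bounds the coefficients of [1 / (1 - \sum_k alpha_k x^k)]. *)
Lemma inverse_series_le (H alpha beta : nat -> R) n :
  (forall k, 0 <= alpha k) -> (forall k, 0 <= beta k) -> beta 0%N <= 1 ->
  (forall k l, beta (k + l)%N <= beta k * beta l) ->
  (forall i, 0 <= H i) -> H 0%N <= 1 ->
  (forall i, H i.+1 <= \sum_(k < i.+1) alpha k.+1 * H (i - k)%N) ->
  \sum_(k < n) alpha k.+1 * beta k.+1 <= 1 ->
  forall i, (i <= n)%N -> H i * beta i <= 1.
Proof.
move=> a0 b0 b1 bm h0 h1 hS sum1; elim/ltn_ind => -[|i] IH iltn.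
  by rewrite -[leRHS]mulr1 ler_pM.
apply: (@le_trans _ _ (\sum_(k < i.+1) alpha k.+1 * beta k.+1)); last first.
  apply: le_trans sum1; rewrite (big_ord_widen_cond n xpredT (fun k => alpha k.+1 * beta k.+1))//.
  rewrite [leRHS](bigID (fun k : 'I_n => (k < i.+1)%N))/= lerDl.
  by apply: sumr_ge0 => k _; rewrite mulr_ge0.
apply: le_trans (ler_wpM2r (b0 _) (hS i)) _; rewrite mulr_suml; apply: ler_sum => k _.
rewrite -mulrA ler_wpM2l//.
have ki : (k <= i)%N by rewrite -ltnS.
have := bm k.+1 (i - k)%N; rewrite addSn subnKC// => /(ler_wpM2l (h0 (i - k)%N)) /le_trans; apply.
rewrite mulrCA -[leRHS]mulr1 ler_wpM2l// IH//; first by rewrite ltnS leq_subr.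
by rewrite (leq_trans _ iltn)// ltnW// ltnS leq_subr.
Qed.

Variables (mu r1 : R).
Hypotheses (mu0 : 0 < mu) (r10 : 0 < r1).

(** Weights equal to mu^-k up to k ~ mu r1 and decaying like r1^k / k! afterwards. The factors
    decrease in [j], which makes them submultiplicative, as the inversion of a series requires. *)
Definition beta k := \prod_(j < k) Num.min mu^-1 (r1 / j.+1%:R).

Let fac_ge0 j : 0 <= Num.min mu^-1 (r1 / j.+1%:R).
Proof. by rewrite le_min invr_ge0 (ltW mu0) divr_ge0// ltW. Qed.

Lemma beta_ge0 k : 0 <= beta k.
Proof. exact: prodr_ge0. Qed.

Lemma beta_gt0 k : 0 < beta k.
Proof. by apply: prodr_gt0 => j _; rewrite lt_min invr_gt0 mu0 divr_gt0. Qed.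

Lemma betaM k l : beta (k + l) <= beta k * beta l.
Proof.
rewrite /beta big_split_ord /=; apply: ler_wpM2l; first exact: prodr_ge0.
apply: ler_prod => j _; rewrite fac_ge0/= le_min ge_min lexx/=.
rewrite ge_min; apply/orP; right.
by rewrite ler_wpM2l ?(ltW r10)// lef_pV2 ?posrE// ler_nat ltnS leq_addl.
Qed.

Lemma beta_le_mu k : beta k <= mu^-1 ^+ k.
Proof.
rewrite -[k in X in _ <= X]card_ord -prodr_const; apply: ler_prod => j _.
by rewrite fac_ge0/= ge_min lexx.
Qed.

Lemma beta_le_fact m d :
  beta (m + d) <= mu^-1 ^+ m * (r1 ^+ d * m`!%:R / (m + d)`!%:R).
Proof.
have f0 j : j`!%:R != 0 :> R by rewrite pnatr_eq0 -lt0n fact_gt0.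
elim: d => [|d IH]; first by rewrite addn0 expr0 mul1r divff// mulr1 beta_le_mu.
rewrite addnS /beta big_ord_recr /= -/(beta (m + d)).
have h : Num.min mu^-1 (r1 / (m + d).+1%:R) <= r1 / (m + d).+1%:R by rewrite ge_min lexx orbT.
apply: le_trans (ler_pM (beta_ge0 _) (fac_ge0 _) IH h) _.
rewrite factS natrM exprS le_eqVlt; apply/orP; left; apply/eqP.
by field; rewrite f0 gt_eqF//= addrC pnatr_eq0.
Qed.

(* Each factor of [r1^i / (i! beta_i)] is [max (mu r1 / j) 1], so the product
   is largest at [i ~ mu r1]. *)
Lemma beta_exp i : r1 ^+ i / i`!%:R <= expR (mu * r1) * beta i.
Proof.
pose y := mu * r1; have y0 : 0 < y by rewrite mulr_gt0.
have ex j : y ^+ j / j`!%:R <= expR y.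
  case: j => [|j]; first by rewrite expr0 divr1 -expR0 ler_expR ltW.
  by have := expR_ge1Dxn j (ltW y0); apply: le_trans; rewrite lerDr.
(* The equality is carried along while mu^-1 is the minimum, where y^i / i! <= e^y gives the bound;
   afterwards both sides gain the same factor. *)
suff [_ ?] : (i%:R <= y -> r1 ^+ i / i`!%:R = y ^+ i / i`!%:R * beta i) /\
    r1 ^+ i / i`!%:R <= expR y * beta i by [].
elim: i => [|i [IH1 IH2]].
  rewrite /beta big_ord0 !expr0 !mulr1; split=> //.
  by rewrite divr1 -expR0 ler_expR ltW.
have b : beta i.+1 = beta i * Num.min mu^-1 (r1 / i.+1%:R) by rewrite /beta big_ord_recr.
have i0 : 0 < i.+1%:R :> R by [].
have f0 : i`!%:R != 0 :> R by rewrite pnatr_eq0 -lt0n fact_gt0.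
have E : r1 ^+ i.+1 / i.+1`!%:R = r1 ^+ i / i`!%:R * (r1 / i.+1%:R).
  by rewrite exprS factS natrM; field; rewrite f0 gt_eqF.
have [iy|yi] := lerP (i.+1%:R) y.
  have m : Num.min mu^-1 (r1 / i.+1%:R) = mu^-1.
    apply/min_idPl; rewrite ler_pdivlMr// ler_pdivrMl//.
  have H : r1 ^+ i.+1 / i.+1`!%:R = y ^+ i.+1 / i.+1`!%:R * beta i.+1.
    rewrite E IH1; last by apply: le_trans iy; rewrite ler_nat.
    by rewrite b m exprS factS natrM /y; field; rewrite f0 !gt_eqF.
  by split=> //; rewrite H ler_wpM2r ?beta_ge0.
split=> [//|].
have m : Num.min mu^-1 (r1 / i.+1%:R) = r1 / i.+1%:R.
  by apply/min_idPr; rewrite ler_pdivrMr// ler_pdivlMl// ltW.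
by rewrite E b m [leRHS]mulrA ler_wpM2r// divr_ge0 ?ltW.
Qed.

Lemma exprD1_ge (a : R) n : 0 <= a -> a ^+ n.+1 + n.+1%:R * a ^+ n <= (a + 1) ^+ n.+1.
Proof.
move=> a0; elim: n => [|n IH]; first by rewrite expr0 mulr1 !expr1.
rewrite [leRHS]exprS; have a1 : 0 <= a + 1 by rewrite addr_ge0.
apply: le_trans (ler_wpM2l a1 IH).
have : 0 <= n.+1%:R * a ^+ n by rewrite mulr_ge0// exprn_ge0.
rewrite -(natr1 n.+1) !(exprS a); lra.
Qed.

(** Induction on (1 + 1/k)^k >= 2. The gain 2^-k over k^k beats the loss (4/3)^k from the
    exponentials in [sum_alpha_beta]. *)
Lemma fact_le_half k : (0 < k)%N -> k`!%:R <= 2 * (k%:R / 2) ^+ k :> R.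
Proof.
case: k => // k _; elim: k => [|k IH]; first by rewrite expr1 (_ : 1`!%:R = 1 :> R)//; lra.
rewrite factS natrM; apply: le_trans (ler_wpM2l (ler0n _ _) IH) _.
have k20 : 0 <= k.+2%:R / 2 :> R by rewrite divr_ge0.
have : 2 * (k.+1%:R / 2) ^+ k.+1 <= (k.+2%:R / 2) ^+ k.+1 :> R.
  rewrite !expr_div_n mulrA ler_wpM2r ?invr_ge0 ?exprn_ge0//.
  have := @exprD1_ge k.+1%:R k (ler0n _ _); rewrite -exprS natr1; lra.
move=> /(ler_wpM2l k20); rewrite -exprS; lra.
Qed.

Lemma expR_quarter : expR (4^-1 : R) <= 4 / 3.
Proof.
have := expR_ge1Dx (- (4^-1) : R); rewrite expRN => h.
rewrite -[expR _]invrK -[4 / 3]invrK lef_pV2 ?posrE ?invr_gt0 ?expR_gt0//.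
by apply: le_trans h; lra.
Qed.

(* [alpha_(k + 1)] is estimated at [t = (k + 1) / mu] for [k < m] and at [t =
   r1] for [k >= m]. *)
Lemma sum_alpha_beta (alpha : nat -> R) (C nu : R) n m :
  0 < C -> mu = 4 * nu -> (forall k, 0 <= alpha k) ->
  (forall k (t : R), 0 < t -> t <= r1 -> alpha k.+1 * t ^+ k <= C * k`!%:R * expR (nu * t)) ->
  8 * C <= mu -> (0 < m)%N -> m%:R <= mu * r1 -> mu * r1 <= m.+1%:R ->
  n%:R * (2 / 3) ^+ m <= 1 :> R ->
  \sum_(k < n) alpha k.+1 * beta k.+1 <= 1.
Proof.
move=> C0 muE a0 ha Cmu m0 my ym nm.
have f0 j : j`!%:R != 0 :> R by rewrite pnatr_eq0 -lt0n fact_gt0.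
have q0 : 0 <= 2 / 3 :> R by rewrite divr_ge0.
have Cm0 : 0 <= C / mu by rewrite divr_ge0// ltW.
have eq k : expR (k%:R / 4 : R) <= (4 / 3) ^+ k.
  rewrite expRM_natl; apply: lerXn2r; rewrite ?nnegrE ?expR_ge0 ?divr_ge0//.
  exact: expR_quarter.
(* At this [t] one has [nu * t] = (k + 1) / 4, so the exponential costs (4/3)^(k + 1) while the
   factorial gains 2^-(k + 1): a convergent geometric series. *)
have small k : (k < m)%N -> alpha k.+1 * beta k.+1 <= C / mu * (2 * (2 / 3) ^+ k.+1).
  move=> km; pose t := k.+1%:R / mu.
  have t0 : 0 < t by rewrite divr_gt0.
  have tr : t <= r1 by rewrite ler_pdivrMr// mulrC (le_trans _ my)// ler_nat.
  have tk0 : 0 < t ^+ k by rewrite exprn_gt0.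
  have nt : nu * t = k.+1%:R / 4 by rewrite /t (_ : nu = mu / 4); [field; rewrite gt_eqF|rewrite muE; field].
  have h1 : alpha k.+1 <= C * k`!%:R * (4 / 3) ^+ k.+1 / t ^+ k.
    rewrite ler_pdivlMr//; apply: le_trans (ha k t t0 tr) _.
    by rewrite nt ler_wpM2l ?eq// mulr_ge0// ltW.
  apply: le_trans (ler_pM (a0 _) (beta_ge0 _) h1 (beta_le_mu _)) _.
  have k10 : k.+1%:R != 0 :> R by [].
  have -> : C * k`!%:R * (4 / 3) ^+ k.+1 / t ^+ k * mu^-1 ^+ k.+1 =
      C / mu * (4 / 3) ^+ k.+1 * (k.+1`!%:R / k.+1%:R ^+ k.+1).
    rewrite /t factS natrM (expr_div_n k.+1%:R) exprVn [k.+1%:R ^+ k.+1]exprS (exprS mu).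
    by field; rewrite !gt_eqF ?exprn_gt0//= ?ltr0n// addrC.
  rewrite -mulrA ler_wpM2l//.
  have : k.+1`!%:R / k.+1%:R ^+ k.+1 <= 2 * 2^-1 ^+ k.+1 :> R.
    rewrite ler_pdivrMr ?exprn_gt0// -mulrA -exprMn.
    by have := @fact_le_half k.+1 isT; rewrite (mulrC 2^-1).
  have k43 : 0 <= (4 / 3) ^+ k.+1 :> R by rewrite exprn_ge0// divr_ge0.
  move=> /(ler_wpM2l k43) /le_trans; apply.
  by rewrite mulrCA -exprMn (_ : 4 / 3 * 2^-1 = 2 / 3 :> R)//; field.
(* These terms need not decay in [k]; there are at most [n] of them, and [nm] is made for their
   common bound. *)
have large k : (m <= k)%N -> alpha k.+1 * beta k.+1 <= C / mu * (8 / 3 * (2 / 3) ^+ m).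
  move=> mk.
  have rk0 : 0 < r1 ^+ k by rewrite exprn_gt0.
  have nr : nu * r1 = mu * r1 / 4 by rewrite muE; field.
  have h1 : alpha k.+1 <= C * k`!%:R * (4 / 3) ^+ m.+1 / r1 ^+ k.
    rewrite ler_pdivlMr//; apply: le_trans (ha k r1 r10 (lexx _)) _.
    rewrite nr ler_wpM2l ?mulr_ge0 ?(ltW C0)//; apply: le_trans (eq m.+1).
    by rewrite ler_expR ler_wpM2r.
  have h2 := beta_le_fact m (k.+1 - m); rewrite subnKC in h2; last exact: leqW.
  apply: le_trans (ler_pM (a0 _) (beta_ge0 _) h1 h2) _.
  have -> : C * k`!%:R * (4 / 3) ^+ m.+1 / r1 ^+ k * (mu^-1 ^+ m * (r1 ^+ (k.+1 - m) * m`!%:R / k.+1`!%:R)) =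
      C * (4 / 3) ^+ m.+1 * (r1 / k.+1%:R) * (m`!%:R / (mu * r1) ^+ m).
    have -> : r1 ^+ (k.+1 - m) = r1 ^+ k.+1 / r1 ^+ m.
      by apply: (canRL (mulfK _)); [rewrite gt_eqF// exprn_gt0|rewrite -exprD subnK// ltnW].
    rewrite factS natrM [(mu * r1) ^+ m]exprMn [r1 ^+ k.+1]exprS exprVn.
    by field; rewrite f0 !gt_eqF ?exprn_gt0//= addrC.
  have h3 : r1 / k.+1%:R <= mu^-1.
    rewrite ler_pdivrMr// ler_pdivlMl//; apply: le_trans ym _.
    by rewrite ler_nat.
  have y0 : 0 < mu * r1 by rewrite mulr_gt0.
  have h4 : m`!%:R / (mu * r1) ^+ m <= 2 * 2^-1 ^+ m.
    rewrite ler_pdivrMr ?exprn_gt0//; apply: le_trans (fact_le_half m0) _.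
    rewrite -mulrA -exprMn ler_wpM2l//; apply: lerXn2r; rewrite ?nnegrE ?divr_ge0//.
      by rewrite mulr_ge0 ?invr_ge0// ltW.
    by rewrite mulrC ler_wpM2l ?invr_ge0.
  have k43 : 0 <= C * (4 / 3) ^+ m.+1 by rewrite mulr_ge0 ?exprn_ge0 ?divr_ge0 ?ltW.
  have h5 : C * (4 / 3) ^+ m.+1 * (r1 / k.+1%:R) <= C * (4 / 3) ^+ m.+1 / mu by rewrite ler_wpM2l.
  apply: le_trans (ler_pM _ _ h5 h4) _; rewrite ?divr_ge0 ?exprn_ge0 ?mulr_ge0 ?divr_ge0 ?(ltW y0) ?(ltW r10) ?(ltW C0) ?(ltW mu0)//.
  have -> : (2 / 3 : R) ^+ m = (4 / 3) ^+ m * 2^-1 ^+ m by rewrite -exprMn; congr (_ ^+ _); field.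
  rewrite le_eqVlt; apply/orP; left; apply/eqP; rewrite exprS; field.
  by rewrite !gt_eqF ?exprn_gt0.
apply: (@le_trans _ _ (\sum_(k < n) (C / mu * (2 * (2 / 3) ^+ k.+1) + C / mu * (8 / 3 * (2 / 3) ^+ m)))).
  apply: ler_sum => k _; have [km|mk] := ltnP k m.
    by apply: le_trans (small _ km) _; rewrite lerDl mulr_ge0// mulr_ge0 ?exprn_ge0// divr_ge0.
  by apply: le_trans (large _ mk) _; rewrite lerDr mulr_ge0// mulr_ge0 ?exprn_ge0.
rewrite big_split /= sumr_const card_ord -!mulr_sumr -[_ *+ n]mulr_natl.
have geo : \sum_(k < n) (2 / 3 : R) ^+ k.+1 <= 2.
  suff -> : \sum_(k < n) (2 / 3 : R) ^+ k.+1 = 2 * (1 - (2 / 3) ^+ n).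
    by have := exprn_ge0 n q0; lra.
  elim: n {nm} => [|j IH]; first by rewrite big_ord0 expr0 subrr mulr0.
  by rewrite big_ord_recr /= IH exprS; field.
(* The total is at most (4 + 8/3) / 8 < 1. *)
have Cmu' : C / mu <= 1 / 8 by rewrite ler_pdivrMr//; lra.
have : n%:R * (C / mu * (8 / 3 * (2 / 3) ^+ m)) <= C / mu * (8 / 3).
  have -> : n%:R * (C / mu * (8 / 3 * (2 / 3) ^+ m)) = C / mu * (8 / 3) * (n%:R * (2 / 3) ^+ m) by ring.
  by rewrite ler_piMr// mulr_ge0// divr_ge0.
have : C / mu * (2 * \sum_(k < n) (2 / 3) ^+ k.+1) <= C / mu * (2 * 2).
  by rewrite ler_wpM2l// ler_wpM2l.
lra.
Qed.

End inverse_series.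

(** * Formal inversion and the truncation error *)

Section inverse_coef.
Variables (A : comNzRingType) (f : nat -> A).

(** All earlier coefficients are kept, the latest in front, so that the recurrence pairs [f] with
    the list read forwards. *)
Fixpoint inverse_seq n := if n is n'.+1 then
  (- \sum_(k < n) f k.+1 * (inverse_seq n')`_k) :: inverse_seq n' else [:: 1].

Definition inverse_coef n := (inverse_seq n)`_0.

Lemma nth_inverse_seq n k : (k <= n)%N -> (inverse_seq n)`_k = inverse_coef (n - k).
Proof. by elim: n k => [|n IH] [|k]// kn; rewrite subSS -IH. Qed.

Lemma inverse_coefS i :
  inverse_coef i.+1 = - \sum_(k < i.+1) f k.+1 * inverse_coef (i - k).
Proof.
by congr (- _); apply: eq_bigr => k _; rewrite nth_inverse_seq// -ltnS.
Qed.

Lemma inverse_coefP m : f 0 = 1 ->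
  \sum_(i < m.+1) inverse_coef i * f (m - i)%N = (m == 0)%:R.
Proof.
move=> f0; rewrite (reindex_inj rev_ord_inj)/= big_ord_recl/= subSS subn0 subnn f0 mulr1.
case: m => [|m]; first by rewrite big_ord0 addr0.
rewrite inverse_coefS addrC; apply/eqP; rewrite subr_eq0; apply/eqP.
apply: eq_bigr => i _; rewrite /bump/= add1n !subSS mulrC subSn ?leq_subr// subKn//.
by rewrite -ltnS.
Qed.

End inverse_coef.

Lemma iter_Jcoef (R : realType) (c : nat -> R[i]) i m : iter i (@Jcoef R) c m =
  if (i <= m)%N then c (m - i)%N * ((m - i)`!%:R / m`!%:R) else 0.
Proof.
elim: i m => [|i IH] [|m]//=.
- by rewrite fact0 divr1 mulr1.
- by rewrite subn0 divff ?mulr1// pnatr_eq0 -lt0n fact_gt0.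
rewrite IH ltnS subSS; case: ifP => _; last by rewrite mul0r.
rewrite factS natrM invfM -!mulrA; congr (_ * (_ * _)); rewrite mulrC//.
Qed.

Lemma fact_quot_le (R : realType) (m i : nat) : (i <= m)%N ->
  (m - i)`!%:R / m`!%:R <= i`!%:R^-1 :> R.
Proof.
move=> im; have f0 j : 0 < j`!%:R :> R by rewrite ltr0n fact_gt0.
rewrite ler_pdivrMr// ler_pdivlMl// -natrM ler_nat -(bin_fact im).
by rewrite leq_pmull// bin_gt0.
Qed.

Lemma sum_shift_le (R : realType) (x : nat -> R) i N F :
  (forall N, \sum_(j < N) x j <= F) ->
  \sum_(m < N) (if (i <= m)%N then x (m - i)%N else 0) <= F.
Proof.
move=> h; suff -> : \sum_(m < N) (if (i <= m)%N then x (m - i)%N else 0) = \sum_(j < N - i) x j by [].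
elim: N => [|N IH]; first by rewrite big_ord0 sub0n big_ord0.
rewrite big_ord_recr/= IH; case: leqP => iN; first by rewrite subSn// big_ord_recr.
by rewrite addr0 (eqP (ltnW iN : (N - i)%N == 0%N)) (eqP (iN : (N.+1 - i)%N == 0%N)).
Qed.

Section truncated_inverse.
Variables (R : realType) (c : nat -> R[i]) (K n : nat).
Hypotheses (c0 : forall k, (k < K)%N -> c k = 0) (cK : K`!%:R * c K = 1).

Definition lead_coefs k : R[i] := (K + k)`!%:R * c (K + k)%N.

Local Notation h := (inverse_coef lead_coefs).

(** The Taylor coefficient of order [m] of the sum of the h_i J^i f, for i <= n, minus z^K / K!. *)
Definition trunc_error m : R[i] :=
  \sum_(i < n.+1) h i * iter i (@Jcoef R) c m - (m == K)%:R / K`!%:R.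

Local Notation w := trunc_error.

Lemma trunc_error0 m : (m <= K + n)%N -> w m = 0.
Proof.
move=> mKn; apply/eqP; rewrite subr_eq0; apply/eqP; have [mK|Km] := ltnP m K.
  rewrite ltn_eqF// mul0r big1// => i _; rewrite iter_Jcoef.
  by rewrite c0 ?mul0r ?if_same ?mulr0// (leq_ltn_trans (leq_subr _ _)).
pose d := (m - K)%N; have dn : (d <= n)%N by rewrite leq_subLR.
have mE : m = (K + d)%N by rewrite subnKC.
have -> : (m == K) = (d == 0) by rewrite mE -{2}(addn0 K) eqn_add2l.
have f0 : lead_coefs 0 = 1 by rewrite /lead_coefs addn0.
have -> : \sum_(i < n.+1) h i * iter i (@Jcoef R) c m =
    (\sum_(i < d.+1) h i * lead_coefs (d - i)) / m`!%:R.
  rewrite mulr_suml (big_ord_widen_cond n.+1 xpredT (fun i => h i * lead_coefs (d - i) / m`!%:R))//.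
  rewrite [RHS]big_mkcond/=; apply: eq_bigr => i _; rewrite iter_Jcoef ltnS.
  case: (leqP i d) => [id|di].
    rewrite mE -addnBA// (leq_trans id) ?leq_addl// /lead_coefs; ring.
  case: ifP => im; rewrite ?mulr0// c0 ?mul0r ?mulr0//.
  by rewrite mE ltn_subLR -?mE// mE addnC ltn_add2r.
rewrite inverse_coefP//; case: eqP => [d0|_]; last by rewrite !mul0r.
by rewrite mE d0 addn0.
Qed.

(** Below order K + n the error vanishes and above it the monomial is absent, so only the J^i f
    contribute; the quotient (m - i)! / m! that they carry is at most 1 / i!. *)
Lemma trunc_error_le m (r : R) : 0 <= r -> cabs (w m) * r ^+ m <=
  \sum_(i < n.+1) cabs (h i) * r ^+ i / i`!%:R *
    (if (i <= m)%N then cabs (c (m - i)%N) * r ^+ (m - i) else 0).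
Proof.
move=> r0; have [mn|nm] := leqP m (K + n).
  rewrite trunc_error0// cabs0 mul0r; apply: sumr_ge0 => i _.
  by rewrite mulr_ge0 ?mulr_ge0 ?cabs_ge0 ?exprn_ge0 ?invr_ge0//; case: ifP => // _; rewrite mulr_ge0 ?cabs_ge0 ?exprn_ge0.
have mK : (m == K) = false by rewrite gtn_eqF// (leq_ltn_trans _ nm)// leq_addr.
rewrite /trunc_error mK mul0r subr0; apply: le_trans (ler_wpM2r (exprn_ge0 _ r0) (@cabs_sum R _ _ _ _)) _.
rewrite mulr_suml; apply: ler_sum => i _.
have im : (i <= m)%N by rewrite (leq_trans _ (ltnW nm))// (leq_trans (_ : _ <= n)%N) ?leq_addl// -ltnS.
have -> : r ^+ m = r ^+ i * r ^+ (m - i) by rewrite -exprD subnKC.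
rewrite iter_Jcoef im !cabsM cabsV !cabs_nat.
have H0 : 0 <= cabs (h i) * r ^+ i * (cabs (c (m - i)%N) * r ^+ (m - i)).
  by rewrite !mulr_ge0 ?cabs_ge0 ?exprn_ge0.
have H := ler_wpM2l H0 (fact_quot_le R im).
by apply: le_trans (le_trans H _); rewrite le_eqVlt; apply/orP; left; apply/eqP; ring.
Qed.

Lemma trunc_error_sum N (r G F : R) : 0 <= r ->
  (forall i, (i <= n)%N -> cabs (h i) * r ^+ i / i`!%:R <= G) ->
  (forall N, \sum_(j < N) cabs (c j) * r ^+ j <= F) ->
  \sum_(m < N) cabs (w m) * r ^+ m <= n.+1%:R * (G * F).
Proof.
move=> r0 hG hF; apply: le_trans (ler_sum _ (fun m _ => trunc_error_le (nat_of_ord m) r0)) _.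
rewrite exchange_big /= -[n.+1 in leRHS]card_ord mulr_natl -sumr_const; apply: ler_sum => i _.
rewrite -mulr_sumr.
have x0 j : 0 <= cabs (c j) * r ^+ j by rewrite mulr_ge0 ?cabs_ge0 ?exprn_ge0.
apply: ler_pM; first by rewrite !mulr_ge0 ?cabs_ge0 ?exprn_ge0 ?invr_ge0.
- by apply: sumr_ge0 => m _; case: ifP.
- by apply: hG; rewrite -ltnS.
exact: (@sum_shift_le _ (fun j => cabs (c j) * r ^+ j)).
Qed.

End truncated_inverse.

(** * The main estimate *)

Section constants.
Variable R : realType.
Implicit Types (s D q x eps C : R).

Lemma slope_le D q r1 : 1 <= D -> 1 <= q -> r1 <= q ->
  (r1 + 1) * (D * (q + 1) + 1) <= 6 * D * q ^+ 2.
Proof.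
move=> D1 q1 rq; have q0 : 0 <= q by apply: le_trans q1.
have Dq : D * 1 <= D * q by rewrite ler_wpM2l// (le_trans _ D1).
have D3 : D * (q + 1) + 1 <= 3 * (D * q) by lra.
have x0 : 0 <= D * (q + 1) + 1 by lra.
have r2 : r1 + 1 <= 2 * q by lra.
have -> : 6 * D * q ^+ 2 = 2 * q * (3 * (D * q)) by ring.
by apply: le_trans (ler_wpM2r x0 r2) _; rewrite ler_wpM2l// mulr_ge0.
Qed.

(** The cubic term (6 s q)^3 / 3! = 36 s^3 q^3 of the exponential has one power of [q] more than the
    bound on [x]. *)
Lemma poly_expR_small s D q x eps C : 0 < s -> 0 < eps -> 0 <= C -> 1 <= q ->
  x <= 16 * s * (6 * D * q ^+ 2) ->
  (16 * s * (6 * D) + 1) * C <= 36 * s ^+ 3 * eps * q ->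
  (x + 1) * C * expR (- (6 * s * q)) <= eps.
Proof.
move=> s0 e0 C0 q1 hx hC; have q0 : 0 < q by apply: lt_le_trans q1.
rewrite expRN ler_pdivrMr ?expR_gt0//.
have h1 : 36 * s ^+ 3 * q ^+ 3 <= expR (6 * s * q).
  have y0 : 0 <= 6 * s * q by rewrite !mulr_ge0 ?ltW.
  have := @expR_ge1Dxn R (6 * s * q) 2 y0; apply: le_trans.
  have -> : 36 * s ^+ 3 * q ^+ 3 = (6 * s * q) ^+ 3 / 3`!%:R by rewrite (_ : 3`!%:R = 6 :> R)//; field.
  by rewrite lerDr.
apply: le_trans (ler_wpM2l (ltW e0) h1).
have q20 : 0 <= q ^+ 2 by rewrite exprn_ge0 ?ltW.
have -> : eps * (36 * s ^+ 3 * q ^+ 3) = q ^+ 2 * (36 * s ^+ 3 * eps * q) by ring.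
apply: le_trans (ler_wpM2l q20 hC).
have -> : q ^+ 2 * ((16 * s * (6 * D) + 1) * C) = (16 * s * (6 * D * q ^+ 2) + q ^+ 2) * C by ring.
by rewrite ler_wpM2r// lerD// exprn_ege1.
Qed.

Lemma geometric_le (r : R) N : 0 <= r -> \sum_(j < N) (r / (r + 1)) ^+ j <= r + 1.
Proof.
move=> r0; have r1 : 0 < r + 1 by rewrite ltr_wpDl.
set q := r / (r + 1); have q0 : 0 <= q by rewrite divr_ge0// ltW.
suff -> : \sum_(j < N) q ^+ j = (r + 1) * (1 - q ^+ N).
  by rewrite ler_piMr ?gerBl ?exprn_ge0// ltW.
have qr : (r + 1) * q = r by rewrite /q mulrC divfK// gt_eqF.
elim: N => [|N IH]; first by rewrite big_ord0 expr0 subrr mulr0.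
by rewrite big_ord_recr/= IH exprS !mulrBr (mulrA (r + 1)) qr; ring.
Qed.

End constants.

Section main_estimate.
Variable R : realType.
Variables (P : R -> R) (D : R).
Hypothesis P_ge0 : forall r : R, 0 <= r -> 0 <= P r.
Hypothesis D_ge1 : 1 <= D.
Hypothesis P_shift : forall r : R, 0 <= r -> P (r + 1) <= D * (P r + 1).
Hypothesis P_super : forall k : R, exists c : R, forall r : R, 0 <= r -> k * r - c <= P r.

Local Notation Q := (log_minorant P).

Variables (c : nat -> R[i]) (K : nat) (C a : R).
Hypotheses (C0 : 0 < C) (a0 : 0 < a).
Hypotheses (c0 : forall k, (k < K)%N -> c k = 0) (cK : K`!%:R * c K = 1).
Hypothesis c_le : forall k (r : R), 0 < r -> cabs (c k) * r ^+ k <= C * expR (a * P r).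

Local Notation ft := (lead_coefs c K).
Local Notation h := (inverse_coef ft).

Let D0 : 0 < D. Proof. exact: lt_le_trans D_ge1. Qed.
Let aD0 : 0 < a * D. Proof. exact: mulr_gt0. Qed.

Lemma coef_le k r : 0 < r -> cabs (c k) * r ^+ k <= C * expR (a * Q r).
Proof. by apply: coef_log_minorant => //; [exact: cabs_ge0|exact: c_le]. Qed.

(** Using the coefficient bound at radius r + 1 leaves a geometric series of ratio r / (r + 1),
    whose sum is at most r + 1. *)
Lemma sum_coef_le r N : 0 < r ->
  \sum_(j < N) cabs (c j) * r ^+ j <= C * expR (a * Q (r + 1)) * (r + 1).
Proof.
move=> r0; have r1 : 0 < r + 1 by rewrite addr_gt0.
pose q := r / (r + 1).
have q0 : 0 <= q by rewrite divr_ge0// ltW.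
have B0 : 0 <= C * expR (a * Q (r + 1)) by rewrite mulr_ge0 ?expR_ge0 ?ltW.
apply: (@le_trans _ _ (\sum_(j < N) C * expR (a * Q (r + 1)) * q ^+ j)).
  apply: ler_sum => j _; rewrite expr_div_n mulrA ler_pdivlMr ?exprn_gt0//.
  by rewrite mulrAC ler_wpM2r ?coef_le// exprn_ge0// ltW.
by rewrite -mulr_sumr ler_wpM2l// geometric_le ?ltW.
Qed.

Section scale.
Variables (r1 C2 : R).
Hypotheses (r11 : 1 <= r1) (C2E : C2 = K.+1`!%:R * C * expR (a * (D * (Q 1 + 1)))).
Hypothesis rec : forall t : R, 0 < t -> t <= r1 -> Q t <= Q 1 + 2 * (Q r1 / r1) * t.

(** The factorial (K + k + 1)! equals 'C(K + k + 1, k) k! (K + 1)!, and the binomial coefficient is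
    absorbed by evaluating the coefficient bound at t + 1: 'C(j, k) t^k <= (t + 1)^j. The shift
    inequality and [rec] then make the exponent affine in t. *)
Lemma lead_coefs_le k (t : R) : 0 < t -> t <= r1 ->
  cabs (ft k.+1) * t ^+ k <= C2 * k`!%:R * expR (2 * (a * D) * (Q r1 / r1) * t).
Proof.
move=> t0 tr; have t1 : 0 < t + 1 by rewrite addr_gt0.
pose j := (K + k.+1)%N.
have jE : j = (k + K.+1)%N by rewrite /j addnS addnC addnS.
have H := coef_le j t1.
have B : 'C(j, k)%:R * t ^+ k <= (t + 1) ^+ j.
  have kj : (k <= j)%N by rewrite jE leq_addr.
  have jkj : (j - k < j.+1)%N by rewrite ltnS leq_subr.
  rewrite (exprDn_comm _ (commr1 t)) (bigD1 (Ordinal jkj))//= expr1n mulr1 subKn// bin_sub// mulr_natl lerDl.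
  by apply: sumr_ge0 => i _; rewrite expr1n mulr1 mulrn_wge0// exprn_ge0// ltW.
have F : j`!%:R = 'C(j, k)%:R * (k`!%:R * K.+1`!%:R) :> R.
  by rewrite -!natrM -(@bin_fact j k) jE ?leq_addr// addKn.
have -> : cabs (ft k.+1) = j`!%:R * cabs (c j) by rewrite -[ft _]/(j`!%:R * c j) cabsM cabs_nat.
rewrite F.
have x0 : 0 <= cabs (c j) * (k`!%:R * K.+1`!%:R) by rewrite !mulr_ge0 ?cabs_ge0.
have := ler_wpM2l x0 B.
have -> : cabs (c j) * (k`!%:R * K.+1`!%:R) * ('C(j, k)%:R * t ^+ k) =
   'C(j, k)%:R * (k`!%:R * K.+1`!%:R) * cabs (c j) * t ^+ k by ring.
move=> /le_trans; apply.
have -> : cabs (c j) * (k`!%:R * K.+1`!%:R) * (t + 1) ^+ j =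
   k`!%:R * K.+1`!%:R * (cabs (c j) * (t + 1) ^+ j) by ring.
have y0 : 0 <= k`!%:R * K.+1`!%:R :> R by rewrite mulr_ge0.
apply: le_trans (ler_wpM2l y0 H) _.
have -> : C2 * k`!%:R * expR (2 * (a * D) * (Q r1 / r1) * t) = k`!%:R * K.+1`!%:R *
   (C * expR (a * (D * (Q 1 + 2 * (Q r1 / r1) * t + 1)))).
  have -> : a * (D * (Q 1 + 2 * (Q r1 / r1) * t + 1)) = a * (D * (Q 1 + 1)) + 2 * (a * D) * (Q r1 / r1) * t by ring.
  by rewrite expRD C2E; ring.
rewrite ler_wpM2l// ler_wpM2l ?(ltW C0)// ler_expR ler_wpM2l ?(ltW a0)//.
apply: le_trans (log_minorant_shift P_ge0 D_ge1 P_shift t0) _.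
by rewrite ler_wpM2l ?(ltW D0)// lerD2r rec.
Qed.

Let q := Q r1.

(* [q >= r1] makes the slope [N] of a line through the graph of [Q] at [r1]
   quadratic in [q], negligible against [exp (a D q)]. *)
Lemma inverse_lead_coefs_le n i :
  r1 <= q -> 1 <= 8 * (a * D) * q -> C2 <= a * D * (q / r1) ->
  n%:R <= 16 * (a * D) * (6 * D * q ^+ 2) -> 108 * D <= (a * D) ^+ 2 * q ->
  (i <= n)%N -> cabs (h i) * r1 ^+ i / i`!%:R <= expR (8 * (a * D) * q).
Proof.
move=> rq q8 qC nq qb iltn.
have r10 : 0 < r1 by apply: lt_le_trans r11.
have q0 : 0 < q by apply: lt_le_trans rq.
(* Four times the rate in [lead_coefs_le], as [sum_alpha_beta] requires. *)
pose mu := 8 * (a * D) * (q / r1).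
have mu0 : 0 < mu by rewrite !mulr_gt0 ?invr_gt0.
have muE : mu * r1 = 8 * (a * D) * q by rewrite /mu; field; rewrite gt_eqF.
have C20 : 0 < C2 by rewrite C2E !mulr_gt0 ?expR_gt0// ltr0n fact_gt0.
have y0 : 0 <= mu * r1 by rewrite mulr_ge0 ?ltW.
have /andP[my ym] := truncn_itv y0.
set m := Num.truncn (mu * r1) in my ym.
(* With x = a D q, (3/2)^(m + 1) >= e^(mu r1 / 3) >= e^(2 x) >= (2 x)^3 / 3!, which is cubic in [q],
   whereas [n] is quadratic. *)
have nm : n%:R * (2 / 3) ^+ m <= 1 :> R.
  have e13 : expR (3^-1 : R) <= 3 / 2.
    have := expR_ge1Dx (- (3^-1) : R); rewrite expRN => hh.
    rewrite -[expR _]invrK -[3 / 2]invrK lef_pV2 ?posrE ?invr_gt0 ?expR_gt0//.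
    by apply: le_trans hh; lra.
  have h1 : expR (mu * r1 / 3) <= (3 / 2) ^+ m.+1.
    apply: (@le_trans _ _ (expR (m.+1%:R * 3^-1))).
      by rewrite ler_expR ler_wpM2r// ltW.
    by rewrite expRM_natl; apply: lerXn2r; rewrite ?nnegrE ?expR_ge0 ?divr_ge0.
  pose x := a * D * q.
  have x0 : 0 < x by rewrite mulr_gt0.
  have h2 : (2 * x) ^+ 3 / 3`!%:R <= expR (mu * r1 / 3).
    have x20 : 0 <= 2 * x by rewrite mulr_ge0// ltW.
    apply: (@le_trans _ _ (expR (2 * x))).
      by have := @expR_ge1Dxn R (2 * x) 2 x20; apply: le_trans; rewrite lerDr.
    have -> : mu * r1 / 3 = 8 / 3 * x by rewrite muE /x; field.
    by rewrite ler_expR ler_wpM2r ?(ltW x0)// ler_pdivlMr// -natrM ler_nat.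
  have h3 : 3 / 2 * n%:R <= (2 * x) ^+ 3 / 3`!%:R.
    have -> : (2 * x) ^+ 3 / 3`!%:R = 4 / 3 * (a * D * q ^+ 2) * ((a * D) ^+ 2 * q).
      by rewrite (_ : 3`!%:R = 6 :> R)// /x; field.
    have s0 : 0 <= 4 / 3 * (a * D * q ^+ 2) by rewrite mulr_ge0 ?divr_ge0// mulr_ge0 ?exprn_ge0 ?ltW.
    apply: le_trans (ler_wpM2l s0 qb).
    have -> : 4 / 3 * (a * D * q ^+ 2) * (108 * D) = 3 / 2 * (16 * (a * D) * (6 * D * q ^+ 2)) by field.
    by rewrite ler_wpM2l// divr_ge0.
  have := le_trans h3 (le_trans h2 h1).
  have -> : (2 / 3 : R) ^+ m = ((3 / 2) ^+ m)^-1 by rewrite -exprVn; congr (_ ^+ _); field.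
  have p0 : 0 < (3 / 2 : R) ^+ m by rewrite exprn_gt0// divr_gt0.
  by rewrite exprS ler_pdivrMr// mul1r ler_pM2l// divr_gt0.
have S : \sum_(k < n) cabs (ft k.+1) * beta mu r1 k.+1 <= 1.
  apply: (@sum_alpha_beta R mu r1 mu0 r10 (fun k => cabs (ft k)) C2 (2 * (a * D) * (q / r1)) n m) => //.
  - by rewrite /mu; ring.
  - by move=> k; exact: cabs_ge0.
  - by move=> k t t0 tr; exact: lead_coefs_le.
  - by rewrite /mu -mulrA ler_wpM2l.
  - by rewrite truncn_gt0 muE.
  - exact: ltW.
have b0 := beta_gt0 mu0 r10 i.
have hb : cabs (h i) * beta mu r1 i <= 1.
  apply: (@inverse_series_le R (fun i => cabs (h i)) (fun k => cabs (ft k)) (beta mu r1) n) => //.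
  - by move=> k; exact: cabs_ge0.
  - by move=> k; exact: beta_ge0.
  - by rewrite /beta big_ord0.
  - by move=> k l; exact: betaM.
  - by move=> k; exact: cabs_ge0.
  - by rewrite cabs1.
  - move=> k; rewrite inverse_coefS cabsN; apply: le_trans (@cabs_sum R _ _ _ _) _.
    by apply: ler_sum => l _; rewrite cabsM.
rewrite -muE -mulrA; apply: le_trans (ler_wpM2l (cabs_ge0 _) (beta_exp mu0 r10 i)) _.
by rewrite mulrCA ler_piMr ?expR_ge0.
Qed.

End scale.
Lemma trunc_error_small (eps : R) : 0 < eps -> exists n, forall (r : R) N, 0 <= r ->
  \sum_(m < N) cabs (trunc_error c K n m) * r ^+ m <= eps * expR (18 * (a * D) * P r).
Proof.
move=> e0; set s := a * D.
have s0 : 0 < s := aD0.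
have s16 : 0 <= 16 * s := mulr_ge0 (ler0n _ _) (ltW s0).
have [c3 hc3] : exists c3, forall r : R, 0 < r -> r + 1 <= expR (s * (Q r + c3)).
  have [c3 h3] := log_minorant_super P_ge0 P_super s^-1; exists c3 => r r0.
  apply: (@le_trans _ _ (expR r)); first by rewrite addrC expR_ge1Dx.
  by rewrite ler_expR -ler_pdivrMl// -lerBlDr h3.
(* The constants of the three exponents below add up to 16 + 1 + c3. *)
pose C' := C * expR (s * (17 + c3)).
pose C2 := K.+1`!%:R * C * expR (a * (D * (Q 1 + 1))).
have C'0 : 0 <= C' by rewrite mulr_ge0 ?expR_ge0 ?ltW.
(* [B] collects the lower bounds on [q] or on [q / r1] needed at the scale [r1]; the record gives B
   <= q / r1 <= q. *)
have [B [b1 b2 b3 b4 b5]] : exists B, [/\ 1 <= B, (8 * s)^-1 <= B, C2 / s <= B,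
    108 * D / s ^+ 2 <= B & (16 * s * (6 * D) + 1) * C' / (36 * s ^+ 3 * eps) <= B].
  exists (Num.max 1 (Num.max (8 * s)^-1 (Num.max (C2 / s) (Num.max (108 * D / s ^+ 2)
    ((16 * s * (6 * D) + 1) * C' / (36 * s ^+ 3 * eps)))))).
  by split; rewrite !le_max lexx ?orbT.
have [r1 [r11 Br rec]] := log_minorant_record P_ge0 P_super B.
have r10 : 0 < r1 by apply: lt_le_trans r11.
have B0 : 0 <= B by apply: le_trans b1.
set q := Q r1 in Br rec.
have rq : r1 <= q by apply: le_trans Br; rewrite ler_peMl// ltW.
have Bq : B <= q by apply: le_trans Br; rewrite ler_peMr.
have q1 : 1 <= q by apply: le_trans Bq.
have q0 : 0 < q by apply: lt_le_trans q1.
have [L [cL [l hl]]] := log_minorant_approx P_ge0 r10.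
have bL0 : 0 <= 16 * s * L := mulr_ge0 s16 l.1.
have /andP[nL Ln] := truncn_itv bL0.
(* Both sides of the truncation serve: n <= 16 s L bounds (r / r1)^n for r >= r1, and 16 s L < n + 1
   bounds (r / r1)^(n + 1) for r < r1, where the logarithm is negative. *)
set n := Num.truncn (16 * s * L) in nL Ln.
have nq : n%:R <= 16 * s * (6 * D * q ^+ 2).
  apply: le_trans nL _; rewrite ler_wpM2l//.
  apply: le_trans (log_line_slope P_ge0 D_ge1 P_shift r10 l hl) _.
  exact: slope_le.
have hi i : (i <= n)%N -> cabs (h i) * r1 ^+ i / i`!%:R <= expR (8 * s * q).
  apply: (@inverse_lead_coefs_le r1 C2) => //.
  - by rewrite -/s -ler_pdivrMl ?mulr1 ?mulr_gt0// (le_trans b2).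
  - rewrite -ler_pdivrMl// mulrC (le_trans b3)// ler_pdivlMr//.
  - by rewrite -ler_pdivrMl ?exprn_gt0// mulrC (le_trans b4).
have hsmall : n.+1%:R * C' * expR (- (6 * s * q)) <= eps.
  rewrite -natr1; apply: (@poly_expR_small _ s D) => //.
  by rewrite -ler_pdivrMl ?mulr_gt0 ?exprn_gt0// mulrC (le_trans b5).
exists n => r N; rewrite le_eqVlt => /predU1P[<-|r0].
  rewrite big1 ?mulr_ge0 ?expR_ge0 ?(ltW e0)// => -[[|m] /= _] _.
    by rewrite trunc_error0// cabs0 mul0r.
  by rewrite expr0n mulr0.
have ratio (k : nat) : (r / r1) ^+ k = expR (k%:R * (ln r - ln r1)).
  by rewrite expRM_natl expRB !lnK ?posrE.
have hF (r' : R) M : 0 < r' -> \sum_(j < M) cabs (c j) * r' ^+ j <=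
    C * expR (s * (Q r' + 1)) * expR (s * (Q r' + c3)).
  move=> r'0; apply: le_trans (sum_coef_le M r'0) _.
  have r'1 : 0 < r' + 1 by rewrite addr_gt0.
  apply: ler_pM; rewrite ?mulr_ge0 ?expR_ge0 ?(ltW C0) ?(ltW r'1) ?hc3//.
  rewrite ler_wpM2l ?(ltW C0)// ler_expR /s -mulrA ler_wpM2l ?(ltW a0)//.
  exact: log_minorant_shift.
have hline : L * (ln r - ln r1) <= Q r - q + 1.
  have -> : L * (ln r - ln r1) = (L * ln r - cL) - (L * ln r1 - cL) by ring.
  have -> : Q r - q + 1 = Q r - (q - 1) by ring.
  exact: lerB (log_minorant_line P_ge0 r0 l) hl.
have QP : Q r <= P r by exact: log_minorant_le.
have sQ : expR (18 * s * Q r) <= expR (18 * s * P r).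
  by rewrite ler_expR ler_wpM2l// mulr_ge0// ltW.
pose E := expR (16 * s * (Q r - q + 1)).
have E0 : 0 <= E := expR_ge0 _.
apply: (@le_trans _ _ (n.+1%:R * C' * expR (- (6 * s * q)) * expR (18 * s * P r))); last first.
  by rewrite ler_wpM2r ?expR_ge0.
apply: (@le_trans _ _ (n.+1%:R * C' * expR (- (6 * s * q)) * expR (18 * s * Q r))); last first.
  by rewrite ler_wpM2l// mulr_ge0 ?expR_ge0// mulr_ge0.
have Qr0 : 0 <= Q r by exact: log_minorant_ge0.
have nC0 : 0 <= n.+1%:R * C' by rewrite mulr_ge0.
(* For r >= r1, passing from r1^i to r^i costs at most [E], and the exponents add up to 18 s Q r - 8
   s q. *)
have [rr|rr] := leP r1 r.
  have ln0 : 0 <= ln r - ln r1 by rewrite subr_ge0 ler_ln.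
  have rE : (r / r1) ^+ n <= E.
    rewrite ratio ler_expR; apply: le_trans (ler_wpM2r ln0 nL) _.
    by rewrite -(mulrA (16 * s) L) ler_wpM2l.
  have hG i : (i <= n)%N -> cabs (h i) * r ^+ i / i`!%:R <= E * expR (8 * s * q).
    move=> iltn; have -> : cabs (h i) * r ^+ i / i`!%:R = (r / r1) ^+ i * (cabs (h i) * r1 ^+ i / i`!%:R).
      rewrite expr_div_n; field.
      by rewrite pnatr_eq0 -lt0n fact_gt0 gt_eqF ?exprn_gt0.
    apply: ler_pM; rewrite ?exprn_ge0 ?divr_ge0 ?mulr_ge0 ?cabs_ge0 ?exprn_ge0 ?(ltW r0) ?(ltW r10) ?hi//.
    apply: le_trans rE; rewrite ler_weXn2l// ler_pdivlMr// mul1r//.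
  apply: le_trans (trunc_error_sum c0 cK N (ltW r0) hG (fun M => hF r M r0)) _.
  have -> : n.+1%:R * (E * expR (8 * s * q) * (C * expR (s * (Q r + 1)) * expR (s * (Q r + c3)))) =
     n.+1%:R * C' * expR (18 * s * Q r - 8 * s * q).
    have -> : 18 * s * Q r - 8 * s * q = 16 * s * (Q r - q + 1) + 8 * s * q + s * (Q r + 1) + s * (Q r + c3) - s * (17 + c3) by ring.
    rewrite !expRD expRN /E /C'; field; by rewrite gt_eqF ?expR_gt0.
  rewrite -(mulrA (n.+1%:R * C')) ler_wpM2l// -expRD ler_expR addrC lerD2r lerN2.
  by rewrite ler_wpM2r ?(ltW q0)// ler_wpM2r ?(ltW s0)// ler_nat.
(* For r < r1 only degrees above n occur, so the whole error at r1 is multiplied by at most [E]: the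
   exponents add up to 16 s Q r - 6 s q. *)
have ln0 : ln r - ln r1 <= 0 by rewrite subr_le0 ler_ln// ltW.
have rE : (r / r1) ^+ n.+1 <= E.
  rewrite ratio ler_expR; apply: le_trans (ler_wnM2r ln0 (ltW Ln)) _.
  by rewrite -(mulrA (16 * s) L) ler_wpM2l.
apply: (@le_trans _ _ (E * \sum_(m < N) cabs (trunc_error c K n m) * r1 ^+ m)).
  rewrite mulr_sumr; apply: ler_sum => -[m /= _] _.
  have [mn|nm] := leqP m n.
    by rewrite trunc_error0 ?cabs0 ?mul0r ?mulr0// (leq_trans mn)// leq_addl.
  have -> : r ^+ m = (r / r1) ^+ m * r1 ^+ m.
    by rewrite expr_div_n divfK// gt_eqF// exprn_gt0.
  rewrite mulrCA ler_wpM2r ?mulr_ge0 ?cabs_ge0 ?exprn_ge0 ?(ltW r10)//.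
  apply: le_trans rE; rewrite ler_wiXn2l ?divr_ge0 ?(ltW r0) ?(ltW r10)//.
  by rewrite ler_pdivrMr// mul1r ltW.
apply: le_trans (ler_wpM2l E0 (trunc_error_sum c0 cK N (ltW r10) hi (fun M => hF r1 M r10))) _.
have -> : E * (n.+1%:R * (expR (8 * s * q) * (C * expR (s * (Q r1 + 1)) * expR (s * (Q r1 + c3))))) =
    n.+1%:R * C' * expR (- (6 * s * q) + 16 * s * Q r).
  have -> : - (6 * s * q) + 16 * s * Q r = 16 * s * (Q r - q + 1) + 8 * s * q + s * (q + 1) + s * (q + c3) - s * (17 + c3) by ring.
  rewrite !expRD expRN /E /C' -/q; field; by rewrite gt_eqF ?expR_gt0.
rewrite -(mulrA (n.+1%:R * C')) ler_wpM2l// -expRD ler_expR lerD2l.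
by rewrite ler_wpM2r// ler_wpM2r ?(ltW s0)// ler_nat.
Qed.

End main_estimate.

(** * Operations on power series *)

Section power_series.
Variable R : realType.
Local Notation C := R[i].

Lemma powX K : pow (fun z : C => z ^+ K) (fun k => (k == K)%:R).
Proof.
move=> r r0; exists (r ^+ K * 2 ^+ K) => [|n z zr]; first by rewrite mulr_ge0 ?exprn_ge0 ?ltW.
have B0 : 0 <= r ^+ K * 2 ^+ K / 2 ^+ n by rewrite divr_ge0 ?mulr_ge0 ?exprn_ge0 ?(ltW r0).
have [Kn|nK] := ltnP K n.
  rewrite (bigD1 (Ordinal Kn))//= eqxx mul1r big1 ?addr0 ?subrr ?cabs0// => i iK.
  by rewrite (_ : (i == K :> nat) = false) ?mul0r//; apply: contraNF iK => /eqP iK; apply/eqP/val_inj.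
rewrite big1 ?subr0 => [|i _]; last by rewrite ltn_eqF ?mul0r// (leq_trans (ltn_ord i)).
rewrite cabsX ler_pdivlMr ?exprn_gt0// ler_pM ?exprn_ge0 ?cabs_ge0 ?ler_weXn2l ?ler1n//.
by apply: lerXn2r; rewrite ?nnegrE ?cabs_ge0 ?(ltW r0).
Qed.

Lemma pow_sum n (F : nat -> C -> C) (d : nat -> nat -> C) :
  (forall i, pow (F i) (d i)) ->
  pow (fun z => \sum_(i < n) F i z) (fun k => \sum_(i < n) d i k).
Proof.
move=> h; elim: n => [|n IH].
  have -> : (fun z => \sum_(i < 0) F i z) = (fun=> 0) by apply/funext => z; rewrite big_ord0.
  by apply: pow_eq (@pow0 R) _ => k; rewrite big_ord0.
have -> : (fun z => \sum_(i < n.+1) F i z) = (fun z => \sum_(i < n) F i z) \+ F n.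
  by apply/funext => z; rewrite big_ord_recr.
by apply: pow_eq (powD IH (h n)) _ => k; rewrite big_ord_recr.
Qed.

Lemma powB (f g : C -> C) c d : pow f c -> pow g d -> pow (fun z : C => f z - g z) (fun k => c k - d k).
Proof.
move=> pf pg; have -> : (fun z => f z - g z) = f \+ (fun z => -1 * g z).
  by apply/funext => z; rewrite /= mulN1r.
by apply: pow_eq (powD pf (powZ (-1) pg)) _ => k; rewrite mulN1r.
Qed.

Lemma pow_inj (f g : C -> C) c : pow f c -> pow g c -> f = g.
Proof.
move=> pf pg; apply/funext => z; apply/eqP; rewrite -subr_eq0; apply/eqP/cabs0_eq0.
apply/eqP; rewrite eq_le cabs_ge0 andbT; apply: (pow_bound (powB pf pg)) => n.
by rewrite big1// => k _; rewrite subrr cabs0 mul0r.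
Qed.

End power_series.

(** * Approximation of monomials and by Taylor sums *)

Section density.
Variable R : realType.
Local Notation C := R[i].
Variables (P : R -> R) (D : R).
Hypothesis P_ge0 : forall r : R, 0 <= r -> 0 <= P r.
Hypothesis D_ge1 : 1 <= D.
Hypothesis P_shift : forall r : R, 0 <= r -> P (r + 1) <= D * (P r + 1).
Hypothesis P_super : forall k : R, exists c : R, forall r : R, 0 <= r -> k * r - c <= P r.

Definition dominated (f : C -> C) (B a : R) :=
  forall z, cabs (f z) <= B * expR (a * P (cabs z)).

Lemma dominated_tcoef f B a k (r : R) : (forall z, hol f z) -> dominated f B a -> 0 < r ->
  cabs (tcoef f k) * r ^+ k <= 2 * B * expR (a * P r).
Proof.
move=> hf fB r0; rewrite -mulrA; apply: cauchy_estimate => // z zr.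
by have := fB z; rewrite zr.
Qed.

Lemma dominated_monomial K : forall a, 0 < a -> exists2 B, 0 < B & dominated (fun z => z ^+ K) B a.
Proof.
move=> a a0; have [c hc] := P_super a^-1.
exists (K`!%:R * expR (a * c)); first by rewrite mulr_gt0 ?expR_gt0 ?ltr0n ?fact_gt0.
move=> z; have z0 := cabs_ge0 z; rewrite cabsX -mulrA -expRD -ler_pdivrMl ?ltr0n ?fact_gt0// mulrC.
apply: (@le_trans _ _ (expR (cabs z))).
  case: K => [|K]; first by rewrite expr0 divr1 -expR0 ler_expR.
  by have := expR_ge1Dxn K z0; apply: le_trans; rewrite lerDr.
by rewrite ler_expR -mulrDr -ler_pdivrMl// addrC -lerBlDr hc.
Qed.

Lemma monomial_approx F K (B a eps : R) : 0 < B -> 0 < a -> 0 < eps ->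
  (forall i z, hol (F i) z) -> (forall i, F i.+1 = J (F i)) -> dominated (F 0) B a ->
  (forall k, (k < K)%N -> tcoef (F 0) k = 0) -> K`!%:R * tcoef (F 0) K = 1 ->
  exists n (h : nat -> C),
    dominated (fun z => \sum_(i < n) h i * F i z - K`!%:R^-1 * z ^+ K) eps (18 * (a * D)).
Proof.
move=> B0 a0 e0 hF FJ FB c0 cK.
have B20 : 0 < 2 * B by rewrite mulr_gt0.
have [n hn] := trunc_error_small P_ge0 D_ge1 P_shift P_super B20 a0 c0 cK
  (fun k r => dominated_tcoef k (hF 0) FB) e0.
exists n.+1, (inverse_coef (lead_coefs (tcoef (F 0)) K)) => z.
have pF i : pow (F i) (iter i (@Jcoef R) (tcoef (F 0))).
  elim: i => [|i IH]; first exact: entire_pow.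
  by rewrite FJ iterS; exact: J_pow.
have pV := powB (pow_sum n.+1 (fun i => powZ (inverse_coef (lead_coefs (tcoef (F 0)) K) i) (pF i)))
   (powZ (K`!%:R^-1) (@powX R K)).
apply: (pow_bound pV) => N; apply: le_trans (hn _ N (cabs_ge0 z)).
by apply: ler_sum => m _; rewrite /trunc_error (mulrC (K`!%:R^-1)).
Qed.

(** Coefficient bounds at radius r + 1 give a tail of order q^N (r + 1), with q = r / (r + 1). The
    exponent 3 a D has one share for the shift to r + 1, one for the factor r + 1, and one that
    makes the tail small for large r, where q^N is close to 1. *)
Lemma taylor_dense f (B a eps : R) : 0 < B -> 0 < a -> 0 < eps ->
  (forall z, hol f z) -> dominated f B a -> exists N,
  dominated (fun z => f z - \sum_(k < N) tcoef f k * z ^+ k) eps (3 * (a * D)).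
Proof.
move=> B0 a0 e0 hf fB; set s := a * D.
have s0 : 0 < s by rewrite mulr_gt0// (lt_le_trans _ D_ge1).
have [c hc] := P_super s^-1.
have hc3 (r : R) : 0 <= r -> r + 1 <= expR (s * (P r + c)).
  move=> r0; apply: (@le_trans _ _ (expR r)); first by rewrite addrC expR_ge1Dx.
  by rewrite ler_expR -ler_pdivrMl// -lerBlDr hc.
pose A := 2 * B * expR (s * (1 + c)).
have A0 : 0 < A by rewrite !mulr_gt0 ?expR_gt0.
have [r0 r00 hr0] : exists2 r0 : R, 0 <= r0 & forall r : R, r0 <= r -> A <= eps * expR (s * P r).
  have [c1 h1] := P_super 1; exists (Num.max 0 (c1 + A / eps / s)); first by rewrite le_max lexx.
  move=> r; rewrite ge_max => /andP[r0 rc]; rewrite -ler_pdivrMl//.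
  apply: (@le_trans _ _ (s * P r)).
    rewrite -ler_pdivrMl//; apply: le_trans (h1 r r0).
    by rewrite mul1r lerBrDl (_ : s^-1 * _ = A / eps / s)//; ring.
  by apply: le_trans (expR_ge1Dx _); rewrite lerDr.
have [N hN] : exists N, A * (r0 / (r0 + 1)) ^+ N <= eps.
  pose q := r0 / (r0 + 1); have r1 : 0 < r0 + 1 by rewrite ltr_wpDl.
  have q0 : 0 <= q by rewrite divr_ge0// ltW.
  have q1 : q <= 1 by rewrite ler_pdivrMr// mul1r lerDl.
  have x0 : 0 <= A * (r0 + 1) / eps := divr_ge0 (mulr_ge0 (ltW A0) (ltW r1)) (ltW e0).
  have /andP[_ xN] := truncn_itv x0; exists (Num.truncn (A * (r0 + 1) / eps)).
  set N := Num.truncn _ in xN *.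
  (* The powers q^j decrease, so N + 1 copies of the last one are bounded by the geometric sum. *)
  have hq : N.+1%:R * q ^+ N <= r0 + 1.
    apply: le_trans (geometric_le N.+1 r00).
    rewrite -[n in n%:R]card_ord mulr_natl -sumr_const; apply: ler_sum => j _.
    by rewrite ler_wiXn2l// -ltnS.
  have := ler_wpM2l (ltW A0) hq; rewrite mulrCA => hA.
  have {}xN : A * (r0 + 1) <= eps * N.+1%:R by rewrite -ler_pdivrMl// mulrC ltW.
  have := le_trans hA xN; rewrite mulrC.
  by rewrite ler_pM2r.
exists N => z; set r := cabs z; have r_ge0 : 0 <= r := cabs_ge0 z.
have r1 : 0 < r + 1 by rewrite ltr_wpDl.
pose q := r / (r + 1); have q0 : 0 <= q by rewrite divr_ge0// ltW.
have pT := pow_sum N (fun i => powZ (tcoef f i) (@powX R i)).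
have AqN : A * q ^+ N <= eps * expR (s * P r).
  have [rr|rr] := leP r0 r.
    apply: le_trans (hr0 r rr); rewrite ler_piMr ?(ltW A0)// exprn_ile1//.
    by rewrite ler_pdivrMr// mul1r lerDl.
  apply: (@le_trans _ _ eps); last first.
    by rewrite ler_peMr ?(ltW e0)// -expR0 ler_expR mulr_ge0 ?P_ge0// ltW.
  apply: le_trans hN; rewrite ler_wpM2l ?(ltW A0)//; apply: lerXn2r; rewrite ?nnegrE//.
    by rewrite divr_ge0// addr_ge0.
  by rewrite ler_pdivrMr// mulrAC ler_pdivlMr ?ltr_wpDl// !mulrDr !mulr1 mulrC lerD2l ltW.
apply: (pow_bound (powB (entire_pow hf) pT)) => M; rewrite -/r.
pose B1 := 2 * B * expR (a * P (r + 1)).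
have B10 : 0 <= B1 by rewrite mulr_ge0 ?expR_ge0// mulr_ge0 ?ltW.
apply: (@le_trans _ _ (\sum_(k < M) (if (N <= k)%N then B1 * q ^+ N * q ^+ (k - N) else 0))).
  apply: ler_sum => k _; have [Nk|kN] := leqP N k.
    rewrite big1 ?subr0 => [|i _]; last first.
      by rewrite gtn_eqF ?mulr0// (leq_trans (ltn_ord i)).
    rewrite -mulrA -exprD subnKC// expr_div_n mulrA ler_pdivlMr ?exprn_gt0//.
    rewrite mulrAC ler_wpM2r ?exprn_ge0//; exact: dominated_tcoef.
  rewrite (bigD1 (Ordinal kN))//= eqxx mulr1 big1 ?addr0 ?subrr ?cabs0 ?mul0r// => i ik.
  by rewrite (_ : (k == i :> nat) = false) ?mulr0//; apply: contraNF ik => /eqP ik; apply/eqP/val_inj.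
apply: (@le_trans _ _ (B1 * q ^+ N * (r + 1))).
  apply: (@sum_shift_le R (fun j => B1 * q ^+ N * q ^+ j)) => M'.
  by rewrite -mulr_sumr ler_wpM2l ?geometric_le// mulr_ge0// exprn_ge0.
have B1A : B1 * (r + 1) <= A * expR (2 * s * P r).
  have -> : A * expR (2 * s * P r) = 2 * B * expR (s * (P r + 1)) * expR (s * (P r + c)).
    rewrite /A -!mulrA -!expRD; congr (_ * (_ * expR _)); ring.
  apply: ler_pM => //; [exact: ltW| |exact: hc3].
  rewrite ler_wpM2l ?mulr_ge0 ?(ltW B0)// ler_expR /s -mulrA ler_wpM2l ?(ltW a0)//.
  exact: P_shift.
rewrite mulrAC; apply: le_trans (ler_wpM2r (exprn_ge0 _ q0) B1A) _.
rewrite mulrAC; apply: le_trans (ler_wpM2r (expR_ge0 _) AqN) _.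
rewrite -(mulrA eps) -expRD le_eqVlt; apply/orP; left; apply/eqP; congr (_ * expR _); ring.
Qed.

End density.

(** * Invariant subspaces *)

Section classification.
Variable R : realType.
Local Notation C := R[i].
Variables (P : R -> R) (D : R).
Hypothesis P_ge0 : forall r : R, 0 <= r -> 0 <= P r.
Hypothesis D_ge1 : 1 <= D.
Hypothesis P_shift : forall r : R, 0 <= r -> P (r + 1) <= D * (P r + 1).
Hypothesis P_super : forall k : R, exists c : R, forall r : R, 0 <= r -> k * r - c <= P r.

(* [Qu] stands for "for all a > 0" on [Ap0] and for "there is a > 0" on [Ap]. *)
Variables (E : preTopologicalLmodType C) (ev : E -> C -> C) (Qu : (R -> Prop) -> Prop).
Hypothesis Qu_scale : forall (k : R) (X Y : R -> Prop), 0 < k ->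
  (forall a : R, 0 < a -> X a -> Y (k * a)) -> Qu X -> Qu Y.
Hypothesis Qu_all : forall X : R -> Prop, (forall a : R, 0 < a -> X a) -> Qu X.
Hypothesis ev_inj : injective ev.
Hypothesis evP : forall a f g z, ev (a *: f + g) z = a * ev f z + ev g z.
Hypothesis ev_hol : forall f z, hol (ev f) z.
Hypothesis ev_dom : forall f, Qu (fun a => exists2 B : R, 0 < B & dominated P (ev f) B a).
Hypothesis ev_surj : forall f, (forall z, hol f z) ->
  Qu (fun a => exists2 B : R, 0 < B & dominated P f B a) -> exists u, ev u = f.
Hypothesis ev_closed : forall (M : set E) u, closed M ->
  Qu (fun a => forall eps : R, 0 < eps ->
    exists2 v, M v & dominated P (fun z => ev v z - ev u z) eps a) -> M u.

Lemma ev0 z : ev 0 z = 0.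
Proof. by have := evP (-1) 0 0 z; rewrite scaleN1r addNr mulN1r addNr. Qed.

Lemma ev_sum n (h : nat -> C) (F : nat -> E) z :
  ev (\sum_(i < n) h i *: F i) z = \sum_(i < n) h i * ev (F i) z.
Proof.
elim: n => [|n IH]; first by rewrite !big_ord0 ev0.
by rewrite !big_ord_recr/= addrC evP IH addrC.
Qed.

Lemma subspace_sum (M : set E) n (h : nat -> C) (F : nat -> E) : subspace_set M ->
  (forall i, (i < n)%N -> h i = 0 \/ M (F i)) -> M (\sum_(i < n) h i *: F i).
Proof.
move=> [M0 MD]; elim: n => [|n IH] hF; first by rewrite big_ord0.
have {}IH : M (\sum_(i < n) h i *: F i) by apply: IH => i iltn; apply: hF; rewrite ltnW.
rewrite big_ord_recr/=; have [->|Fn] := hF n (ltnSn n); first by rewrite scale0r addr0.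
by rewrite addrC; exact: MD.
Qed.

Lemma A_K_tcoef K u : A_K ev K u <-> forall k, (k < K)%N -> tcoef (ev u) k = 0.
Proof.
have E0 j : derive1n j (ev u) 0 = j`!%:R * tcoef (ev u) j.
  by apply: derive1n_at0 => //; exact: entire_pow.
split=> h k kK; have := h k kK; rewrite E0; last by move=> ->; rewrite mulr0.
by move=> /eqP; rewrite mulf_eq0 pnatr_eq0 -[_`! == _]negbK -lt0n fact_gt0 => /eqP.
Qed.

(** Times k!, both sides are the k-th derivative at 0 of the same function, computed from two
    expansions. *)
Lemma tcoef_ev a f g k : tcoef (ev (a *: f + g)) k = a * tcoef (ev f) k + tcoef (ev g) k.
Proof.
have p1 := entire_pow (ev_hol (a *: f + g)).
have p2 := powD (powZ a (entire_pow (ev_hol f))) (entire_pow (ev_hol g)).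
have fact_neq0 : k`!%:R != 0 :> C by rewrite pnatr_eq0 -lt0n fact_gt0.
apply: (mulfI fact_neq0); rewrite -(derive1n_at0 k (ev_hol _) p1).
have E1 : ev (a *: f + g) = (fun z => a * ev f z) \+ ev g by apply/funext => z; rewrite evP.
rewrite -E1 in p2; exact: (derive1n_at0 k (ev_hol _) p2).
Qed.

Lemma monomial_ev K : exists u, ev u = fun z => K`!%:R^-1 * z ^+ K.
Proof.
apply: ev_surj => [z|]; first by apply: holM; [exact: hol_cst|exact: holX].
apply: Qu_all => a a0; have [B B0 hB] := dominated_monomial P_super K a0.
exists B => // z; rewrite cabsM; apply: le_trans (hB z).
rewrite ler_piMl ?cabs_ge0// cabsV cabs_nat invf_le1 ?ltr0n ?fact_gt0//.
by rewrite ler1n fact_gt0.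
Qed.

Lemma J_monomial K : J (fun z : C => K`!%:R^-1 * z ^+ K) = fun z => K.+1`!%:R^-1 * z ^+ K.+1.
Proof.
have hK z : hol (fun z : C => K`!%:R^-1 * z ^+ K) z by apply: holM; [exact: hol_cst|exact: holX].
apply: pow_inj (J_pow hK (powZ (K`!%:R^-1) (@powX R K))) _.
apply: pow_eq (powZ (K.+1`!%:R^-1) (@powX R K.+1)) _ => -[|k] /=; first by rewrite mulr0.
rewrite eqSS; case: eqP => [->|_]; last by rewrite !mulr0 mul0r.
by rewrite factS natrM invfM !mulr1 mulrC.
Qed.

Lemma classification : only_A_K_invariant ev.
Proof.
move=> M [sM Mn0 MnT] cM JM; have [M0 MD] := sM.
have [K0 MK0] : exists K, exists2 u, M u & tcoef (ev u) K <> 0.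
  apply: contrapT => none; apply: Mn0; apply/seteqP; split=> [u Mu|u ->//].
  apply: ev_inj; apply: pow_inj (entire_pow (ev_hol u)) _.
  apply: pow_eq (entire_pow (ev_hol 0)) _ => k.
  have t0 v : M v -> tcoef (ev v) k = 0.
    by move=> Mv; apply: contrapT => vk; apply: none; exists k, v.
  by rewrite !t0.
pose S K := `[< exists2 u, M u & tcoef (ev u) K <> 0 >].
have exS : exists K, S K by exists K0; apply/asboolP.
case: (ex_minnP exS) => K /asboolP[f0 Mf0 f0K] minK.
have lowM u k : M u -> (k < K)%N -> tcoef (ev u) k = 0.
  move=> Mu kK; apply: contrapT => uk; move: kK; rewrite ltnNge minK//.
  by apply/asboolP; exists u.
(* Invariance only places [J (ev u)] in the image of [M]; choosing preimages makes [J] iterable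
   inside [M]. *)
have [nx hnx] : exists nx : E -> E, forall u, M u -> M (nx u) /\ ev (nx u) = J (ev u).
  suff /choice[nx h] : forall u, exists v, M u -> M v /\ ev v = J (ev u) by exists nx.
  move=> u; have [Mu|nMu] := pselect (M u); last by exists u.
  have [v Mv vu] : (ev @` M) (J (ev u)) by apply: JM; exists (ev u) => //; exists u.
  by exists v.
have fact_neq0 : K`!%:R != 0 :> C by rewrite pnatr_eq0 -lt0n fact_gt0.
pose f := (K`!%:R * tcoef (ev f0) K)^-1 *: f0 + 0.
have Mf : M f by exact: MD.
have fK : K`!%:R * tcoef (ev f) K = 1.
  rewrite tcoef_ev (_ : tcoef (ev 0) K = 0) ?addr0.
    by field; rewrite fact_neq0 andbT; apply/eqP.
  have := tcoef_ev (-1) 0 0 K; rewrite scaleN1r addNr.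
  by rewrite mulN1r addNr.
pose F i := iter i nx f.
have MF i : M (F i) by elim: i => //= i /hnx[].
have [e eE] := choice monomial_ev.
have Me m : (K <= m)%N -> M (e m).
  move=> /subnK <-; elim: (m - K)%N => [|d IH]; rewrite ?add0n.
    have D18 : 0 < 18 * D by rewrite mulr_gt0// (lt_le_trans _ D_ge1).
    (* The lowest monomial is a limit of combinations of the J^i f; the higher ones follow by
       applying [J]. *)
    apply: ev_closed cM _; apply: (@Qu_scale _ _ _ D18 _ (ev_dom f)).
    move=> a a0 [B B0 fB] eps e0.
    have [n [h hh]] := monomial_approx P_ge0 D_ge1 P_shift P_super B0 a0 e0
      (fun i => ev_hol (F i)) (fun i => (hnx _ (MF i)).2) fB (fun k => lowM f k Mf) fK.
    exists (\sum_(i < n) h i *: F i); first by apply: (@subspace_sum M n h F sM) => i _; right.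
    by move=> z; rewrite ev_sum eE (_ : 18 * D * a = 18 * (a * D)) ?hh//; ring.
  rewrite addSn; have [Mn En] := hnx _ IH.
  by rewrite (_ : e (d + K).+1 = nx (e (d + K)%N))//; apply: ev_inj; rewrite En !eE J_monomial.
have AM : A_K ev K `<=` M.
  move=> u /A_K_tcoef uK; have D3 : 0 < 3 * D by rewrite mulr_gt0// (lt_le_trans _ D_ge1).
  apply: ev_closed cM _; apply: (@Qu_scale _ _ _ D3 _ (ev_dom u)).
  move=> a a0 [B B0 uB] eps e0.
  have [N hN] := taylor_dense P_ge0 D_ge1 P_shift P_super B0 a0 e0 (ev_hol u) uB.
  exists (\sum_(k < N) (tcoef (ev u) k * k`!%:R) *: e k).
    apply: (@subspace_sum M N (fun k => tcoef (ev u) k * k`!%:R) e sM) => k _.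
    by have [kK|Kk] := ltnP k K; [left; rewrite uK ?mul0r|right; exact: Me].
  move=> z; rewrite (ev_sum N (fun k => tcoef (ev u) k * k`!%:R)) cabsBC.
  rewrite (eq_bigr (fun k : 'I_N => tcoef (ev u) k * z ^+ k)) => [|k _].
    by rewrite (_ : 3 * D * a = 3 * (a * D)) ?hN//; ring.
  by rewrite eE mulrA mulfK// pnatr_eq0 -lt0n fact_gt0.
have MA : M `<=` A_K ev K by move=> u Mu; apply/A_K_tcoef => k; exact: lowM.
exists K; last by apply/seteqP; split.
(* For K = 0 there is no vanishing condition, so [M] would be the whole space. *)
rewrite lt0n; apply/eqP => K0'; apply: MnT; apply/seteqP; split=> // u _.
by apply: AM => j; rewrite K0'.
Qed.

End classification.

(** * Closed sets in the two topologies *)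

Section closure.
Variable R : realType.
Local Notation C := R[i].

Lemma dominated_weighted (P : R -> R) (p : C -> R) f (a : R) : (forall z, p z = P (cabs z)) ->
  has_ubound (weighted f (fun z => a * p z)) <-> exists2 B : R, 0 < B & dominated P f B a.
Proof.
move=> pP; rewrite has_ubound_weightedP; split=> [[B hB]|[B B0 hB]]; last first.
  by exists B => z; rewrite expRN ler_pdivrMr ?expR_gt0// pP.
exists (Num.max 1 B); first by rewrite lt_max ltr01.
move=> z; have := hB z; rewrite expRN ler_pdivrMr ?expR_gt0// pP => /le_trans; apply.
by rewrite ler_wpM2r ?expR_ge0// le_max lexx orbT.
Qed.

Lemma step_cvg (q : C -> R) (d : nat -> step q) (l : step q) :
  (forall e : R, 0 < e -> \forall j \near \oo, forall z, cabs (d j z - l z) * expR (- q z) <= e) ->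
  d j @[j --> \oo] --> l.
Proof.
move=> h; apply/cvgrPdist_le => -[e e']; rewrite ltcE/= => /andP[/eqP-> e0].
have {h} := h e e0; apply: filterS => j hj.
rewrite -[`|_|]/((step_norm (l - d j))%:C%C) -[(e +i* 0)%C]/(e%:C%C) lecR.
apply: step_norm_le => z; apply: le_trans (hj z).
by rewrite -[(l - d j : step q) z]/(l z - d j z) cabsBC.
Qed.

Variables (P : R -> R) (D : R).
Hypothesis P_ge0 : forall r : R, 0 <= r -> 0 <= P r.
Hypothesis D_ge1 : 1 <= D.
Hypothesis P_shift : forall r : R, 0 <= r -> P (r + 1) <= D * (P r + 1).
Hypothesis P_super : forall k : R, exists c : R, forall r : R, 0 <= r -> k * r - c <= P r.

Variable p : C -> R.
Hypothesis pP : forall z, p z = P (cabs z).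

(** A diagonal sequence, with exponent and error both 1 / (j + 1), converges in every step of the
    projective limit. *)
Lemma Ap0_closed (M : set (Ap0 p)) (u : Ap0 p) : closed M ->
  (forall a : R, 0 < a -> forall eps : R, 0 < eps ->
    exists2 v : Ap0 p, M v & dominated P (fun z => v z - u z) eps a) -> M u.
Proof.
move=> cM hM.
have /choice[v hv] : forall j : nat, exists v : Ap0 p,
    M v /\ dominated P (fun z => v z - u z) (j.+1%:R^-1) (j.+1%:R^-1).
  move=> j; have j0 : 0 < j.+1%:R^-1 :> R by rewrite invr_gt0.
  by have [v Mv hv] := hM _ j0 _ j0; exists v.
have FF : Filter (v j @[j --> \oo]) by exact: fmap_filter.
have vu : v j @[j --> \oo] --> u.
  apply/(@cvg_sup (Ap0 p) nat) => i A /=.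
  rewrite (@nbhsE (initial_topology (@Ap0_incl R p i))) => -[_ [[B oB <-] Bu] BA].
  have vi : (Ap0_incl i (v j)) @[j --> \oo] --> Ap0_incl i u.
    apply: step_cvg => e e0.
    near=> j => z.
    have ij : (i <= j)%N by near: j; exists i.
    have je : j.+1%:R^-1 <= e by apply: ltW; near: j; exact: near_infty_natSinv_lt (PosNum e0).
    apply: le_trans je; rewrite expRN ler_pdivrMr ?expR_gt0//.
    apply: le_trans ((hv j).2 z) _; rewrite ler_wpM2l ?invr_ge0// ler_expR pP.
    by rewrite ler_wpM2r ?P_ge0 ?cabs_ge0// lef_pV2 ?posrE// ler_nat ltnS.
  have /vi : nbhs (Ap0_incl i u) B by apply: open_nbhs_nbhs.
  move=> nB; exact: (@filterS _ (v j @[j --> \oo]) _ _ _ BA nB).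
have Mv : \forall j \near \oo, M (v j) by apply: nearW => j; have [] := hv j.
exact: (@closed_cvg _ _ _ _ v M cM Mv u vu).
Unshelve. all: by end_near. Qed.

Lemma Ap0_classification : only_A_K_invariant (@Ap0_val R p : Ap0 p -> C -> C).
Proof.
pose Qu (X : R -> Prop) := forall a : R, 0 < a -> X a.
apply: (@classification R P D P_ge0 D_ge1 P_shift P_super (Ap0 p) (@Ap0_val R p) Qu) => //.
- move=> k X Y k0 XY hX a a0; rewrite (_ : a = k * (a / k)).
    by apply: XY; [|apply: hX]; rewrite divr_gt0.
  by field; rewrite gt_eqF.
- exact: val_inj.
- by move=> [f /=]; rewrite inE => -[/entireP].
- by move=> [f /=]; rewrite inE => -[_ hf] a a0; apply/(dominated_weighted _ _ pP)/hf.
- move=> f hf hQ; have h : f \in Ap0_pred p.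
    rewrite inE; split; first exact/entireP.
    by move=> a a0; apply/(dominated_weighted _ _ pP)/hQ.
  by exists (MkAp0 h).
- exact: Ap0_closed.
Qed.

Hypothesis p_ge0 : forall z, 0 <= p z.

(** With the exponent fixed, all differences v_j - u lie in one Banach step, even if u and the v_j
    do not, and tend to 0 there. Continuity of the inclusion and of addition carries this over to
    the inductive limit. *)
Lemma Ap_closed (M : set (Ap p_ge0)) (u : Ap p_ge0) : closed M ->
  (exists2 a : R, 0 < a & forall eps : R, 0 < eps ->
    exists2 v : Ap p_ge0, M v & dominated P (fun z => v z - u z) eps a) -> M u.
Proof.
move=> cM [a a0 hM].
have /choice[v hv] : forall j : nat, exists v : Ap p_ge0,
    M v /\ dominated P (fun z => v z - u z) (j.+1%:R^-1) a.
  move=> j; have j0 : 0 < j.+1%:R^-1 :> R by rewrite invr_gt0.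
  by have [v Mv hv] := hM _ j0; exists v.
pose n := Num.truncn a.
have an : a <= n.+1%:R by have /andP[_ /ltW] := truncn_itv (ltW a0).
have bound j z : cabs (v j z - u z) * expR (- (n.+1%:R * p z)) <= j.+1%:R^-1.
  rewrite expRN ler_pdivrMr ?expR_gt0//; apply: le_trans ((hv j).2 z) _.
  by rewrite ler_wpM2l ?invr_ge0// ler_expR pP ler_wpM2r ?P_ge0 ?cabs_ge0.
have hd j : (fun z => v j z - u z) \in step_pred (fun z : C => n.+1%:R * p z).
  rewrite inE; split; last by apply/has_ubound_weightedP; exists j.+1%:R^-1; exact: bound.
  have : Ap_val (v j - u) \in Ap_pred p by case: (v j - u).
  by rewrite inE => -[].
pose d j : Ap_step p n := Step (hd j).
have d0 : d j @[j --> \oo] --> (0 : Ap_step p n).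
  apply: step_cvg => e e0; near=> j => z.
  have je : j.+1%:R^-1 <= e by apply: ltW; near: j; exact: near_infty_natSinv_lt (PosNum e0).
  by apply: le_trans je; rewrite -[(0 : Ap_step p n) z]/(0 : C) subr0; exact: bound.
have [[addC _ _] incl] := Ap_topology_admissible p_ge0.
have i0 : Ap_incl p_ge0 (d j) @[j --> \oo] --> Ap_incl p_ge0 (0 : Ap_step p n).
  by apply: cvg_comp d0 _; exact: (incl n 0).
have vu : v j @[j --> \oo] --> u.
  have -> : v = fun j => Ap_incl p_ge0 (d j) + u.
    by apply/funext => j; apply: val_inj; apply/funext => z; rewrite /= -[RHS]/(v j z - u z + u z) subrK.
  have {2}-> : u = Ap_incl p_ge0 (0 : Ap_step p n) + u.
    by apply: val_inj; apply/funext => z; rewrite -[RHS]/(0 + u z) add0r.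
  have := addC (Ap_incl p_ge0 (0 : Ap_step p n), u).
  move=> h; exact: (@cvg_comp _ _ _ (fun j => (Ap_incl p_ge0 (d j), u)) (fun x : Ap p_ge0 * Ap p_ge0 => x.1 + x.2) _ _ _ (cvg_pair i0 (cvg_cst u)) h).
have Mv : \forall j \near \oo, M (v j) by apply: nearW => j; have [] := hv j.
exact: (@closed_cvg _ _ _ _ v M cM Mv u vu).
Unshelve. all: by end_near. Qed.

Lemma Ap_classification : only_A_K_invariant (@Ap_val R p p_ge0 : Ap p_ge0 -> C -> C).
Proof.
pose Qu (X : R -> Prop) := exists2 a : R, 0 < a & X a.
apply: (@classification R P D P_ge0 D_ge1 P_shift P_super (Ap p_ge0) (@Ap_val R p p_ge0) Qu) => //.
- by move=> k X Y k0 XY [a a0 Xa]; exists (k * a); [exact: mulr_gt0|exact: XY].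
- by move=> X hX; exists 1 => //; exact: hX.
- exact: val_inj.
- by move=> [f /=]; rewrite inE => -[/entireP].
- by move=> [f /=]; rewrite inE => -[_ [a a0 hf]]; exists a => //; apply/(dominated_weighted _ _ pP).
- move=> f hf [a a0 hQ]; have h : f \in Ap_pred p.
    rewrite inE; split; first exact/entireP.
    by exists a => //; apply/(dominated_weighted _ _ pP).
  by exists (MkAp p_ge0 h).
- exact: Ap_closed.
Qed.

Lemma J_classified : J_subspaces_classified p_ge0.
Proof. by split; [exact: Ap0_classification|exact: Ap_classification]. Qed.

End closure.

(** * Weights *)

Section weights.
Variable R : realType.
Local Notation C := R[i].

Lemma exp_weight_super (k : R) : exists c : R, forall r : R, 0 <= r -> k * r - c <= expR r.
Proof.
have [k0|k0] := lerP k 0.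
  by exists 0 => r r0; rewrite subr0 (le_trans _ (expR_ge0 _))// mulr_le0_ge0.
(* The tangent of the exponential at ln k, which has slope k. *)
exists (k * ln k) => r r0; have := expR_ge1Dx (r - ln k).
rewrite expRB lnK ?posrE// ler_pdivlMr// => h; apply: le_trans h; lra.
Qed.

Lemma power_weight_shift (a s r : R) : 0 < a -> 1 < s -> 0 <= r ->
  a * ((r + 1) `^ s) <= 2 `^ s * (1 + a) * (a * (r `^ s) + 1).
Proof.
move=> a0 s1 r0; have s0 : 0 <= s by rewrite ltW// (lt_trans ltr01).
have h : (r + 1) `^ s <= 2 `^ s * (r `^ s + 1).
  have [r1|r1] := lerP r 1.
    apply: (@le_trans _ _ (2 `^ s)); last by rewrite ler_peMr ?powR_ge0// lerDr powR_ge0.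
    by apply: ge0_ler_powR; rewrite ?nnegrE//; lra.
  apply: (@le_trans _ _ ((2 * r) `^ s)); first by apply: ge0_ler_powR; rewrite ?nnegrE//; lra.
  by rewrite powRM// ler_wpM2l ?powR_ge0// lerDl.
apply: le_trans (ler_wpM2l (ltW a0) h) _.
rewrite mulrCA -mulrA ler_wpM2l ?powR_ge0//.
have x0 : 0 <= r `^ s := powR_ge0 _ _.
have := mulr_ge0 (ltW a0) (mulr_ge0 (ltW a0) x0); lra.
Qed.

Lemma power_weight_super (a s k : R) : 0 < a -> 1 < s ->
  exists c : R, forall r : R, 0 <= r -> k * r - c <= a * (r `^ s).
Proof.
move=> a0 s1; have s0 : 0 < s - 1 by rewrite subr_gt0.
(* The solution of a r^(s - 1) = |k|. *)
pose r0 := (`|k| / a) `^ (s - 1)^-1.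
have ka0 : 0 <= `|k| / a by rewrite divr_ge0// ltW.
exists (`|k| * r0) => r r_ge0.
have kr : k * r <= `|k| * r by rewrite ler_wpM2r// ler_norm.
have [rr|rr] := leP r r0.
  apply: (@le_trans _ _ 0); last by rewrite mulr_ge0 ?powR_ge0// ltW.
  by rewrite subr_le0 (le_trans kr)// ler_wpM2l.
rewrite -(mulr_powRB1 r_ge0) ?(lt_trans ltr01)//.
apply: (@le_trans _ _ (`|k| * r)).
  by rewrite lerBlDr (le_trans kr)// lerDl mulr_ge0 ?powR_ge0.
rewrite mulrCA mulrC ler_wpM2l// -ler_pdivrMl// mulrC.
have -> : `|k| / a = r0 `^ (s - 1) by rewrite /r0 -powRrM mulVf ?powRr1// gt_eqF.
by apply: ge0_ler_powR; rewrite ?nnegrE ?powR_ge0 ?(ltW rr) ?(ltW s0).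
Qed.

Lemma real_complex_continuous : continuous (fun r : R => r%:C%C : C).
Proof.
move=> t; apply/cvgrPdist_lt => -[e e']; rewrite ltcE/= => /andP[/eqP-> e0].
near=> s; rewrite -rmorphB/= normcE cabs_real -[(e +i* 0)%C]/(e%:C%C) ltcR.
by near: s; exact: (@cvgr_dist_lt _ _ _ _ _ id t _ _ e0).
Unshelve. all: by end_near. Qed.

Section weight_exponent.
Variable p : C -> R.
Hypotheses (hp : weight_exponent p) (dp : radially_differentiable p).
Hypothesis p'oo : derive1 (radial_part p) r @[r --> +oo] --> +oo.

Local Notation P := (radial_part p).

Lemma radial_part_slope (k : R) : exists2 r0 : R, 0 < r0 &
  forall r s, r0 <= r -> r <= s -> k * (s - r) <= P s - P r.
Proof.
have /cvgryPge/(_ k) [M [_ hM]] := p'oo.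
exists (Num.max 1 (M + 1)); first by rewrite lt_max ltr01.
move=> r s; rewrite ge_max => /andP[r1 rM]; rewrite le_eqVlt => /predU1P[->|rs].
  by rewrite !subrr mulr0.
have dP x : r <= x -> derivable P x 1 by move=> rx; apply: dp.1; apply: lt_le_trans rx; rewrite (lt_le_trans _ r1).
have [||c /[!in_itv]/= /andP[rc cs] ->] := @MVT R P (derive1 P) r s rs.
- move=> x /[!in_itv]/= /andP[rx xs]; rewrite derive1E; apply: derivableP; apply: dP; exact: ltW.
- apply: derivable_within_continuous => x /[!in_itv]/= /andP[rx _]; exact: dP.
rewrite ler_wpM2r ?subr_ge0 ?(ltW rs)//; apply: hM; apply: lt_trans rc; lra.
Qed.

Lemma weight_super (k : R) : exists c : R, forall r : R, 0 <= r -> k * r - c <= P r.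
Proof.
have [r0 r00 h] := radial_part_slope k; exists (`|k| * r0) => r r_ge0.
have Pge0 x : 0 <= P x by exact: ltW (weight_gt0 hp _).
have [rr|rr] := lerP r r0.
  apply: le_trans (Pge0 r); rewrite subr_le0.
  by apply: (@le_trans _ _ (`|k| * r)); [rewrite ler_wpM2r// ler_norm|rewrite ler_wpM2l].
have := h r0 r (lexx _) (ltW rr); have := Pge0 r0.
have : k * r0 <= `|k| * r0 by rewrite ler_wpM2r ?(ltW r00)// ler_norm.
lra.
Qed.

(** For large r, [P] is nondecreasing and r + 1 <= 2 r, so doubling applies; on the remaining
    compact interval, the maximum of [P] is absorbed by the summand 1. *)
Lemma weight_shift : exists2 D : R, 1 <= D & forall r : R, 0 <= r -> P (r + 1) <= D * (P r + 1).
Proof.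
have Pge0 x : 0 <= P x by exact: ltW (weight_gt0 hp _).
have [r0 r00 h] := radial_part_slope 0.
have [c [m hc]] := weight_doubling hp.
pose r1 := Num.max 1 (Num.max r0 (m + 1)).
have cP : continuous P.
  move=> t; apply: (@continuous_comp _ _ _ (fun r : R => r%:C%C : C) p).
    exact: real_complex_continuous.
  exact: (weight_continuous hp).
have r11 : 0 <= r1 + 1 by rewrite addr_ge0// le_max ler01.
have [t _ ht] := EVT_max r11 (continuous_subspaceT cP).
exists (Num.max 1 (Num.max c (P t))); first by rewrite le_max lexx.
set D := Num.max _ _ => r r_ge0.
have D1 : 1 <= D by rewrite le_max lexx.
have D0 : 0 <= D by apply: le_trans D1.
have [rr|rr] := leP r r1.
  apply: (@le_trans _ _ D); last by rewrite ler_peMr// lerDr.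
  apply: (@le_trans _ _ (P t)); last by rewrite !le_max lexx !orbT.
  by apply: ht; rewrite in_itv/= addr_ge0//= lerD2r.
have [r1r r0r mr] : [/\ 1 < r, r0 < r & m + 1 < r].
  by split; apply: le_lt_trans rr; rewrite !le_max lexx ?orbT.
apply: (@le_trans _ _ (P (2 * r))).
  have := h (r + 1) (2 * r); rewrite mul0r subr_ge0; apply; lra.
apply: (@le_trans _ _ (c * P r)).
  have := hc r%:C%C; rewrite cabs_real ger0_norm// => /(_ (lt_trans _ mr)).
  rewrite /radial_part rmorphM/= (_ : 2%:C%C = 2 :> C); first by apply; rewrite ltrDl.
  by rewrite -(rmorph_nat (real_complex R)).
apply: (@le_trans _ _ (D * P r)); first by rewrite ler_wpM2r// !le_max lexx orbT.
by rewrite ler_wpM2l// lerDl.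
Qed.

End weight_exponent.
End weights.

Theorem theorem5p1 (R : realType) :
  (forall (p : R[i] -> R) (hp : weight_exponent p),
     radially_differentiable p ->
     derive1 (radial_part p) r @[r --> +oo] --> +oo ->
     J_subspaces_classified (weight_ge0 hp)) /\
  (forall (a s : R) (a0 : 0 < a), 1 < s ->
     J_subspaces_classified (power_weight_ge0 s a0)) /\
  J_subspaces_classified (@exp_weight_ge0 R).
Proof.
split; [|split].
- move=> p hp dp p'oo; have [D D1 PD] := weight_shift hp dp p'oo.
  apply: (@J_classified R (radial_part p) D) => //.
  + by move=> r _; exact: ltW (weight_gt0 hp _).
  + exact: weight_super.
  + exact: weight_radial hp.
- move=> a s a0 s1.
  apply: (@J_classified R (fun r => a * (r `^ s)) (2 `^ s * (1 + a))) => //.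
  + by move=> r _; rewrite mulr_ge0 ?powR_ge0// ltW.
  + have h2 : 1 <= 2 `^ s :> R.
      apply: (@le_trans _ _ (2 `^ 0)); first by rewrite powRr0.
      by apply: ler_powR; [rewrite ler1n|rewrite ltW// (lt_trans ltr01)].
    by rewrite -[leLHS]mulr1 ler_pM// lerDl ltW.
  + by move=> r r0; exact: power_weight_shift.
  + by move=> k; exact: power_weight_super.
(* Here e^(r + 1) = e * e^r yields the shift condition, although e^r is not doubling. *)
- apply: (@J_classified R expR (expR 1)) => //.
  + by rewrite -expR0 ler_expR.
  + by move=> r r0; rewrite expRD mulrC ler_wpM2l ?expR_ge0// lerDl.
  + exact: exp_weight_super.
Qed.
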